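(* Let $A>0$ be a constant and let $K'(x)=-\frac{A}{2}H(x)+V(x)$ for $x\in\mathbb{R}$, where $H$ is the sign function and $V\in W^{1,1}(\mathbb{R})$ satisfies $\|V_x\|_1<A$. Let $u_0\in L^1(\mathbb{R})$ be nonnegative with $\int_{\mathbb{R}}u_0(x)\,dx=1$. Let $\varepsilon\ge0$ and, in the case $\varepsilon=0$, assume in addition that $\int_{\mathbb{R}}u_0(x)|x|\,dx<\infty$. Let $u=u(x,t)$ be the solution (in the sense specified in the context for $\varepsilon>0$ and for $\varepsilon=0$) of $$u_t=\varepsilon u_{xx}+\left(u\,(K'*u)\right)_x\quad (x\in\mathbb{R},\ t>0),\qquad u(x,0)=u_0(x)\quad (x\in\mathbb{R}).$$ For $\lambda>0$ define $u^\lambda(x,t)=\lambda u(\lambda x,\lambda t)$, $x\in\mathbb{R}$, $t>0$. Then for every test function $\varphi\in C_c^\infty(\mathbb{R})$ and each $t_0>0$, $$\int_{\mathbb{R}}u^\lambda(x,t_0)\varphi(x)\,dx\longrightarrow-\int_{\mathbb{R}}W^R(x,t_0)\varphi_x(x)\,dx\quad\text{as }\lambda\to+\infty,$$ where $$W^R(x,t)=\begin{cases}-\frac12 & \text{for } x\le-\frac{At}{2},\\ \frac{x}{At} & \text{for } -\frac{At}{2}<x<\frac{At}{2},\\ \frac12 & \text{for } x\ge\frac{At}{2}.\end{cases}$$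
   Context: $\|\cdot\|_p$ is the norm of $L^p(\mathbb{R})$ in the space variable $x$ (with $\frac1p=0$ for $p=\infty$); $*$ is convolution in $x$, $(f*g)(x)=\int_{\mathbb{R}}f(x-y)g(y)\,dy$. The sign function is $H(x)=-1$ for $x<0$ and $H(x)=1$ for $x>0$. The symbol $K'$ denotes a given function (the interaction kernel). Case $\varepsilon>0$: ''solution'' means the unique global-in-time solution, known to exist, in the class $u\in C([0,\infty),L^1(\mathbb{R}))\cap C((0,\infty),W^{1,1}(\mathbb{R}))\cap C^1((0,\infty),L^1(\mathbb{R}))$; for nonnegative $u_0$ it is known to be nonnegative and to satisfy $\int_{\mathbb{R}}u(x,t)\,dx=\int_{\mathbb{R}}u_0(x)\,dx$. Case $\varepsilon=0$: the solution is $u=U_x$, where $U\in C(\mathbb{R}\times(0,\infty))$, $U_x\in L^\infty_{loc}((0,\infty),L^\infty(\mathbb{R}))$, is a weak solution of $U_t=-AUU_x+U_x\,(V*U_x)$, $U(x,0)=U_0(x)=\int_{-\infty}^x u_0(y)\,dy-\frac12$, in the sense that $$-\int_0^\infty\!\!\int_{\mathbb{R}}U\varphi_t\,dx\,dt-\int_{\mathbb{R}}U_0(x)\varphi(x,0)\,dx=\frac A2\int_0^\infty\!\!\int_{\mathbb{R}}U^2\varphi_x\,dx\,dt+\int_0^\infty\!\!\int_{\mathbb{R}}U_x\,(V_x*U)\,\varphi\,dx\,dt$$ for all $\varphi\in C_c^\infty(\mathbb{R}\times[0,\infty))$, and which satisfies, for some constant $C>0$, the estimate $\|U(\cdot,t)-W^R(\cdot,t)\|_p\le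 C\,t^{-\frac12(1-\frac1p)}(\log(2+t))^{\frac12(1+\frac1p)}$ for all $t>0$ and $p\in(1,\infty]$ (such a weak solution exists under the stated assumptions). *)

(* Defs.v *)
From HB Require Import structures.
From mathcomp Require Import all_boot all_order all_algebra.
From mathcomp Require Import all_classical all_reals all_analysis.

Set Implicit Arguments.
Unset Strict Implicit.
Unset Printing Implicit Defensive.

Import Order.TTheory GRing.Theory Num.Theory.
Import numFieldNormedType.Exports.

Local Open Scope classical_set_scope.
Local Open Scope ring_scope.

(* A function of space and time is a curried map [u : R -> R -> R], with
   [u x t] its value at the point [x] and the time [t]. *)

Definition L1 (R : realType) (f : R -> R) : Prop :=
  (@lebesgue_measure R).-integrable setT (EFin \o f).

Definition Lpnorm (R : realType) (p : \bar R) (f : R -> R) : \bar R :=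
  ('N[@lebesgue_measure R]_p [EFin \o f])%E.

(* C_c^oo(R) *)
Definition test_function (R : realType) (phi : R -> R) : Prop :=
  (forall (n : nat) (x : R), derivable (derive1n n phi) x 1) /\
  compact (closure [set x | phi x != 0]).

(* C_c^oo(R * R), for pairs (x, t): every iterated directional derivative is
   continuous and can be differentiated again.  The elements of
   C_c^oo(R * [0, +oo[) are the restrictions of such functions to t >= 0. *)
Definition test_function2 (R : realType) (phi : R * R -> R) : Prop :=
  (forall vs : seq (R * R),
     let psi := foldr (fun v g => (fun p => 'D_v g p)) phi vs in
     continuous psi /\ forall p v : R * R, derivable psi p v) /\
  compact (closure [set p | phi p != 0]).

Definition weak_derivative (R : realType) (f g : R -> R) : Prop :=
  [/\ locally_integrable setT f, locally_integrable setT g &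
      forall phi : R -> R, test_function phi ->
        \int[@lebesgue_measure R]_x (g x * phi x) =
        - \int[@lebesgue_measure R]_x (f x * derive1 phi x)].

(* f is in W^{1,1}(R), with weak derivative g *)
Definition W11 (R : realType) (f g : R -> R) : Prop :=
  [/\ L1 f, L1 g & weak_derivative f g].

Definition conv (R : realType) (f g : R -> R) (x : R) : R :=
  \int[@lebesgue_measure R]_y (f (x - y) * g y).

(* The value given to K' at 0 (here V 0, as Num.sg 0 = 0) is irrelevant. *)
Definition kernel' (R : realType) (A : R) (V : R -> R) (x : R) : R :=
  - (A / 2) * Num.sg x + V x.

(* u is in C(D, L^1(R)), for a set D of times *)
Definition C_L1 (R : realType) (D : set R) (u : R -> R -> R) : Prop :=
  forall s : R, D s ->
    L1 (u^~ s) /\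
    Lpnorm 1%E (fun x => u x t - u x s) @[t --> within D (nbhs s)] --> 0%E.

(* u is in C(D, W^{1,1}(R)), with weak space derivative ux *)
Definition C_W11 (R : realType) (D : set R) (u ux : R -> R -> R) : Prop :=
  [/\ C_L1 D u, C_L1 D ux & forall t, D t -> weak_derivative (u^~ t) (ux^~ t)].

(* u is in C^1(D, L^1(R)), with time derivative ut, for an open D *)
Definition C1_L1 (R : realType) (D : set R) (u ut : R -> R -> R) : Prop :=
  [/\ C_L1 D u, C_L1 D ut &
      forall s, D s ->
        Lpnorm 1%E (fun x => (u x (s + h) - u x s) / h - ut x s)
          @[h --> 0^'] --> 0%E].

(* For t > 0 the equation u_t = (eps u_x + u (K' * u))_x holds between elements
   of L^1(R), the x-derivative on the right being the weak one. *)
Definition viscous_solution (R : realType) (A : R) (V : R -> R) (eps : R)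
    (u0 : R -> R) (u : R -> R -> R) : Prop :=
  exists ux ut : R -> R -> R,
    [/\ C_L1 `[0, +oo[ u, C_W11 `]0, +oo[ u ux, C1_L1 `]0, +oo[ u ut,
        forall t, 0 < t ->
          weak_derivative
            (fun x => eps * ux x t + u x t * conv (kernel' A V) (u^~ t) x)
            (ut^~ t) &
        {ae @lebesgue_measure R, forall x, u x 0 = u0 x}].

Definition WR (R : realType) (A x t : R) : R :=
  if x <= - (A * t / 2) then - 2^-1
  else if x < A * t / 2 then x / (A * t)
  else 2^-1.

Definition primitive0 (R : realType) (u0 : R -> R) (x : R) : R :=
  (\int[@lebesgue_measure R]_(y in `]-oo, x]) u0 y) - 2^-1.

Definition int_space_time (R : realType) (f : R -> R -> R) : R :=
  \int[@lebesgue_measure R]_(t in `]0, +oo[)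
    \int[@lebesgue_measure R]_x f x t.

Definition space_time_integrable (R : realType) (f : R -> R -> R) : Prop :=
  (@lebesgue_measure R \x @lebesgue_measure R)%E.-integrable
    (setT `*` `]0, +oo[) (fun p => (f p.1 p.2)%:E).

(* The weak formulation of
   U_t = - A U U_x + U_x (V * U_x), U(., 0) = primitive0 u0,
   in which u stands for U_x and Vx for V_x; the integrals over R * ]0, +oo[
   are required to converge absolutely, since divergent integrals would
   otherwise get a conventional value. *)
Definition weak_formulation (R : realType) (A : R) (Vx : R -> R)
    (u0 : R -> R) (U u : R -> R -> R) : Prop :=
  forall phi : R * R -> R, test_function2 phi ->
    let phi_x x t := 'D_(1, 0) phi (x, t) in
    let phi_t x t := 'D_(0, 1) phi (x, t) in
    let F1 x t := U x t * phi_t x t in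
    let F2 x t := U x t ^+ 2 * phi_x x t in
    let F3 x t := u x t * conv Vx (U^~ t) x * phi (x, t) in
    [/\ space_time_integrable F1, space_time_integrable F2,
        space_time_integrable F3 &
        - int_space_time F1
          - \int[@lebesgue_measure R]_x (primitive0 u0 x * phi (x, 0)) =
        A / 2 * int_space_time F2 + int_space_time F3].

(* u = U_x.  As U is continuous and U_x is locally bounded in time, U(., t) is
   Lipschitz for every t > 0; so u(., t) is required to be the weak derivative
   of U(., t) at every time, and not only at almost every time.
   In the decay estimate, [fine (p^-1)%E] is 1 / p, which is 0 for p = +oo. *)
Definition inviscid_solution (R : realType) (A : R) (Vx : R -> R)
    (u0 : R -> R) (u : R -> R -> R) : Prop :=
  exists U : R -> R -> R,
    [/\ {within setT `*` `]0, +oo[, continuous (fun p : R * R => U p.1 p.2)},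
        forall t, 0 < t -> weak_derivative (U^~ t) (u^~ t),
        (* U_x is in L^oo_loc(]0, +oo[, L^oo(R)) *)
        (forall a b, 0 < a -> a < b -> exists M : R,
          {ae @lebesgue_measure R, forall t, t \in `[a, b] ->
            (Lpnorm +oo (u^~ t) <= M%:E)%E}),
        weak_formulation A Vx u0 U u &
        exists2 C : R, 0 < C & forall (t : R) (p : \bar R),
          0 < t -> (1 < p)%E ->
          (Lpnorm p (fun x => (U x t - WR A x t)%R) <=
            (C * t `^ (- (2^-1 * (1 - fine (p^-1)%E)))
               * ln (2 + t) `^ (2^-1 * (1 + fine (p^-1)%E)))%:E)%E].

Definition is_solution (R : realType) (A : R) (V Vx : R -> R) (eps : R)
    (u0 : R -> R) (u : R -> R -> R) : Prop :=
  (0 < eps -> viscous_solution A V eps u0 u) /\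
  (eps = 0 -> inviscid_solution A Vx u0 u).

Definition rescale (R : realType) (lambda : R) (u : R -> R -> R) (x t : R) : R :=
  lambda * u (lambda * x) (lambda * t).

(* Main.v *)
Require Import Defs.
From HB Require Import structures.
From mathcomp Require Import all_boot all_order all_algebra.
From mathcomp Require Import all_classical all_reals all_analysis.
From mathcomp Require Import measurable_realfun ess_sup_inf.
From mathcomp Require Import ring lra.

(** Let [U] be the primitive of the density, centred so that it runs from -1/2 to
    1/2.  The rarefaction wave [W] is a function of [x / t], so substituting
    [lam * x] and integrating by parts ([rescaled_error]) reduces the theorem to
    showing that the mean of [|U - W|] over the scale [lam], at the time
    [lam * t0], tends to zero.  For [eps = 0] this is the decay estimate that is
    part of the definition of a solution, in the sup norm ([inviscid_limit]).

    For [eps > 0] the convergence is proved by an energy method.  By the lemma of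
    du Bois-Reymond ([weak_derivative_ac]) the density has a representative [v]
    that is absolutely continuous in space, and so has the flux, for which the
    equation reads [prim vt = eps * vx + v * vel v] with the velocity
    [vel v = - A * U + conv V v].  Integrating by parts against convex functions of [v]
    ([entropy_dissipation]) has two consequences.  Smoothed absolute values give a
    contraction of the L^1 norm; as the mass is conserved, [v] stays a probability
    density ([flow_ge0]).  The square gives [y' <= - (A - nrm Vx) * y ^+ 2] for the
    integral [y] of [v ^+ 2], which therefore tends to zero ([energy_decay]).

    Now [U] satisfies [U_t = eps * U_xx - A * U * U_x + U_x * conv V U_x] and [W]
    satisfies the Burgers equation [W_t = - A * W * W_x].  Let [E] be the integral
    of [(U - W) ^+ 2] against the weight [1 / (1 + (x / lam) ^+ 2)].  Since [U] and
    [W] are both nondecreasing, the Burgers part only decreases [E], up to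
    [A / (2 lam) * E] due to the weight; the viscosity contributes a term of order
    [1 / t + 1 / lam], and [V] at most [2 * nrm V * y] ([mod_energy_ineq]).  Over a
    time of length [lam * t0] the exponential factor in the lemma of Gronwall is
    bounded independently of [lam], while the errors, small after a fixed time
    [T0], add up to [o(lam)]; and at [T0] itself [E] is [o(lam)] because [U - W]
    vanishes at infinity.  Hence [E] is [o(lam)] at the time [lam * t0]
    ([mod_energy_small]), and Young's inequality turns this into the smallness of
    the mean of [|U - W|] ([viscous_limit]). *)

(* so that [conv] is the convolution, not the operation of convex spaces *)
Import Defs.

Set Implicit Arguments.
Unset Strict Implicit.
Unset Printing Implicit Defensive.

Import Order.TTheory GRing.Theory Num.Theory.
Import numFieldNormedType.Exports.

Local Open Scope classical_set_scope.
Local Open Scope ring_scope.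

(** * Integrable functions and bounded measurable functions *)

Section toolkit.
Context {R : realType}.
Local Notation mu := (@lebesgue_measure R).
Implicit Types (f g h : R -> R).

Definition bmf f := measurable_fun setT f /\ exists M, forall x, `|f x| <= M.

Definition nrm f := \int[mu]_x `|f x|.

Lemma L1_meas f : L1 f -> measurable_fun setT f.
Proof. by move=> /integrableP[/measurable_EFinP]. Qed.

Lemma L1_dom f g : measurable_fun setT f -> (forall x, `|f x| <= g x) ->
  L1 g -> L1 f.
Proof.
move=> mf fg; apply: le_integrable => //; first exact/measurable_EFinP.
by move=> x _ /=; rewrite lee_fin (le_trans (fg x)) // ler_norm.
Qed.

Lemma L1D f g : L1 f -> L1 g -> L1 (fun x => f x + g x).
Proof. by move=> hf hg; exact: (integrableD measurableT hf hg). Qed.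

Lemma L1N f : L1 f -> L1 (fun x => - f x).
Proof. by move=> hf; exact: (integrableN hf). Qed.

Lemma L1B f g : L1 f -> L1 g -> L1 (fun x => f x - g x).
Proof. by move=> hf hg; apply: L1D => //; exact: L1N. Qed.

Lemma L1_abs f : L1 f -> L1 (fun x => `|f x|).
Proof. by move=> hf; exact: (integrable_abse hf). Qed.

Lemma L1Z (k : R) f : L1 f -> L1 (fun x => k * f x).
Proof. by move=> hf; exact: (integrableZl measurableT k hf). Qed.

Lemma L1_0 : @L1 R (fun x => 0).
Proof. exact: integrable0. Qed.

Lemma L1Mb f g : L1 f -> bmf g -> L1 (fun x => f x * g x).
Proof.
move=> hf [mg [M gM]].
apply: (@L1_dom _ (fun x => M * `|f x|)); last exact/L1Z/L1_abs.
  by apply: measurable_funM => //; exact: L1_meas.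
by move=> x; rewrite normrM mulrC ler_wpM2r.
Qed.

Lemma bL1M f g : bmf f -> L1 g -> L1 (fun x => f x * g x).
Proof.
move=> hf hg; rewrite (_ : (fun x => _) = (fun x => g x * f x)); first exact: L1Mb.
by apply/funext => x; rewrite mulrC.
Qed.

Lemma bmf_cst (c : R) : bmf (fun=> c).
Proof. by split; [exact: measurable_cst|exists `|c|]. Qed.

Lemma bmfD f g : bmf f -> bmf g -> bmf (fun x => f x + g x).
Proof.
move=> [mf [M fM]] [mg [N gN]]; split; first exact: measurable_funD.
by exists (M + N) => x; rewrite (le_trans (ler_normD _ _))// lerD.
Qed.

Lemma bmfN f : bmf f -> bmf (fun x => - f x).
Proof.
move=> [mf [M fM]]; split; last by exists M => x; rewrite normrN.
exact: measurableT_comp.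
Qed.

Lemma bmfM f g : bmf f -> bmf g -> bmf (fun x => f x * g x).
Proof.
move=> [mf [M fM]] [mg [N gN]]; split; first exact: measurable_funM.
by exists (M * N) => x; rewrite normrM ler_pM.
Qed.

Lemma bmf_abs f : bmf f -> bmf (fun x => `|f x|).
Proof.
move=> [mf [M fM]]; split; last by exists M => x; rewrite normr_id.
exact: measurableT_comp.
Qed.

Lemma bmfX f n : bmf f -> bmf (fun x => f x ^+ n).
Proof.
move=> hf; elim: n => [|n ih]; first exact: bmf_cst.
by under eq_fun do rewrite exprS; exact: bmfM.
Qed.

Lemma L1X f n : L1 f -> bmf f -> L1 (fun x => f x ^+ n.+1).
Proof.
by move=> f1 bf; under eq_fun do rewrite exprS; apply: L1Mb => //; exact: bmfX.
Qed.

Lemma Int_fin f : L1 f -> (\int[mu]_x (f x)%:E)%E = (\int[mu]_x f x)%:E.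
Proof. by move=> hf; rewrite /Rintegral fineK//; exact: integrable_fin_num. Qed.

Lemma IntD f g : L1 f -> L1 g ->
  \int[mu]_x (f x + g x) = \int[mu]_x f x + \int[mu]_x g x.
Proof. by move=> hf hg; rewrite RintegralD. Qed.

Lemma IntB f g : L1 f -> L1 g ->
  \int[mu]_x (f x - g x) = \int[mu]_x f x - \int[mu]_x g x.
Proof. by move=> hf hg; rewrite RintegralB. Qed.

Lemma IntZ (k : R) f : L1 f -> \int[mu]_x (k * f x) = k * \int[mu]_x f x.
Proof. by move=> hf; rewrite RintegralZl. Qed.

Lemma Int0 : \int[mu]_(x in setT) (0 : R) = 0.
Proof. by rewrite /Rintegral integral0. Qed.

Lemma aeS (P Q : R -> Prop) : (forall x, P x -> Q x) ->
  {ae mu, forall x, P x} -> {ae mu, forall x, Q x}.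
Proof. move=> PQ; exact: (@filterS _ _ (ae_filter_ringOfSetsType mu)). Qed.

Lemma aeI (P Q : R -> Prop) : {ae mu, forall x, P x} -> {ae mu, forall x, Q x} ->
  {ae mu, forall x, P x /\ Q x}.
Proof. exact: (@filterI _ _ (ae_filter_ringOfSetsType mu)). Qed.

Lemma aeT (P : R -> Prop) : (forall x, P x) -> {ae mu, forall x, P x}.
Proof.
move=> h; apply: (@aeS (fun=> True)) => //.
exact: (@filterT _ _ (ae_filter_ringOfSetsType mu)).
Qed.

Lemma Int_ae_eq f g : measurable_fun setT f -> measurable_fun setT g ->
  {ae mu, forall x, f x = g x} -> \int[mu]_x f x = \int[mu]_x g x.
Proof.
move=> mf mg fg; congr fine; apply: ae_eq_integral => //; try exact/measurable_EFinP.
by apply: aeS fg => x /= ->.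
Qed.

Lemma L1_ae f g : L1 f -> measurable_fun setT g ->
  {ae mu, forall x, f x = g x} -> L1 g.
Proof.
move=> /integrableP[mf fi] mg fg; apply/integrableP; split; first exact/measurable_EFinP.
suff <- : (\int[mu]_x `|(EFin \o f) x| = \int[mu]_x `|(EFin \o g) x|)%E by [].
apply: ae_eq_integral => //.
- exact: measurableT_comp.
- by apply: measurableT_comp => //; exact/measurable_EFinP.
- by apply: aeS fg => x /= ->.
Qed.

Lemma Int_le f g : L1 f -> L1 g -> (forall x, f x <= g x) ->
  \int[mu]_x f x <= \int[mu]_x g x.
Proof. by move=> hf hg fg; apply: le_Rintegral => // x _; exact: fg. Qed.

Lemma Int_ae_le f g : L1 f -> L1 g -> {ae mu, forall x, f x <= g x} ->
  \int[mu]_x f x <= \int[mu]_x g x.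
Proof.
move=> hf hg fg.
have mf := L1_meas hf; have mg := L1_meas hg.
have mm : measurable_fun setT (fun x => Num.max (f x) (g x)).
  exact: measurable_maxr.
have hmm : L1 (fun x => Num.max (f x) (g x)).
  by apply: (L1_ae hg mm); apply: aeS fg => x ?; rewrite max_r.
rewrite (@Int_ae_eq g (fun x => Num.max (f x) (g x)))//.
  by apply: Int_le => // x; rewrite le_max lexx.
by apply: aeS fg => x ?; rewrite max_r.
Qed.

Lemma Int_ge0 f : (forall x, 0 <= f x) -> 0 <= \int[mu]_x f x.
Proof. by move=> f0; exact: Rintegral_ge0. Qed.

Lemma Int_norm f : L1 f -> `|\int[mu]_x f x| <= nrm f.
Proof. by move=> hf; exact: le_normr_Rintegral. Qed.

Lemma nrm_ge0 f : 0 <= nrm f. Proof. exact: Int_ge0. Qed.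

Lemma nrmD f g : L1 f -> L1 g -> nrm (fun x => f x + g x) <= nrm f + nrm g.
Proof.
move=> hf hg; rewrite /nrm -IntD//; try exact: L1_abs.
apply: Int_le => [||x]; [|by apply: L1D; exact: L1_abs|exact: ler_normD].
by apply: L1_abs; exact: L1D.
Qed.

Lemma nrm0_ae f : L1 f -> nrm f = 0 -> {ae mu, forall x, f x = 0}.
Proof.
move=> hf; rewrite /nrm => h.
have mf : measurable_fun setT (EFin \o f) by apply/measurable_EFinP; exact: L1_meas.
have [+ _] := ae_eq_integral_abs mu measurableT mf.
have -> : (\int[mu]_x `|(EFin \o f) x| = 0)%E.
  by rewrite -[RHS]/(0%:E) -h -Int_fin//; exact: L1_abs.
move=> /(_ erefl); apply: aeS => x /= /(_ I) h'; exact: EFin_inj h'.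
Qed.

Lemma Lp1 f : L1 f -> Lpnorm 1 f = (nrm f)%:E.
Proof. by move=> hf; rewrite /Lpnorm Lnorm1 /= Int_fin//; exact: L1_abs. Qed.

End toolkit.

(** Structural proofs that a sum, product, power or absolute value is bounded
    measurable, respectively integrable, from hypotheses on its atoms. *)
Ltac bm := lazymatch goal with
 | |- bmf (fun x => (@?a x + @?b x)%R) => (assumption || (apply: bmfD; bm))
 | |- bmf (fun x => (@?a x * @?b x)%R) => (assumption || (apply: bmfM; bm))
 | |- bmf (fun x => (- (@?a x))%R) => (assumption || (apply: bmfN; bm))
 | |- bmf (fun x => `|@?a x|%R) => (assumption || (apply: bmf_abs; bm))
 | |- bmf (fun x => (@?a x ^+ _)%R) => (assumption || (apply: bmfX; bm))
 | |- _ => (assumption || exact: bmf_cst)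
 end.
Ltac l1 := lazymatch goal with
 | |- L1 (fun x => (@?a x + @?b x)%R) => (assumption || (apply: L1D; l1))
 | |- L1 (fun x => (@?a x * @?b x)%R) =>
     (first [assumption | (apply: L1Mb; [l1|bm]) | (apply: bL1M; [bm|l1])])
 | |- L1 (fun x => (- (@?a x))%R) => (assumption || (apply: L1N; l1))
 | |- L1 (fun x => `|@?a x|%R) => (assumption || (apply: L1_abs; l1))
 | |- L1 (fun x => (@?a x ^+ _)%R) => (assumption || (apply: L1X; [l1|bm]))
 | |- _ => (assumption || exact: L1_0)
 end.


(** * Primitives of integrable functions *)

Section prim.
Context {R : realType}.
Local Notation mu := (@lebesgue_measure R).
Implicit Types (f g h : R -> R).

Lemma Int_DCT (fn : nat -> R -> R) f g :
  (forall n, measurable_fun setT (fn n)) -> measurable_fun setT f ->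
  {ae mu, forall x, fn ^~ x @ \oo --> f x} ->
  L1 g -> (forall n x, `|fn n x| <= g x) ->
  (fun n => \int[mu]_x fn n x) @ \oo --> \int[mu]_x f x.
Proof.
move=> mfn mf fnf g1 fg.
have [|||||f1 _] := @dominated_convergence _ _ _ mu _ measurableT
  (fun n => EFin \o fn n) (EFin \o f) (EFin \o g).
- by move=> n; apply/measurable_EFinP; exact: mfn.
- by apply/measurable_EFinP; exact: mf.
- apply: aeS fnf => x h _; by apply: cvg_EFin; [exact: nearW|exact: h].
- exact: g1.
- by apply: aeT => x n _ /=; rewrite lee_fin.
move=> H; have : (\int[mu]_x (fn n x)%:E)%E @[n --> \oo] --> (\int[mu]_x f x)%:E.
  by rewrite -Int_fin.
exact: fine_cvg.
Qed.

Definition prim g x := \int[mu]_(y in `]-oo, x]) g y.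

(** The primitive is also the integral of [g] against the indicator of
    [y <= x], over all of the line: so one linearity lemma and one dominated
    convergence theorem, both on the whole line, serve every primitive. *)
Definition below (x y : R) : R := (y <= x)%R%:R.

Lemma primE g x : prim g x = \int[mu]_y (g y * below x y).
Proof.
rewrite /prim Rintegral_mkcond; apply: eq_Rintegral => y _.
rewrite /patch /below; case: ifPn => [|/negP].
  by rewrite inE/= in_itv/= => ->; rewrite mulr1.
by rewrite inE/= in_itv/= => /negP/negPf ->; rewrite mulr0.
Qed.

Lemma below1 (x y : R) : y <= x -> below x y = 1.
Proof. by rewrite /below => ->. Qed.

Lemma below0 (x y : R) : x < y -> below x y = 0.
Proof. by rewrite ltNge /below => /negPf ->. Qed.

Lemma bmf_below x : bmf (below x).
Proof.
split; last by exists 1 => y; rewrite normr_nat lern1 leq_b1.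
rewrite (_ : below x = \1_(`]-oo, x]%classic : set R)).
  by apply: measurable_indic; exact: measurable_itv.
apply/funext => y; rewrite indicE /below; congr (_%:R).
by rewrite mem_setE in_itv.
Qed.
Hint Resolve bmf_below : core.

Lemma prim_norm g x : L1 g -> `|prim g x| <= nrm g.
Proof.
move=> g1; rewrite primE (le_trans (Int_norm _))//; first by exact: L1Mb.
apply: Int_le => [||y]; [by apply: L1_abs; apply: L1Mb|exact: L1_abs|].
by rewrite normrM ler_piMr// normr_nat lern1 leq_b1.
Qed.

Lemma primD f g x : L1 f -> L1 g -> prim (fun y => f y + g y) x = prim f x + prim g x.
Proof.
move=> f1 g1; rewrite !primE -IntD; [|exact: L1Mb..].
by apply: eq_Rintegral => y _; rewrite mulrDl.
Qed.

Lemma primZ (k : R) f x : L1 f -> prim (fun y => k * f y) x = k * prim f x.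
Proof.
move=> f1; rewrite !primE -IntZ; last exact: L1Mb.
by apply: eq_Rintegral => y _; rewrite mulrA.
Qed.

(** Continuity of the primitive and its limits at both infinities are all
    obtained from the convergence of the indicators. *)
Lemma prim_DCT g (u : nat -> R) (s : R -> R) : L1 g -> measurable_fun setT s ->
  {ae mu, forall y, below (u n) y @[n --> \oo] --> s y} ->
  (fun n => prim g (u n)) @ \oo --> \int[mu]_y (g y * s y).
Proof.
move=> g1 ms us.
rewrite (_ : (fun n => _) = (fun n => \int[mu]_y (g y * below (u n) y))); last first.
  by apply/funext => n; rewrite primE.
apply: (@Int_DCT _ _ (fun y => `|g y|)).
- by move=> n; apply: L1_meas; apply: L1Mb.
- by apply: measurable_funM => //; exact: L1_meas.
- by apply: aeS us => y h; apply: cvgMl_tmp.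
- exact: L1_abs.
- move=> n y; by rewrite normrM ler_piMr// normr_nat lern1 leq_b1.
Qed.

Lemma ae_neq (x : R) : {ae mu, forall y, y != x}.
Proof.
exists [set x]; split => //; first exact: lebesgue_measure_set1.
by move=> y /= /negP; rewrite negbK => /eqP.
Qed.

Lemma prim_cont g : L1 g -> continuous (prim g).
Proof.
move=> g1 x; apply/(@cvg_nbhsP _ R^o) => u ux.
rewrite primE; apply: prim_DCT => //; first by have [] := bmf_below x.
apply: aeS (ae_neq x) => y yx.
have : (fun=> below x y) @ \oo --> (below x y : R) by exact: cvg_cst.
apply: cvg_trans.
apply: near_eq_cvg; have [xy|xy|/eqP] := ltgtP (y : R) x; last by rewrite (negPf yx).
  near=> n; rewrite (below1 (ltW xy)) below1//; apply: ltW; near: n.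
  by move/cvgr_gt : (ux : (u : nat -> R) n @[n --> \oo] --> (x : R)); exact.
near=> n; rewrite (below0 xy) below0//; near: n.
by move/cvgr_lt : (ux : (u : nat -> R) n @[n --> \oo] --> (x : R)); exact.
Unshelve. all: by end_near. Qed.

Lemma prim_pinfty g : L1 g -> prim g x @[x --> +oo] --> \int[mu]_x g x.
Proof.
move=> g1; apply/cvg_pinftyP => u uoo.
under [in X in _ --> X]eq_Rintegral do rewrite -[g _]mulr1.
apply: prim_DCT => //; apply: aeT => y.
have : (fun=> 1) @ \oo --> (1 : R) by exact: cvg_cst.
apply: cvg_trans.
apply: near_eq_cvg; near=> n; rewrite below1//; near: n.
by move/cvgryPge : uoo; exact.
Unshelve. all: by end_near. Qed.

Lemma prim_ninfty g : L1 g -> prim g x @[x --> -oo] --> 0.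
Proof.
move=> g1; apply/cvg_ninftyP => u uoo.
rewrite [X in _ --> X](_ : 0 = \int[mu]_x (g x * 0)).
  apply: prim_DCT => //; apply: aeT => y.
  have : (fun=> 0) @ \oo --> (0 : R) by exact: cvg_cst.
apply: cvg_trans.
  apply: near_eq_cvg; near=> n; rewrite below0//; near: n.
  by move/cvgrNyPlt : uoo; exact.
by under eq_Rintegral do rewrite mulr0; rewrite Int0.
Unshelve. all: by end_near. Qed.

End prim.

(** * Absolutely continuous functions with integrable derivative *)

Section ac.
Context {R : realType}.
Local Notation mu := (@lebesgue_measure R).
Implicit Types (f g h : R -> R).

(** [f] is absolutely continuous with derivative [g] in L^1 of the line: the
    increments of [f] are those of the primitive of [g]. *)
Definition ac_deriv f g := L1 g /\ forall a b, f b - f a = prim g b - prim g a.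

Lemma ac_prim g : L1 g -> ac_deriv (prim g) g.
Proof. by []. Qed.

Lemma ac_cst (c : R) : ac_deriv (fun=> c) (fun=> 0).
Proof.
split=> [|a b]; first exact: L1_0.
have p0 x : prim (fun=> 0 : R) x = 0.
  by rewrite primE -[RHS]Int0; apply: eq_Rintegral => y _; rewrite mul0r.
by rewrite !p0 !subrr.
Qed.

Lemma ac_derivD f f' g g' : ac_deriv f f' -> ac_deriv g g' ->
  ac_deriv (fun x => f x + g x) (fun x => f' x + g' x).
Proof.
move=> [f1 hf] [g1 hg]; split=> [|a b]; first exact: L1D.
by rewrite !primD// !opprD !(addrACA _ _ (- _)) hf hg.
Qed.

Lemma ac_derivZ (k : R) f f' : ac_deriv f f' -> ac_deriv (fun x => k * f x) (fun x => k * f' x).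
Proof.
move=> [f1 hf]; split=> [|a b]; first exact: L1Z.
by rewrite !primZ// -!mulrBr hf.
Qed.

Lemma ac_eq f g f' g' : ac_deriv f g -> f =1 f' -> g =1 g' -> ac_deriv f' g'.
Proof. by move=> h /funext <- /funext <-. Qed.

Lemma ac_E f g : ac_deriv f g -> forall x, f x = (f 0 - prim g 0) + prim g x.
Proof. by move=> [_ h] x; rewrite -addrA [- _ + _]addrC -h addrC subrK. Qed.

Lemma ac_cont f g : ac_deriv f g -> continuous f.
Proof.
move=> h x; rewrite (funext (ac_E h)).
by apply: cvgD; [exact: cvg_cst|apply: prim_cont; case: h].
Qed.

Lemma ac_bmf f g : ac_deriv f g -> bmf f.
Proof.
move=> h; split; first by apply: continuous_measurable_fun; exact: ac_cont h.
exists (`|f 0 - prim g 0| + nrm g) => x; rewrite (ac_E h) (le_trans (ler_normD _ _))//.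
by rewrite lerD2l prim_norm//; case: h.
Qed.

Lemma ac_pinfty f g : ac_deriv f g -> f x @[x --> +oo] --> f 0 - prim g 0 + \int[mu]_x g x.
Proof.
move=> h; rewrite [X in X x @[x --> _] --> _](funext (ac_E h)).
by apply: cvgD; [exact: cvg_cst|apply: prim_pinfty; case: h].
Qed.

Lemma ac_ninfty f g : ac_deriv f g -> f x @[x --> -oo] --> f 0 - prim g 0.
Proof.
move=> h; rewrite [X in X x @[x --> _] --> _](funext (ac_E h)) -[X in _ --> X]addr0.
by apply: cvgD; [exact: cvg_cst|apply: prim_ninfty; case: h].
Qed.

(** A function bounded away from zero on a set of infinite measure is not
    integrable; hence an integrable function with limits at infinity tends to
    zero there. *)
Lemma L1_itv_infty f (e : R) (D : set R) : measurable D -> mu D = +oo%E ->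
  0 < e -> (forall x, D x -> e <= `|f x|) -> ~ L1 f.
Proof.
move=> mD Doo e0 ef /integrableP[mf]; apply/negP; rewrite -leNgt.
apply: (@le_trans _ _ (\int[mu]_(x in D) `|(EFin \o f) x|)%E); last first.
  by apply: ge0_subset_integral => //; exact: measurableT_comp.
apply: (@le_trans _ _ (\int[mu]_(x in D) e%:E)%E).
  rewrite (_ : \int[mu]_(x in D) e%:E = e%:E * mu D)%E; last exact: integral_cst.
  by rewrite Doo gt0_muley// lte_fin.
apply: ge0_le_integral => //.
- by move=> x _; rewrite lee_fin ltW.
- by apply: measurable_funTS; exact: measurableT_comp.
Qed.

Lemma L1_lim0_pinfty f (l : R) : L1 f -> f x @[x --> +oo] --> l -> l = 0.
Proof.
move=> f1 fl; apply/eqP/negPn/negP => l0.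
have e0 : 0 < `|l| / 2 by rewrite divr_gt0// normr_gt0.
have lt2 : `|l| / 2 < `|l| by rewrite ltr_pdivrMr// ltr_pMr ?normr_gt0// ltr1n.
have [M [_ fM]] := cvgr_gt _ (cvg_norm fl) _ lt2.
apply: (@L1_itv_infty f (`|l|/2) `]M, +oo[%classic) f1 => //.
- by rewrite lebesgue_measure_itv/= ?ltry ?ltNyr.
- by move=> x /=; rewrite in_itv/= andbT => /fM/ltW.
Qed.

Lemma L1_lim0_ninfty f (l : R) : L1 f -> f x @[x --> -oo] --> l -> l = 0.
Proof.
move=> f1 fl; apply/eqP/negPn/negP => l0.
have e0 : 0 < `|l| / 2 by rewrite divr_gt0// normr_gt0.
have lt2 : `|l| / 2 < `|l| by rewrite ltr_pdivrMr// ltr_pMr ?normr_gt0// ltr1n.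
have [M [_ fM]] := cvgr_gt _ (cvg_norm fl) _ lt2.
apply: (@L1_itv_infty f (`|l|/2) `]-oo, M[%classic) f1 => //.
- by rewrite lebesgue_measure_itv/= ?ltry ?ltNyr.
- by move=> x /=; rewrite in_itv/= => /fM/ltW.
Qed.

Lemma ac_L1_prim f g : ac_deriv f g -> L1 f -> f =1 prim g.
Proof. by move=> h f1 x; rewrite (ac_E h) (L1_lim0_ninfty f1 (ac_ninfty h)) add0r. Qed.

(** The basis of every integration by parts below: the boundary terms vanish. *)
Lemma ac_int0 f g : ac_deriv f g -> L1 f -> \int[mu]_x g x = 0.
Proof.
move=> h f1; have := L1_lim0_pinfty f1 (ac_pinfty h).
by rewrite (L1_lim0_ninfty f1 (ac_ninfty h)) add0r.
Qed.

End ac.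

(** * The chain rule and the product rule *)

Section chain.
Context {R : realType}.
Local Notation mu := (@lebesgue_measure R).
Implicit Types (f g h : R -> R).

Lemma is_derive_cont (f f' : R -> R) :
  (forall x : R, is_derive x 1 f (f' x)) -> continuous f.
Proof.
move=> df x; apply: differentiable_continuous; apply/derivable1_diffP.
by have [] := df x.
Qed.

Definition ind (a b x : R) : R := below b x - below a x.

Lemma bmf_ind a b : bmf (ind a b).
Proof. by apply: bmfD; [|apply: bmfN]; exact: bmf_below. Qed.

Lemma indE (a b x : R) : a <= b -> ind a b x = ((a < x) && (x <= b))%:R.
Proof.
move=> ab; rewrite /ind; have [xa|ax] := leP x a.
  by rewrite !below1 ?subrr//; exact: le_trans ab.
by rewrite (below0 ax) subr0 /below.
Qed.

Lemma prim_ind g a b x : L1 g -> a <= x -> x <= b ->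
  prim (fun y => g y * ind a b y) x = prim g x - prim g a.
Proof.
move=> g1 ax xb; rewrite !primE -IntB; [|by apply: L1Mb => //; exact: bmf_below..].
apply: eq_Rintegral => y _; rewrite /ind -mulrBr -mulrA; congr (_ * _).
have [yx|xy] := leP (y : R) x.
  by rewrite (below1 yx) mulr1 below1//; exact: le_trans xb.
by rewrite (below0 xy) !mulr0 below0 ?subrr//; exact: le_lt_trans xy.
Qed.

Lemma Int_ind g a b : L1 g ->
  \int[mu]_x (g x * ind a b x) = prim g b - prim g a.
Proof.
move=> g1; rewrite !primE -IntB; [|by apply: L1Mb => //; exact: bmf_below..].
by apply: eq_Rintegral => y _; rewrite -mulrBr.
Qed.

Lemma mul_indE (f : R -> R) a b : a <= b ->
  (fun x => f x * ind a b x) = (f \_ `]a, b]).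
Proof.
move=> ab; apply/funext => x; rewrite indE// /patch mem_setE in_itv/=.
by case: (_ && _); rewrite ?mulr1 ?mulr0.
Qed.

Lemma Int_ind_itv f a b : a <= b ->
  \int[mu]_x (f x * ind a b x) = \int[mu]_(x in `]a, b]) f x.
Proof. by move=> ab; rewrite mul_indE// [RHS]Rintegral_mkcond. Qed.

Lemma L1_ind f a b : a <= b -> mu.-integrable `]a, b] (EFin \o f) ->
  L1 (fun x => f x * ind a b x).
Proof.
move=> ab fi; rewrite /L1 mul_indE//.
move/integrable_mkcond : fi; rewrite restrict_EFin; apply.
exact: measurable_itv.
Qed.

Lemma cont_int f a b : a <= b -> continuous f -> mu.-integrable `]a, b] (EFin \o f).
Proof.
move=> ab cf; apply: (@integrableS _ _ _ mu `[a, b]%classic) => //.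
  by move=> x /=; rewrite !in_itv/= => /andP[/ltW -> ->].
by apply: continuous_compact_integrable; [exact: segment_compact|exact: continuous_subspaceT].
Qed.

Lemma prim_derive g x : L1 g -> {for x, continuous g} -> is_derive x 1 (prim g) (g x).
Proof.
move=> g1 cg.
have xx : x < x + 1 by rewrite ltrDl.
have gi : mu.-integrable [set` Interval -oo%O (BRight (x + 1))] (EFin \o g).
  by apply: (@integrableS _ _ _ mu setT).
have [|h1 h2] := @continuous_FTC1 R g -oo%O x (x + 1) xx gi _ cg; first by rewrite ltNyr.
by apply: DeriveDef => //; rewrite -derive1E.
Qed.

Lemma FTC_ind (F f : R -> R) (a b : R) : a < b -> continuous f ->
  continuous F -> (forall x : R, a < x -> x < b -> is_derive x 1 F (f x)) ->
  F b - F a = \int[mu]_x (f x * ind a b x).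
Proof.
move=> ab cf cF dF.
rewrite Int_ind_itv ?(ltW ab)// Rintegral_itv_obnd_cbnd; last exact: cont_int (ltW ab) cf.
rewrite /Rintegral (@continuous_FTC2 _ f F a b)//.
- exact: continuous_subspaceT.
- split.
  + by move=> x; rewrite in_itv => /andP[ax xb]; have [] := dF _ ax xb.
  + by apply: cvg_at_right_filter; exact: cF.
  + by apply: cvg_at_left_filter; exact: cF.
- move=> x; rewrite in_itv => /andP[ax xb]; rewrite derive1E.
  by have h := dF _ ax xb; rewrite derive_val.
Qed.

Lemma bounded_cont (h : R -> R) (M : R) : continuous h ->
  exists K, forall x, `|x| <= M -> `|h x| <= K.
Proof.
move=> ch; have [M0|M0] := ltP M 0.
  by exists 0 => x xM; have := le_lt_trans xM M0; rewrite ltNge normr_ge0.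
have MM : - M <= M by rewrite ge0_cp.
have cnh : {within `[- M, M], continuous (fun x => `|h x|)}.
  by apply: continuous_subspaceT => x; apply: cvg_norm; exact: ch.
have [c _ hc] := EVT_max MM cnh.
by exists `|h c| => x; rewrite ler_norml => xM; apply: hc; rewrite in_itv.
Qed.

Lemma bmf_comp (h f : R -> R) : continuous h -> bmf f -> bmf (fun x => h (f x)).
Proof.
move=> ch [mf [M fM]]; split.
  by apply: measurableT_comp => //; exact: continuous_measurable_fun.
by have [K hK] := bounded_cont M ch; exists K => x; exact: hK.
Qed.

Lemma bmf_prim g : L1 g -> bmf (prim g).
Proof. by move=> g1; exact: ac_bmf (ac_prim g1). Qed.

(** The chain rule for a continuous [g] cut off to the interval is the
    fundamental theorem of calculus; the case of an integrable [g] follows by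
    density. *)
Lemma chain_smooth (h h' g : R -> R) (c a b : R) : a < b ->
  (forall x : R, is_derive x 1 h (h' x)) -> continuous h' -> continuous g ->
  let g0 := fun x => g x * ind a b x in
  h (c + \int[mu]_x g0 x) - h c = \int[mu]_x (h' (c + prim g0 x) * g0 x).
Proof.
move=> ab dh ch' cg g0.
have ch := is_derive_cont dh.
have g01 : L1 g0 by apply: L1_ind (ltW ab) (cont_int (ltW ab) cg).
have cp := prim_cont g01.
(* [g0] vanishes outside of ]a, b], so its primitive is 0 at [a] and the whole
   integral at [b] *)
have p0 : prim g0 a = 0.
  rewrite primE -[RHS]Int0; apply: eq_Rintegral => x _; rewrite /g0.
  have [xa|ax] := leP (x : R) a; last by rewrite (below0 ax) mulr0.
  by rewrite indE ?(ltW ab)// ltNge xa/= mulr0 mul0r.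
have pb : prim g0 b = \int[mu]_x g0 x.
  rewrite primE; apply: eq_Rintegral => x _; rewrite /g0.
  have [xa|ax] := leP (x : R) b; first by rewrite (below1 xa) mulr1.
  by rewrite indE ?(ltW ab)// leNgt ax/= andbF mulr0 mul0r.
rewrite -{1}pb -[c in X in _ - X]addr0 -p0.
have FTC := @FTC_ind (fun x => h (c + prim g0 x)) (fun x => h' (c + prim g0 x) * g x) a b ab.
apply: etrans (FTC _ _ _) _ => {FTC}; last first.
- by apply: eq_Rintegral => x _; rewrite mulrA.
- move=> x ax xb.
  have g0g : {near x, g =1 g0}.
    near=> y; rewrite /g0 indE ?(ltW ab)//.
    suff -> : (a < y) && (y <= b) by rewrite mulr1.
    apply/andP; split; [|apply: ltW].
      by near: y; exact: lt_nbhsr.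
    by near: y; exact: lt_nbhsl.
  have cg0 : {for x, continuous g0}.
    rewrite /prop_for/continuous_at -(nbhs_singleton g0g).
    by apply: cvg_trans (cg x); apply: near_eq_cvg.
  have d0 := prim_derive g01 cg0.
  have d1 : is_derive x 1 (fun y => c + prim g0 y) (g x).
    rewrite (nbhs_singleton g0g).
    by have := is_deriveD (is_derive_cst c x 1) d0; rewrite add0r.
  exact: (@is_derive1_comp _ h (fun y => c + prim g0 y) x).
- move=> x; apply: (@cvg_comp _ _ _ _ h _ (nbhs (c + prim g0 x))); last exact: ch.
  by apply: cvgD; [exact: cvg_cst|exact: cp].
- move=> x; apply: cvgM; last exact: cg.
  apply: (@cvg_comp _ _ _ _ h' _ (nbhs (c + prim g0 x))); last exact: ch'.
  by apply: cvgD; [exact: cvg_cst|exact: cp].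
Unshelve. all: by end_near. Qed.

End chain.

Section chain_rule.
Context {R : realType}.
Local Notation mu := (@lebesgue_measure R).
Implicit Types (f g h : R -> R).

Lemma cvg_nrm_Int (gn : nat -> R -> R) g : (forall n, L1 (gn n)) -> L1 g ->
  nrm (fun x => gn n x - g x) @[n --> \oo] --> (0 : R) ->
  \int[mu]_x gn n x @[n --> \oo] --> \int[mu]_x g x.
Proof.
move=> gn1 g1 e0; apply/cvgrPdist_lt => e ep; near=> n.
rewrite -IntB//; apply: le_lt_trans (Int_norm _) _; first exact: L1B.
have -> : nrm (fun x => g x - gn n x) = nrm (fun x => gn n x - g x).
  by apply: eq_Rintegral => x _; rewrite distrC.
near: n; exact: (cvgr_lt _ e0 _ ep).
Unshelve. all: by end_near. Qed.

(** Both sides of the chain rule are continuous with respect to L^1 convergence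
    of [g] on ]a, b], where the continuous functions are dense: convergence in
    L^1 makes the primitives converge uniformly, so that [h'] stays bounded along
    the approximation and dominated convergence applies. *)
Lemma chain_ind (h h' g : R -> R) (c a b : R) : a < b ->
  (forall x : R, is_derive x 1 h (h' x)) -> continuous h' -> L1 g ->
  let g0 := fun x => g x * ind a b x in
  h (c + \int[mu]_x g0 x) - h c = \int[mu]_x (h' (c + prim g0 x) * g0 x).
Proof.
move=> ab dh ch' g1 g0.
have ch := is_derive_cont dh.
have bi := bmf_ind a b.
have g01 : L1 g0 by apply: L1Mb.
have mE : measurable `]a, b]%classic by exact: measurable_itv.
have Efin : (mu `]a, b]%classic < +oo)%E.
  by rewrite lebesgue_measure_itv/=; case: ifP => _; rewrite -?EFinB ltry.
have gE : mu.-integrable `]a, b] (EFin \o g).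
  by apply: (@integrableS _ _ _ mu setT).
have [gn [cgn ign gncvg]] := approximation_continuous_integrable mE Efin gE.
pose g0n n x := gn n x * ind a b x.
have g0n1 n : L1 (g0n n) by apply: L1_ind (ltW ab) (ign n).
have e0 : nrm (fun x => g0n n x - g0 x) @[n --> \oo] --> (0 : R).
  have -> : (fun n => nrm (fun x => g0n n x - g0 x)) =
     (fun n => \int[mu]_(z in `]a, b]) `|g z - gn n z|).
    apply/funext => n; rewrite -Int_ind_itv ?(ltW ab)//; apply: eq_Rintegral => x _.
    rewrite -mulrBl normrM distrC; congr (_ * _).
    by rewrite indE ?(ltW ab)// normr_nat.
  exact: fine_cvg gncvg.
have fcvg x : c + prim (g0n n) x @[n --> \oo] --> c + prim g0 x.
  apply: cvgD; first exact: cvg_cst.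
  apply/cvgrPdist_lt => e ep; near=> n.
  have -> : prim g0 x - prim (g0n n) x = - prim (fun y => g0n n y - g0 y) x.
    have -> : (fun y => g0n n y - g0 y) = (fun y => g0n n y + (-1) * g0 y).
      by apply/funext => y; rewrite mulN1r.
    rewrite primD ?primZ//; last exact: L1Z.
    by rewrite mulN1r opprD opprK addrC.
  rewrite normrN; apply: le_lt_trans (prim_norm _ _) _; first exact: L1B.
  near: n; exact: (cvgr_lt _ e0 _ ep).
(* beyond [N] the primitives stay in a fixed ball, on which [h'] is bounded by
   [K]; the sequences are therefore shifted by [N] *)
have [N _ HN] : \forall n \near \oo, nrm (fun x => g0n n x - g0 x) < 1.
  exact: (cvgr_lt _ e0 _ ltr01).
have [K hK] := bounded_cont (`|c| + (nrm g0 + 1)) ch'.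
have K0 : 0 <= K.
  apply: le_trans (hK c _); first exact: normr_ge0.
  by rewrite lerDl addr_ge0// nrm_ge0.
have fb n x : (N <= n)%N -> `|h' (c + prim (g0n n) x)| <= K.
  move=> Nn; apply: hK; apply: le_trans (ler_normD _ _) _; rewrite lerD2l.
  apply: le_trans (prim_norm _ _) _ => //.
  have -> : g0n n = (fun x => g0 x + (g0n n x - g0 x)).
    by apply/funext => y; rewrite addrCA subrr addr0.
  apply: le_trans (nrmD _ _) _ => //; first exact: L1B.
  by rewrite lerD2l ltW// HN.
have fb0 x : `|h' (c + prim g0 x)| <= K.
  apply: hK; apply: le_trans (ler_normD _ _) _; rewrite lerD2l.
  by apply: le_trans (prim_norm _ _) _; rewrite ?lerDl.
have bh n : bmf (fun x => h' (c + prim (g0n n) x)).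
  by apply: (bmf_comp ch'); apply: bmfD; [exact: bmf_cst|exact: bmf_prim].
have bh0 : bmf (fun x => h' (c + prim g0 x)).
  by apply: (bmf_comp ch'); apply: bmfD; [exact: bmf_cst|exact: bmf_prim].
pose F n := h (c + \int[mu]_x g0n (n + N)%N x) - h c.
have F1 : F n @[n --> \oo] --> h (c + \int[mu]_x g0 x) - h c.
  apply: (@cvgB _ R^o); last exact: cvg_cst.
  apply: (@cvg_comp _ _ _ _ h _ (nbhs (c + \int[mu]_x g0 x))); last exact: ch.
  apply: cvgD; first exact: cvg_cst.
  apply: (@cvg_comp _ _ _ (fun n => (n + N)%N) (fun n => \int[mu]_x g0n n x) _ \oo).
    exact: cvg_addnr.
  exact: cvg_nrm_Int.
have F2 : F n @[n --> \oo] --> \int[mu]_x (h' (c + prim g0 x) * g0 x).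
  have -> : F = (fun n => \int[mu]_x (h' (c + prim (g0n (n + N)%N) x) * g0 x) +
     \int[mu]_x (h' (c + prim (g0n (n + N)%N) x) * (g0n (n + N)%N x - g0 x))).
    apply/funext => n; rewrite -IntD; [|exact: bL1M|by apply: bL1M => //; exact: L1B].
    rewrite /F (chain_smooth c ab dh ch' (cgn _)); apply: eq_Rintegral => x _.
    by rewrite -mulrDr addrCA subrr addr0.
  rewrite -[X in _ --> X]addr0; apply: cvgD.
    apply: (@Int_DCT _ _ _ (fun x => K * `|g0 x|)).
    - by move=> n; apply: L1_meas; exact: bL1M.
    - by apply: L1_meas; exact: bL1M.
    - apply: aeT => x; apply: cvgMr_tmp.
      apply: (@cvg_comp _ _ _ _ h' _ (nbhs (c + prim g0 x))); last exact: ch'.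
      apply: (@cvg_comp _ _ _ (fun n => (n + N)%N) (fun n => c + prim (g0n n) x) _ \oo).
        exact: cvg_addnr.
      exact: fcvg.
    - exact/L1Z/L1_abs.
    - by move=> n x; rewrite normrM ler_wpM2r// fb// leq_addl.
  apply: norm_cvg0.
  apply: (@squeeze_cvgr _ _ _ _ (fun=> 0) (fun n => K * nrm (fun x => g0n (n + N)%N x - g0 x))).
  - apply: nearW => n; rewrite normr_ge0/=.
    apply: le_trans (Int_norm _) _; first by apply: bL1M => //; exact: L1B.
    rewrite /nrm -IntZ; last by apply: L1_abs; exact: L1B.
    apply: Int_le => [||x].
    + by apply: L1_abs; apply: bL1M => //; exact: L1B.
    + by apply: L1Z; apply: L1_abs; exact: L1B.
    + by rewrite normrM ler_wpM2r// fb// leq_addl.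
  - exact: cvg_cst.
  - rewrite -[X in _ --> X](mulr0 K); apply: cvgMl_tmp.
    apply: (@cvg_comp _ _ _ (fun n => (n + N)%N)
      (fun n => nrm (fun x => g0n n x - g0 x)) _ \oo) => //.
    exact: cvg_addnr.
exact: (cvg_unique _ F1 F2).
Unshelve. all: by end_near. Qed.

Lemma ac_chain (h h' f g : R -> R) : (forall x : R, is_derive x 1 h (h' x)) ->
  continuous h' -> ac_deriv f g -> ac_deriv (fun x => h (f x)) (fun x => h' (f x) * g x).
Proof.
move=> dh ch' hf; have [g1 fE] := hf; have bf := ac_bmf hf.
have b1 : L1 (fun x => h' (f x) * g x) by apply: bL1M => //; exact: bmf_comp.
split => //.
have main a b : a < b -> h (f b) - h (f a) =
   prim (fun x => h' (f x) * g x) b - prim (fun x => h' (f x) * g x) a.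
  move=> ab; rewrite -Int_ind//.
  have -> : f b = f a + \int[mu]_x (g x * ind a b x).
    by rewrite Int_ind// -fE addrC subrK.
  rewrite (chain_ind _ ab dh ch' g1); apply: eq_Rintegral => x _.
  rewrite mulrA; have [/andP[ax xb]|nx] := boolP ((a < x) && (x <= b)).
    by rewrite prim_ind ?(ltW ax)// -fE addrC subrK.
  by rewrite indE ?(ltW ab)// (negPf nx) !mulr0.
move=> a b; have [ab|ba|->] := ltgtP a b; [exact: main| |by rewrite !subrr].
by apply: oppr_inj; rewrite !opprB; exact: main.
Qed.

End chain_rule.

Section product.
Context {R : realType}.
Local Notation mu := (@lebesgue_measure R).
Implicit Types (f g h : R -> R).

Lemma ac_sqr f g : ac_deriv f g -> ac_deriv (fun x => f x ^+ 2) (fun x => 2 * f x * g x).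
Proof.
move=> fg; apply: (@ac_chain R (fun x => x ^+ 2) (fun x => 2 * x)) fg.
  move=> x; apply: is_derive_eq.
  rewrite /GRing.scale/=. by ring.
by move=> x; apply: cvgMl_tmp.
Qed.

(** By polarization, from the chain rule for the square. *)
Lemma ac_mul f f' g g' : ac_deriv f f' -> ac_deriv g g' ->
  ac_deriv (fun x => f x * g x) (fun x => f' x * g x + f x * g' x).
Proof.
move=> hf hg; have hp := ac_sqr (ac_derivD hf hg).
have hm := ac_sqr (ac_derivD hf (ac_derivZ (-1) hg)).
apply: ac_eq (ac_derivZ (4^-1) (ac_derivD hp (ac_derivZ (-1) hm))) _ _ => x /=.
  by field.
by field.
Qed.

End product.

(** * Affine changes of variable *)

Section affine.
Context {R : realType}.
Local Notation mu := (@lebesgue_measure R).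
Implicit Types (f g h : R -> R).

Variables (a b : R).
Hypothesis a0 : a != 0.
Let phi (x : R) : R := a * x + b.

Lemma measurable_affine : measurable_fun setT phi.
Proof.
apply: continuous_measurable_fun => x.
by apply: cvgD; [apply: cvgMl_tmp|exact: cvg_cst].
Qed.

Let a0' : (0 <= `|a|)%R. Proof. exact: normr_ge0. Qed.

Let numeas : {measure set (measurableTypeR R) -> \bar R}.
Proof.
unshelve refine (mscale (NngNum a0') (@pushforward _ _ (measurableTypeR R) (measurableTypeR R) R mu phi)).
exact: measurable_affine.
Defined.

(** The right-hand side is a measure that agrees with the Lebesgue measure on the
    half-open intervals, which determine the latter. *)
Lemma affine_measure (X : set R) : measurable X -> mu X = (`|a|%:E * mu (phi @^-1` X))%E.
Proof.
apply: (@lebesgue_measure_unique R numeas) => _ /ocitvP[->|[[c d] /= cd ->]].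
  by rewrite !measure0.
rewrite lebesgue_measure_itv/= lte_fin cd.
transitivity (`|a|%:E * mu (phi @^-1` `]c, d]%classic))%E; last by [].
have [ap|an|/eqP] := ltgtP 0 a; last by rewrite eq_sym (negPf a0).
  have E : phi @^-1` `]c, d]%classic = `](c - b) / a, (d - b) / a]%classic.
    apply/seteqP; split=> x /=; rewrite !in_itv/= /phi;
    by rewrite ltr_pdivrMr// ler_pdivlMr// ltrBlDr lerBrDr [x * a]mulrC.
  rewrite [X in (_ * X)%E](_ : _ = mu `](c - b) / a, (d - b) / a]%classic); last by rewrite -E.
  rewrite lebesgue_measure_itv/= lte_fin ltr_pM2r ?invr_gt0// ltrD2r cd.
  rewrite -!EFinB -EFinM gtr0_norm//; congr EFin; field.
  by rewrite gt_eqF.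
have E : phi @^-1` `]c, d]%classic = `[(d - b) / a, (c - b) / a[%classic.
  apply/seteqP; split=> x /=; rewrite !in_itv/= /phi;
  by rewrite ltr_ndivlMr// ler_ndivrMr// ltrBlDr lerBrDr [x * a]mulrC andbC.
rewrite [X in (_ * X)%E](_ : _ = mu `[(d - b) / a, (c - b) / a[%classic); last by rewrite -E.
rewrite lebesgue_measure_itv/= lte_fin ltr_nM2r ?invr_lt0// ltrD2r cd.
rewrite -!EFinB -EFinM ltr0_norm//; congr EFin; field.
by rewrite lt_eqF.
Qed.

Lemma ge0_affine (f : R -> \bar R) : measurable_fun setT f -> (forall x, (0 <= f x)%E) ->
  (\int[mu]_x f x = `|a|%:E * \int[mu]_x f (phi x))%E.
Proof.
move=> mf f0.
transitivity (\int[numeas]_x f x)%E.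
  by apply: eq_measure_integral => A mA _; exact: affine_measure.
rewrite ge0_integral_mscale//; congr (_ * _)%E.
by rewrite ge0_integral_pushforward//; exact: measurable_affine.
Qed.

End affine.

Section affine_integral.
Context {R : realType}.
Local Notation mu := (@lebesgue_measure R).
Implicit Types (f g h : R -> R).

Lemma meas_affine f (a b : R) : a != 0 -> measurable_fun setT f ->
  measurable_fun setT (fun x => f (a * x + b)).
Proof. by move=> a0 mf; apply: (measurableT_comp mf); exact: measurable_affine. Qed.

Lemma L1_affine f (a b : R) : a != 0 -> L1 f -> L1 (fun x => f (a * x + b)).
Proof.
move=> a0 /[dup] /L1_meas mf /integrableP[mef fi]; apply/integrableP; split.
  by apply/measurable_EFinP; exact: meas_affine.
move: fi; rewrite (ge0_affine b a0)//; last exact: measurableT_comp.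
move=> fi; rewrite ltNge leye_eq; apply/negP => /eqP h.
by move: fi; rewrite [X in (_ * X)%E]h gt0_muley ?ltxx// lte_fin normr_gt0.
Qed.

(** The formula for nonnegative functions is applied to [f + |f|] and to
    [|f|]. *)
Lemma Int_affine f (a b : R) : a != 0 -> L1 f ->
  \int[mu]_x f x = `|a| * \int[mu]_x f (a * x + b).
Proof.
move=> a0 f1.
have pos g : L1 g -> (forall x, 0 <= g x) -> \int[mu]_x g x = `|a| * \int[mu]_x g (a * x + b).
  move=> g1 g0; apply: EFin_inj; rewrite -Int_fin// EFinM -Int_fin//; last exact: L1_affine.
  apply: (ge0_affine b a0); first by apply/measurable_EFinP; exact: L1_meas.
  by move=> x; rewrite lee_fin.
have fa := L1_affine b a0 f1.
have h1 : \int[mu]_x (f x + `|f x|) = `|a| * \int[mu]_x (f (a * x + b) + `|f (a * x + b)|).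
  by apply: (pos (fun x => f x + `|f x|)); [l1|move=> x; rewrite -lerBlDl sub0r -normrN ler_norm].
have h2 := pos _ (L1_abs f1) (fun x => normr_ge0 _).
rewrite IntD in h1; [|exact: f1|exact: L1_abs].
rewrite IntD in h1; [|exact: fa|exact: L1_abs].
by move: h1; rewrite h2 mulrDr => /addIr.
Qed.

Lemma nrm_refl f (x : R) : L1 f -> nrm (fun y => f (x - y)) = nrm f.
Proof.
move=> f1; have n1 : (-1 : R) != 0 by rewrite oppr_eq0 oner_eq0.
rewrite /nrm (Int_affine x n1 (L1_abs f1)) normrN1 mul1r.
by apply: eq_Rintegral => y _; rewrite mulN1r addrC.
Qed.

Lemma L1_refl f (x : R) : L1 f -> L1 (fun y => f (x - y)).
Proof.
move=> f1; have n1 : (-1 : R) != 0 by rewrite oppr_eq0 oner_eq0.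
have := L1_affine x n1 f1; congr (L1 _); apply/funext => y.
by rewrite mulN1r addrC.
Qed.

Lemma L1_shift f (y : R) : L1 f -> L1 (fun x => f (x - y)).
Proof.
move=> f1; have := L1_affine (- y) (oner_neq0 R) f1; congr (L1 _); apply/funext => x.
by rewrite mul1r.
Qed.

Lemma Int_shift f (y : R) : L1 f -> \int[mu]_x f (x - y) = \int[mu]_x f x.
Proof.
move=> f1; rewrite (Int_affine (- y) (oner_neq0 R) f1) normr1 mul1r.
by apply: eq_Rintegral => x _; rewrite mul1r.
Qed.

End affine_integral.

(** * Convolution *)

Section conv.
Context {R : realType}.
Local Notation mu := (@lebesgue_measure R).
Implicit Types (f g h k v : R -> R).

(** Double integrals of [k (x - y) * phi x * psi y].  The product of [phi] and
    [psi] is split by a pointwise inequality into a function of [x] and a function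
    of [y], each of which is integrated against [k] by translation invariance. *)
Variables (k phi psi alpha beta : R -> R).
Hypotheses (k1 : L1 k) (bphi : bmf phi) (bpsi : bmf psi)
  (alpha1 : L1 alpha) (beta1 : L1 beta) (beta0 : forall y, 0 <= beta y)
  (alpha0 : forall y, 0 <= alpha y)
  (ab : forall x y, `|phi x| * `|psi y| <= alpha x + beta y).

Let K x y := k (x - y) * (phi x * psi y).

Lemma K_L1y x : L1 (K x).
Proof.
have hk := L1_refl x k1.
have hb : bmf (fun y => phi x * psi y) by bm.
exact: L1Mb hk hb.
Qed.

Lemma K_L1x y : L1 (K ^~ y).
Proof.
have hk := L1_shift y k1.
have hb : bmf (fun x => phi x * psi y) by bm.
exact: L1Mb hk hb.
Qed.

Lemma K_meas : measurable_fun setT (fun p : R * R => (K p.1 p.2)%:E).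
Proof.
apply/measurable_EFinP; apply: measurable_funM.
  apply: (measurableT_comp (L1_meas k1)); exact: measurable_funB.
apply: measurable_funM.
  by apply: (measurableT_comp bphi.1).
by apply: (measurableT_comp bpsi.1).
Qed.

Let ka (p : R * R) : \bar R := (`|k (p.1 - p.2)| * alpha p.1)%:E.
Let kb (p : R * R) : \bar R := (`|k (p.1 - p.2)| * beta p.2)%:E.

Let mk : measurable_fun setT (fun p : R * R => `|k (p.1 - p.2)|).
Proof.
apply: measurableT_comp => //.
by apply: (measurableT_comp (L1_meas k1)); exact: measurable_funB.
Qed.

Let mka : measurable_fun setT ka.
Proof.
apply/measurable_EFinP; apply: measurable_funM => //.
by apply: (measurableT_comp (L1_meas alpha1)).
Qed.

Let mkb : measurable_fun setT kb.
Proof.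
apply/measurable_EFinP; apply: measurable_funM => //.
by apply: (measurableT_comp (L1_meas beta1)).
Qed.

Let ka0 p : (0 <= ka p)%E. Proof. by rewrite lee_fin mulr_ge0. Qed.
Let kb0 p : (0 <= kb p)%E. Proof. by rewrite lee_fin mulr_ge0. Qed.

Let int_ka : (\int[mu]_x \int[mu]_y ka (x, y) = (nrm k * \int[mu]_x alpha x)%:E)%E.
Proof.
rewrite -IntZ// -Int_fin; last exact: L1Z.
apply: eq_integral => x _; rewrite /ka/=.
have h := L1_abs (L1_refl x k1).
rewrite Int_fin; last by apply: L1Mb => //; exact: bmf_cst.
congr EFin; rewrite -(nrm_refl x k1) mulrC -IntZ//.
by apply: eq_Rintegral => y _; rewrite mulrC.
Qed.

Let int_kb : (\int[mu]_x \int[mu]_y kb (x, y) = (nrm k * \int[mu]_x beta x)%:E)%E.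
Proof.
rewrite (@fubini_tonelli _ _ _ _ _ mu mu _ mkb kb0) -IntZ// -Int_fin; last exact: L1Z.
apply: eq_integral => y _; rewrite /kb/=.
have h := L1_abs (L1_shift y k1).
rewrite Int_fin; last by apply: L1Mb => //; exact: bmf_cst.
congr EFin; rewrite /nrm -(Int_shift y (L1_abs k1)) mulrC -IntZ//.
by apply: eq_Rintegral => x _; rewrite mulrC.
Qed.

Lemma K_bound : (\int[mu]_x \int[mu]_y `|(K x y)%:E| <=
  (nrm k * (\int[mu]_x alpha x + \int[mu]_x beta x))%:E)%E.
Proof.
rewrite mulrDr EFinD -int_ka -int_kb.
have mF (f : R * R -> \bar R) := @measurable_fun_fubini_tonelli_F _ _ _ _ _ mu f.
have my (f : R * R -> \bar R) x : measurable_fun setT f -> measurable_fun setT (fun y => f (x, y)).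
  by move=> mf; apply: measurableT_comp => //; exact: measurable_pair1.
rewrite -ge0_integralD//; last 4 first.
- by move=> x _; exact: integral_ge0.
- exact: mF.
- by move=> x _; exact: integral_ge0.
- exact: mF.
apply: ge0_le_integral => //.
- by move=> x _; exact: integral_ge0.
- apply: (mF (fun p => `|(K p.1 p.2)%:E|)%E) => //.
  by apply: measurableT_comp => //; exact: K_meas.
- by apply: emeasurable_funD; exact: mF.
move=> x _; rewrite -ge0_integralD//; [|exact: my..].
apply: ge0_le_integral => //.
- by apply: (my (fun p => `|(K p.1 p.2)%:E|)%E); apply: measurableT_comp => //; exact: K_meas.
- by apply: emeasurable_funD; exact: my.
- move=> y _; rewrite /ka/kb/= lee_fin -mulrDr normrM ler_wpM2l// normrM.
  exact: ab.
Qed.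

Lemma K_integrable : (mu \x mu)%E.-integrable setT (fun p : R * R => (K p.1 p.2)%:E).
Proof.
apply/(@integrable12ltyP _ _ _ _ _ mu mu _ K_meas); apply: le_lt_trans K_bound _.
exact: ltry.
Qed.

Lemma K_fubini : \int[mu]_x \int[mu]_y K x y = \int[mu]_y \int[mu]_x K x y.
Proof.
rewrite /Rintegral; congr fine.
transitivity (\int[mu]_x \int[mu]_y (K x y)%:E)%E.
  by apply: eq_integral => x _; rewrite Int_fin//; exact: K_L1y.
rewrite (@Fubini _ _ _ _ _ mu mu _ K_integrable); apply: eq_integral => y _.
by rewrite /= Int_fin//; exact: K_L1x.
Qed.

Lemma L1_K : L1 (fun x => \int[mu]_y K x y).
Proof.
have := @integrable_fubini_F _ _ _ _ _ mu mu _ K_integrable.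
congr (_.-integrable _ _); apply/funext => x.
by rewrite /= -Int_fin//; exact: K_L1y.
Qed.

Lemma nrm_K : nrm (fun x => \int[mu]_y K x y) <= nrm k * (\int[mu]_x alpha x + \int[mu]_x beta x).
Proof.
rewrite -lee_fin -Int_fin; last exact/L1_abs/L1_K.
apply: le_trans K_bound.
apply: ge0_le_integral => //.
- by apply/measurable_EFinP; apply: L1_meas; apply: L1_abs; exact: L1_K.
- apply: (@measurable_fun_fubini_tonelli_F _ _ _ _ _ mu (fun p => `|(K p.1 p.2)%:E|)%E) => //.
  by apply: measurableT_comp => //; exact: K_meas.
- move=> x _; have -> : (\int[mu]_y `|(K x y)%:E| = (nrm (K x))%:E)%E.
    by rewrite -Int_fin//; apply: L1_abs; exact: K_L1y.
  by rewrite lee_fin; apply: Int_norm; exact: K_L1y.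
Qed.

End conv.

Section conv_facts.
Context {R : realType}.
Local Notation mu := (@lebesgue_measure R).
Implicit Types (f g h k v : R -> R).

Lemma conv_L1 k v : L1 k -> L1 v -> bmf v ->
  L1 (conv k v) /\ nrm (conv k v) <= nrm k * nrm v.
Proof.
move=> k1 v1 bv.
have b1 := @bmf_cst R 1.
have v0 y : 0 <= `|v y| by [].
have z0 (y : R) : 0 <= (0 : R) by [].
have ab (x y : R) : `|(fun=> 1 : R) x| * `|v y| <= (fun=> 0 : R) x + `|v y|.
  by rewrite normr1 mul1r add0r.
have e x : \int[mu]_y (k (x - y) * (1 * v y)) = conv k v x.
  by apply: eq_Rintegral => y _; rewrite mul1r.
have := L1_K k1 b1 bv (@L1_0 R) (L1_abs v1) v0 z0 ab.
have := nrm_K k1 b1 bv (@L1_0 R) (L1_abs v1) v0 z0 ab.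
by rewrite (funext e) Int0 add0r.
Qed.

(** Fubini, after which the translation by [y] turns the indicator of [x <= X]
    into that of [z <= X - y]. *)
Lemma conv_prim k v : L1 k -> L1 v -> bmf v -> conv (prim k) v =1 prim (conv k v).
Proof.
move=> k1 v1 bv X.
have bX := @bmf_below R X.
have v0 y : 0 <= `|v y| by [].
have z0 (y : R) : 0 <= (0 : R) by [].
have ab (x y : R) : `|below X x| * `|v y| <= (fun=> 0 : R) x + `|v y|.
  by rewrite add0r ler_piMl// normr_nat lern1 leq_b1.
rewrite primE.
transitivity (\int[mu]_x \int[mu]_y (k (x - y) * (below X x * v y))).
  rewrite (K_fubini k1 bX bv (@L1_0 R) (L1_abs v1) v0 z0 ab).
  apply: eq_Rintegral => y _; rewrite primE.
  have hk := L1_shift y k1.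
  transitivity (\int[mu]_x (v y * (k (x - y) * below X x))); last first.
    by apply: eq_Rintegral => x _; rewrite mulrA [v y * _]mulrC -mulrA [v y * _]mulrC.
  rewrite IntZ; last exact: L1Mb.
  rewrite mulrC; congr (_ * _).
  rewrite -(@Int_shift _ (fun z => k z * below (X - y) z) y); last by apply: L1Mb => //; exact: bmf_below.
  apply: eq_Rintegral => x _; congr (_ * _).
  by rewrite /below lerD2r.
apply: eq_Rintegral => x _; rewrite /conv.
have hk := L1_refl x k1.
transitivity (\int[mu]_y (below X x * (k (x - y) * v y))).
  by apply: eq_Rintegral => y _; rewrite mulrCA.
rewrite IntZ; last by exact: L1Mb.
by rewrite mulrC.
Qed.

Lemma conv_ae_r k v v' : measurable_fun setT k -> measurable_fun setT v ->
  measurable_fun setT v' -> {ae mu, forall y, v y = v' y} -> conv k v =1 conv k v'.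
Proof.
move=> mk mv mv' vv x.
have n1 : (-1 : R) != 0 by rewrite oppr_eq0 oner_eq0.
have mk' : measurable_fun setT (fun y : R => k (x - y)).
  have := meas_affine x n1 mk; congr (measurable_fun _ _); apply/funext => y.
  by rewrite mulN1r addrC.
by apply: Int_ae_eq; [exact: measurable_funM..|apply: aeS vv => y ->].
Qed.

Lemma conv_ae_l k k' v : L1 k -> L1 k' -> bmf v ->
  {ae mu, forall y, k y = k' y} -> conv k v =1 conv k' v.
Proof.
move=> k1 k1' bv kk x; have h := L1_refl x k1; have h' := L1_refl x k1'.
apply/eqP; rewrite -subr_eq0 -IntB; [|exact: L1Mb..].
have d1 : L1 (fun y => k y - k' y) by exact: L1B.
have n0 : nrm (fun y => k y - k' y) = 0.
  rewrite -[RHS]Int0; apply: Int_ae_eq => //.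
    by apply: L1_meas; exact: L1_abs.
  by apply: aeS kk => y ->; rewrite subrr normr0.
have := nrm_refl x d1; rewrite n0 => /(nrm0_ae (L1_refl x d1)) z.
apply/eqP; rewrite -[RHS]Int0; apply: Int_ae_eq => //.
  by apply: L1_meas; apply: L1B; exact: L1Mb.
by apply: aeS z => y /=; rewrite -mulrBl => ->; rewrite mul0r.
Qed.

(** From [|v x * v y| <= (v x ^+ 2 + v y ^+ 2) / 2]. *)
Lemma nrm_conv_sqr k v : L1 k -> L1 v -> bmf v ->
  L1 (fun x => v x * conv k v x) /\
  nrm (fun x => v x * conv k v x) <= nrm k * \int[mu]_x (v x ^+ 2).
Proof.
move=> k1 v1 bv.
pose al x := 2^-1 * v x ^+ 2.
have v2 : L1 (fun x => v x ^+ 2) by l1.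
have al1 : L1 al by apply: L1Z.
have al0 x : 0 <= al x by rewrite mulr_ge0// ?sqr_ge0 ?invr_ge0.
have ab (x y : R) : `|v x| * `|v y| <= al x + al y.
  rewrite /al -(real_normK (num_real (v x))) -(real_normK (num_real (v y))).
  have := sqr_ge0 (`|v x| - `|v y|); nra.
have e x : \int[mu]_y (k (x - y) * (v x * v y)) = v x * conv k v x.
  rewrite -IntZ; last by apply: L1Mb => //; exact: L1_refl.
  by apply: eq_Rintegral => y _; rewrite mulrCA.
have := L1_K k1 bv bv al1 al1 al0 al0 ab.
have := nrm_K k1 bv bv al1 al1 al0 al0 ab.
rewrite (funext e) /al IntZ// => h1 h2; split => //.
by apply: le_trans h1 _; rewrite ler_wpM2l ?nrm_ge0//; lra.
Qed.

(** From [v x ^+ 2 * |v y| <= 2 / 3 * |v x| ^+ 3 + 1 / 3 * |v y| ^+ 3], which is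
    [(2 a + b) (a - b) ^+ 2 >= 0] for [a = |v x|] and [b = |v y|]. *)
Lemma nrm_conv_cube k v : L1 k -> L1 v -> bmf v ->
  L1 (fun x => v x ^+ 2 * conv k v x) /\
  nrm (fun x => v x ^+ 2 * conv k v x) <= nrm k * \int[mu]_x `|v x| ^+ 3.
Proof.
move=> k1 v1 bv.
pose al x := (2 / 3) * `|v x| ^+ 3; pose be x := 3^-1 * `|v x| ^+ 3.
have v3 : L1 (fun x => `|v x| ^+ 3) by l1.
have al1 : L1 al by apply: L1Z.
have be1 : L1 be by apply: L1Z.
have al0 x : 0 <= al x by rewrite mulr_ge0// ?exprn_ge0// divr_ge0.
have be0 x : 0 <= be x by rewrite mulr_ge0// ?exprn_ge0// invr_ge0.
have b2 : bmf (fun x => v x ^+ 2) by bm.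
have ab (x y : R) : `|v x ^+ 2| * `|v y| <= al x + be y.
  rewrite /al /be normrX.
  have := normr_ge0 (v x); have := normr_ge0 (v y).
  move: `|v x| `|v y| => a b b0 a0.
  have := mulr_ge0 (addr_ge0 (addr_ge0 a0 a0) b0) (sqr_ge0 (a - b)).
  nra.
have e x : \int[mu]_y (k (x - y) * (v x ^+ 2 * v y)) = v x ^+ 2 * conv k v x.
  rewrite -IntZ; last by apply: L1Mb => //; exact: L1_refl.
  by apply: eq_Rintegral => y _; rewrite mulrCA.
have := L1_K k1 b2 bv al1 be1 be0 al0 ab.
have := nrm_K k1 b2 bv al1 be1 be0 al0 ab.
rewrite (funext e) /al /be !IntZ// => h1 h2; split => //.
by apply: le_trans h1 _; rewrite ler_wpM2l ?nrm_ge0//; lra.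
Qed.

Lemma bmf_sg (x : R) : bmf (fun y => Num.sg (x - y)).
Proof.
have h : bmf (fun y => below x y - below (- x) (- y)).
  apply: bmfD; first exact: bmf_below.
  apply: bmfN; have [m b] := @bmf_below R (- x); split.
    by apply: (measurableT_comp m); exact: measurable_funN.
  by have [M HM] := b; exists M => y; exact: HM.
move: h; congr (bmf _); apply/funext => y; rewrite /below lerN2.
have [h|h|->] := ltgtP (y : R) x.
- by rewrite gtr0_sg ?subr_gt0//= subr0.
- by rewrite ltr0_sg ?subr_lt0//= sub0r.
- by rewrite !subrr sgr0.
Qed.

(** Convolution with the sign function is twice the primitive minus the mass:
    the velocity field of the equation is, up to a convolution with [V], the
    centred primitive of the density. *)
Lemma conv_kernel (A : R) V v : L1 V -> L1 v -> bmf v ->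
  conv (kernel' A V) v =1
  (fun x => - A * (prim v x - 2^-1 * \int[mu]_y v y) + conv V v x).
Proof.
move=> V1 v1 bv x; rewrite /conv primE.
have hs := bmf_sg x; have hb := @bmf_below R x; have hV := L1_refl x V1.
rewrite -IntZ// -IntB; [|l1..].
rewrite -IntZ; last by l1.
rewrite -IntD; [|l1..].
apply: Int_ae_eq.
- by rewrite /kernel'; apply: L1_meas; under eq_fun do rewrite mulrDl -mulrA; l1.
- by apply: L1_meas; l1.
apply: aeS (ae_neq x) => y yx; rewrite /kernel' mulrDl; congr (_ + _).
rewrite /below; case: ltgtP yx => // xy _.
  by rewrite gtr0_sg ?subr_gt0//=; lra.
by rewrite ltr0_sg ?subr_lt0//=; lra.
Qed.

End conv_facts.

(** * Smooth test functions *)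

Section smooth.
Context {R : realType}.
Local Notation mu := (@lebesgue_measure R).
Implicit Types (f g h : R -> R) (p q : {poly R}).

(** The functions [p (1 / x) * exp (- 1 / x)], extended by zero to [x <= 0]: this
    family is stable under differentiation and contains the standard flat
    function, so that smoothness needs no computation of higher derivatives. *)
Definition flat p (x : R) : R := if 0 < x then p.[x^-1] * expR (- x^-1) else 0.

(** Exponential decay beats every polynomial.  The induction on [p] needs the
    statement for all the powers [y ^+ n] at once. *)
Lemma flat_decay p n : exists C, forall y : R, 0 < y -> `|p.[y]| * y ^+ n * expR (- y) <= C.
Proof.
elim/poly_ind: p n => [|p c ih] n.
  by exists 0 => y y0; rewrite horner0 normr0 !mul0r.
have [C1 h1] := ih n.+1.
exists (C1 + `|c| * (n.+1)`!%:R * 1 + `|c|) => y y0.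
have e0 := expR_gt0 (- y); have yn : 0 <= y ^+ n by rewrite exprn_ge0// ltW.
have h2 : y ^+ n * expR (- y) <= n.+1`!%:R + 1.
  case: n {ih h1} yn => [|n] yn.
    rewrite expr0 mul1r (@le_trans _ _ 1)//; last by rewrite lerDr.
    by rewrite -expR0 ler_expR lerNl oppr0 ltW.
  have := @expR_ge1Dxn _ y n (ltW y0) => h.
  rewrite expRN ler_pdivrMr ?expR_gt0//.
  have f0 : (0 : R) < n.+1`!%:R by rewrite ltr0n fact_gt0.
  have f1 : (n.+1`!%:R : R) <= n.+2`!%:R by rewrite ler_nat factS leq_pmull.
  have : y ^+ n.+1 <= n.+1`!%:R * expR y.
    rewrite -ler_pdivrMl// mulrC; apply: le_trans h.
    by rewrite lerDr.
  move=> h'; apply: le_trans h' _; rewrite ler_pM2r ?expR_gt0//.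
  by rewrite (le_trans f1)// lerDl.
rewrite hornerMXaddC; apply: (@le_trans _ _ ((`|p.[y] * y| + `|c|) * y ^+ n * expR (- y))).
  by rewrite ler_wpM2r ?(ltW e0)// ler_wpM2r// ler_normD.
rewrite mulrDl mulrDl mulr1 -addrA; apply: lerD.
  by rewrite normrM (gtr0_norm y0) -mulrA -mulrA [y * _]mulrA -exprS mulrA; exact: h1.
by rewrite -mulrA -{3}[`|c|]mulr1 -mulrDr ler_wpM2l.
Qed.

Lemma flat_lin p : exists C, forall x, `|flat p x| <= C * `|x|.
Proof.
have [C hC] := flat_decay p 1; exists `|C| => x; rewrite /flat.
case: ifPn => x0; last by rewrite normr0 mulr_ge0.
have i0 : 0 < x^-1 by rewrite invr_gt0.
have := hC _ i0; rewrite expr1 => h.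
rewrite normrM (gtr0_norm (expR_gt0 _)) (gtr0_norm x0) -ler_pdivrMr// mulrAC.
by apply: le_trans h _; exact: ler_norm.
Qed.

Definition dflat p : {poly R} := 'X^2 * (p - p^`()).

(** At the origin the difference quotient is [flat ('X * p)], which is bounded by
    a multiple of [|x|]. *)
Lemma is_derive_flat p (x : R) : is_derive x 1 (flat p) (flat (dflat p) x).
Proof.
have [x0|x0|->] := ltgtP x 0.
- have -> : flat (dflat p) x = 0 by rewrite /flat ltNge (ltW x0).
  apply: (near_eq_is_derive _ (is_derive_cst (0 : R) x 1)).
  near=> y; rewrite /flat ltNge; suff -> : y <= 0 by [].
  by apply: ltW; near: y; exact: lt_nbhsl.
- have x0' : x != 0 by rewrite gt_eqF.
  have e : is_derive x 1 (fun y : R => p.[y^-1] * expR (- y^-1)) (flat (dflat p) x).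
    have d1 := is_deriveV x0' (is_derive_id x 1).
    have d2 : is_derive (x^-1) 1 (horner p) p^`().[x^-1] by exact: is_derive_poly.
    have d3 := @is_derive1_comp _ _ _ _ _ _ d2 d1.
    have d4 := @is_derive1_comp _ expR (fun y => - y^-1) x _ _ (is_derive_expR _) (is_deriveN d1).
    have d5 := is_deriveM d3 d4.
    apply: is_derive_eq d5 _; rewrite /flat x0 /GRing.scale/= /dflat.
    rewrite hornerM hornerXn hornerD hornerN exprVn.
    by field.
  apply: (near_eq_is_derive _ e).
  by near=> y; rewrite /flat; suff -> : 0 < y by []; near: y; exact: lt_nbhsr.
- have -> : flat (dflat p) 0 = 0 by rewrite /flat ltxx.
  have [C hC] := flat_lin ('X * p).
  have cv : h^-1 *: (flat p (h + 0) - flat p 0) @[h --> 0^'] --> (0 : R).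
    apply: norm_cvg0; apply: (@squeeze_cvgr _ _ _ _ (fun=> 0) (fun h : R => C * `|h|)).
    + near=> h; rewrite normr_ge0/= addr0 {2}/flat ltxx subr0.
      have -> : h^-1 *: flat p h = flat ('X * p) h.
        rewrite /flat /GRing.scale/=; case: ifP; rewrite ?mulr0// => _.
        by rewrite hornerM hornerX mulrA.
      exact: hC.
    + exact: cvg_cst.
    + rewrite -[X in _ --> X](mulr0 C); apply: cvgMl_tmp; rewrite -[X in _ --> X](@normr0 _ R).
      by apply: cvg_norm; apply: nbhs_dnbhs.
  apply: DeriveDef; last first.
    by apply: cvg_lim => //; apply: cvg_trans cv; apply: near_eq_cvg; near=> h; rewrite [h%:A]mulr1.
  apply/cvg_ex; exists 0; apply: cvg_trans cv; apply: near_eq_cvg; near=> h.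
  by rewrite [h%:A]mulr1.
Unshelve. all: by end_near. Qed.

(** A class of functions closed under differentiation, hence consisting of
    smooth functions, which contains all the test functions built below. *)
Inductive smoothc : (R -> R) -> Prop :=
| smooth_flat p : smoothc (flat p)
| smooth_cst c : smoothc (fun=> c)
| smooth_add f g : smoothc f -> smoothc g -> smoothc (fun x => f x + g x)
| smooth_mul f g : smoothc f -> smoothc g -> smoothc (fun x => f x * g x)
| smooth_aff f a b : smoothc f -> smoothc (fun x => f (a * x + b))
| smooth_prim f F : smoothc f -> (forall x : R, is_derive x 1 F (f x)) -> smoothc F.

Lemma smooth_der f : smoothc f -> exists2 g, smoothc g & forall x : R, is_derive x 1 f (g x).
Proof.
elim=> {f} [p|c|f g sf [f' sf' df] sg [g' sg' dg]|f g sf [f' sf' df] sg [g' sg' dg]|f a b sf [f' sf' df]|f F sf _ dF].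
- by exists (flat (dflat p)); [exact: smooth_flat|move=> x; exact: is_derive_flat].
- by exists (fun=> 0); [exact: smooth_cst|move=> x; exact: is_derive_cst].
- by exists (fun x => f' x + g' x); [exact: smooth_add|move=> x; exact: is_deriveD].
- exists (fun x => f x * g' x + g x * f' x); first by apply: smooth_add; exact: smooth_mul.
  by move=> x; exact: is_deriveM.
- exists (fun x => a * f' (a * x + b)).
    by apply: (smooth_mul (smooth_cst a)); exact: smooth_aff.
  move=> x; have da : is_derive x 1 (fun x : R => a * x + b) a.
    by apply: is_derive_eq; rewrite /GRing.scale/=; ring.
  by rewrite mulrC; exact: (@is_derive1_comp _ f (fun x : R => a * x + b) x).
- by exists f.
Qed.

Lemma smooth_derivable f : smoothc f -> forall n (x : R), derivable (derive1n n f) x 1.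
Proof.
move=> sf n; elim: n f sf => [|n ih] f sf x.
  by have [g _ dg] := smooth_der sf; have [] := dg x.
rewrite derive1Sn; have [g sg dg] := smooth_der sf.
have -> : f^`()%classic = g.
  by apply/funext => y; rewrite derive1E; have h := dg y; rewrite derive_val.
exact: ih.
Qed.

End smooth.

(** * Weak derivatives and absolute continuity *)

Section bump.
Context {R : realType}.
Local Notation mu := (@lebesgue_measure R).
Implicit Types (f g h : R -> R).

Lemma ac_C1 (F f : R -> R) : (forall x : R, is_derive x 1 F (f x)) -> continuous f ->
  L1 f -> ac_deriv F f.
Proof.
move=> dF cf f1.
have cF := is_derive_cont dF.
have main (a b : R) : a < b -> F b - F a = prim f b - prim f a.
  by move=> ab; rewrite -Int_ind//; exact: FTC_ind.
split=> // a b; have [ab|ba|->] := ltgtP a b; [exact: main| |by rewrite !subrr].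
by apply: oppr_inj; rewrite !opprB; exact: main.
Qed.

Lemma aeE (P : R -> Prop) : {ae mu, forall x, P x} -> exists x, P x.
Proof.
move=> [N [mN N0 hN]]; apply/not_existsP => nP.
have h : (mu setT <= mu N)%E by apply: le_measure; rewrite ?inE//; move=> x _; apply: hN; exact: nP.
have := le_trans h (eq_ind_r (fun z => (z <= 0)%E) (lexx 0%E) N0).
by rewrite -set_itvNyy lebesgue_measure_itv/= leNgt ltry.
Qed.

(** A negative value would persist on a ball, which has positive measure. *)
Lemma ae_cont_ge0 f : continuous f -> {ae mu, forall x, 0 <= f x} -> forall x, 0 <= f x.
Proof.
move=> cf [N [mN N0 hN]] x; rewrite leNgt; apply/negP => fx.
have [e /= e0 he] : \forall y \near x, f y < 0 by exact: cvgr_lt _ (cf x) _ fx.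
have h : (mu (ball x e) <= mu N)%E.
  apply: le_measure; rewrite ?inE//; first exact: measurable_ball.
  by move=> y /he fy; apply: hN => /= fy0; move: fy; rewrite ltNge fy0.
have := le_trans h (eq_ind_r (fun z => (z <= 0)%E) (lexx 0%E) N0).
rewrite lebesgue_measure_ball. 2: exact: ltW.
by rewrite leNgt lte_fin pmulrn_lgt0// e0.
Qed.

Lemma smooth_cont f : smoothc f -> continuous f.
Proof. by move=> /smooth_der[g _ dg]; exact: is_derive_cont dg. Qed.

Definition bump (x : R) : R := flat 1 x * flat 1 (-1 * x + 1).

Lemma smooth_bump : smoothc bump.
Proof. by apply: smooth_mul; [|apply: smooth_aff]; exact: smooth_flat. Qed.

Lemma bump_ge0 x : 0 <= bump x.
Proof.
have h y : 0 <= flat 1 y :> R.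
  by rewrite /flat; case: ifP => // _; rewrite hornerC mul1r expR_ge0.
exact: mulr_ge0.
Qed.

Lemma bump_out (x : R) : (x <= 0) || (1 <= x) -> bump x = 0.
Proof.
move=> /orP[x0|x1]; rewrite /bump /flat; first by rewrite ltNge x0 mul0r.
by rewrite mulN1r addrC subr_gt0 [x < 1]ltNge x1/= mulr0.
Qed.

Lemma bump_half : 0 < bump (2^-1).
Proof.
have h (y : R) : 0 < y -> 0 < flat 1 y.
  by move=> y0; rewrite /flat y0 hornerC mul1r expR_gt0.
apply: mulr_gt0; apply: h; first by rewrite invr_gt0.
by rewrite mulN1r; lra.
Qed.

(** The support lies in the closed interval [m, M], whereas [ind] is the
    indicator of a half-open one; hence the left end [m - 1]. *)
Lemma L1_supp f (m M : R) : bmf f -> (forall x, (x < m) || (M < x) -> f x = 0) -> L1 f.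
Proof.
move=> [mf [K hK]] f0; have [mM|Mm] := leP m M; last first.
  rewrite (_ : f = (fun=> 0)); first exact: L1_0.
  apply/funext => x; apply: f0; have [//|mx] := ltP x m.
  exact: lt_le_trans mx.
have mM' : m - 1 <= M by lra.
apply: (@L1_dom _ f (fun x => K * ind (m - 1) M x)) => //; last first.
  apply: L1_ind => //; apply: (@cont_int _ (fun=> K)) => // x; exact: cvg_cst.
move=> x; rewrite indE//; have [/andP[h1 h2]|] := boolP ((m - 1 < x) && (x <= M)).
  by rewrite mulr1.
rewrite negb_and -leNgt -ltNge mulr0 => h; rewrite f0 ?normr0//.
by move: h => /orP[h|->]; rewrite ?orbT//; apply/orP; left; lra.
Qed.

Lemma bounded_supp f (m M : R) : continuous f -> (forall x, (x < m) || (M < x) -> f x = 0) -> bmf f.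
Proof.
move=> cf f0; split; first exact: continuous_measurable_fun.
have [K hK] := bounded_cont (`|m| + `|M|) cf.
have K0 : 0 <= K by apply: le_trans (hK 0 _); rewrite ?normr0 ?addr_ge0.
exists K => x; have [/f0 ->|] := boolP ((x < m) || (M < x)); first by rewrite normr0.
rewrite negb_or -!leNgt => /andP[mx xM]; apply: hK.
rewrite ler_norml; have := ler_norm M; have := ler_norm (- m); rewrite normrN.
have := normr_ge0 m; have := normr_ge0 M; move=> *; apply/andP; split; lra.
Qed.

Lemma bmf_bump : bmf bump.
Proof.
apply: (@bounded_supp _ 0 1); first exact: smooth_cont smooth_bump.
by move=> x /orP[h|h]; apply: bump_out; rewrite (ltW h) ?orbT.
Qed.

Lemma L1_bump : L1 bump.
Proof.
apply: (@L1_supp _ 0 1); first exact: bmf_bump.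
by move=> x /orP[h|h]; apply: bump_out; rewrite (ltW h) ?orbT.
Qed.

Definition mass : R := \int[mu]_x bump x.

Lemma mass_neq0 : mass != 0.
Proof.
apply/negP => /eqP m0.
have n0 : nrm bump = 0.
  by rewrite -m0; apply: eq_Rintegral => x _; rewrite ger0_norm// bump_ge0.
have h : {ae mu, forall x, 0 <= - bump x}.
  by apply: aeS (nrm0_ae L1_bump n0) => x ->; rewrite oppr0.
have c : continuous (fun x => - bump x).
  by move=> x; apply: cvgN; exact: smooth_cont smooth_bump x.
by have := ae_cont_ge0 c h 2^-1; rewrite oppr_ge0 leNgt bump_half.
Qed.

Definition step : R -> R := prim bump.

Lemma step_der (x : R) : is_derive x 1 step (bump x).
Proof. by apply: prim_derive; [exact: L1_bump|exact: smooth_cont smooth_bump _]. Qed.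

Lemma step_left (x : R) : x <= 0 -> step x = 0.
Proof.
move=> x0; rewrite /step primE -[RHS]Int0; apply: eq_Rintegral => y _.
have [yx|xy] := leP (y : R) x; last by rewrite (below0 xy) mulr0.
by rewrite bump_out ?mul0r// (le_trans yx).
Qed.

Lemma step_right (x : R) : 1 <= x -> step x = mass.
Proof.
move=> x1; rewrite /step primE; apply: eq_Rintegral => y _.
have [yx|xy] := leP (y : R) x; first by rewrite (below1 yx) mulr1.
by rewrite bump_out ?mul0r// (le_trans x1 (ltW xy)) orbT.
Qed.

Lemma test_functionI f (m M : R) : smoothc f -> (forall x, (x < m) || (M < x) -> f x = 0) ->
  test_function f.
Proof.
move=> sf f0; split; first exact: smooth_derivable.
apply: (@subclosed_compact _ _ `[m, M]%classic); first exact: closed_closure.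
  exact: segment_compact.
rewrite (closure_id `[m, M]%classic).1; last exact: interval_closed.
apply: closure_subset => x /= fx; rewrite in_itv/=; apply: contraT.
by rewrite negb_and -!ltNge => /f0 e; rewrite e eqxx in fx.
Qed.

Section dbr.
Variables (f g : R -> R).
Hypotheses (f1 : L1 f) (g1 : L1 g) (fg : weak_derivative f g).

Let w x := f x - prim g x.

(** The bump concentrated on the interval [a, a + 1 / n]; its integral is [mass]
    for every [n], without normalization. *)
Definition moll (n a x : R) : R := n * bump (n * x + (- (n * a))).

Let mollE n a x : moll n a x = n * bump (n * (x - a)).
Proof. by rewrite /moll mulrBr. Qed.

Let moll_out (n a x : R) : 1 <= n -> (x < a) || (a + 1 < x) -> moll n a x = 0.
Proof.
move=> n1 h; rewrite mollE bump_out ?mulr0//.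
have n0 : 0 < n by exact: lt_le_trans n1.
move: h => /orP[h|h]; first by rewrite pmulr_rle0// subr_le0 ltW.
apply/orP; right; rewrite (le_trans n1)// ler_peMr ?(ltW n0)//; lra.
Qed.

Let moll_smooth n a : smoothc (moll n a).
Proof. by apply: (smooth_mul (smooth_cst n)); apply: smooth_aff; exact: smooth_bump. Qed.

Let moll_bmf (n a : R) : 1 <= n -> bmf (moll n a).
Proof.
move=> n1; apply: (@bounded_supp _ a (a + 1)); first exact: smooth_cont.
by move=> x; exact: moll_out.
Qed.

Let moll_L1 (n a : R) : 1 <= n -> L1 (moll n a).
Proof.
move=> n1; apply: (@L1_supp _ a (a + 1)); first exact: moll_bmf.
by move=> x; exact: moll_out.
Qed.

Let w_moll_L1 n a : 1 <= n -> L1 (fun x => w x * moll n a x).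
Proof.
move=> n1; have h1 := moll_L1 a n1; have h2 := moll_bmf a n1; have h3 := bmf_prim g1.
by rewrite /w; under eq_fun do rewrite mulrBl; apply: L1B; l1.
Qed.

(** The difference of two translates of [moll] is the derivative of a test
    function, the difference of two smoothed steps; and [w] has weak derivative
    zero, since [f] and the primitive of [g] have the same one. *)
Lemma moll_indep (n a b : R) : 1 <= n ->
  \int[mu]_x (w x * moll n a x) = \int[mu]_x (w x * moll n b x).
Proof.
move=> n1; have n0 : 0 < n by exact: lt_le_trans n1.
pose phi x := step (n * x + (- (n * a))) + (-1) * step (n * x + (- (n * b))).
pose phi' x := moll n a x - moll n b x.
have dphi (x : R) : is_derive x 1 phi (phi' x).
  have d c : is_derive x 1 (fun x : R => step (n * x + (- (n * c)))) (moll n c x).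
    have da : is_derive x 1 (fun x : R => n * x + (- (n * c))) n.
      by apply: is_derive_eq; rewrite /GRing.scale/=; ring.
    by rewrite /moll [n * bump _]mulrC; exact: (@is_derive1_comp _ step (fun x : R => n * x + (- (n * c))) x _ _ (step_der _)).
  apply: is_derive_eq; rewrite /GRing.scale/= /phi'; ring.
have sphi : smoothc phi.
  have ss := smooth_prim smooth_bump step_der.
  by apply: smooth_add; [|apply: (smooth_mul (smooth_cst (-1)))]; exact: smooth_aff.
pose m := Num.min a b; pose M := Num.max a b + 1.
have phi0 x : (x < m) || (M < x) -> phi x = 0.
  rewrite /m /M /phi => /orP[|].
    rewrite lt_min => /andP[xa xb]; rewrite -!mulrBr !step_left ?mulr0 ?addr0//.
      by rewrite pmulr_rle0// subr_le0 ltW.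
    by rewrite pmulr_rle0// subr_le0 ltW.
  rewrite -ltrBrDr gt_max => /andP[ax bx]; rewrite -!mulrBr !step_right; first ring.
    rewrite (le_trans n1)// ler_peMr ?(ltW n0)//; lra.
  rewrite (le_trans n1)// ler_peMr ?(ltW n0)//; lra.
have tphi := test_functionI sphi phi0.
have bphi : bmf phi by apply: (@bounded_supp _ m M) => //; exact: smooth_cont.
have phi1 : L1 phi by apply: (@L1_supp _ m M).
have phi'E : derive1 phi = phi'.
  by apply/funext => x; rewrite derive1E; have h := dphi x; rewrite derive_val.
have ma := moll_L1 a n1; have mb := moll_L1 b n1.
have ba := moll_bmf a n1; have bb := moll_bmf b n1.
have phi'1 : L1 phi' by apply: L1B.
have bphi' : bmf phi' by rewrite /phi'; bm.
have [_ _ /(_ _ tphi)] := fg; rewrite phi'E => E1.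
have bp := bmf_prim g1.
have cphi' : continuous phi'.
  by move=> x; apply: cvgB; apply: smooth_cont; exact: moll_smooth.
have acphi := ac_C1 dphi cphi' phi'1.
have ac2 := ac_mul (ac_prim g1) acphi.
have pphi1 : L1 (fun x => prim g x * phi x) by l1.
have := ac_int0 ac2 pphi1.
rewrite IntD; [|l1..].
rewrite E1 => E2.
have fphi' : L1 (fun x => f x * phi' x) by l1.
have pphi' : L1 (fun x => prim g x * phi' x) by l1.
apply/eqP; rewrite -subr_eq0 -IntB; [|exact: w_moll_L1..].
apply/eqP; rewrite (_ : \int[mu]_x _ = \int[mu]_x (f x * phi' x - prim g x * phi' x)).
  by rewrite IntB//; lra.
by apply: eq_Rintegral => x _; rewrite /w /phi'; ring.
Qed.

Let int_moll (n a : R) : 1 <= n -> \int[mu]_x moll n a x = mass.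
Proof.
move=> n1; have n0 : 0 < n by exact: lt_le_trans n1.
rewrite /mass (Int_affine (- (n * a)) (lt0r_neq0 n0) L1_bump) (gtr0_norm n0) -IntZ//.
exact: L1_affine (lt0r_neq0 n0) L1_bump.
Qed.

(** The mollifier is bounded by a multiple of [n] and is supported in the ball of
    radius [2 / n] around [a], so the error is at most a multiple of the mean
    deviation of [w] from [w a] on that ball. *)
Lemma moll_lebesgue_pt (a : R) : lebesgue_pt w a ->
  \int[mu]_x (w x * moll k.+1%:R a x) @[k --> \oo] --> w a * mass.
Proof.
move=> wa.
have [K hK] : exists K : R, forall x, `|bump x| <= K by case: bmf_bump.
have K0 : 0 <= K by apply: le_trans (hK 0).
have mw : measurable_fun setT w.
  by apply: measurable_funB; [exact: L1_meas|case: (bmf_prim g1)].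
pose r k : R := 2 / k.+1%:R.
have r0 k : 0 < r k by rewrite divr_gt0.
have dc : davg w a (r k) @[k --> \oo] --> 0%E.
  move/cvge_at_rightP : wa; apply; split => //.
  rewrite -[X in _ --> X](mulr0 2); apply: cvgMl_tmp; exact: cvg_harmonic.
have bound k : (`|\int[mu]_x (w x * moll k.+1%:R a x) - w a * mass|%:E <= (4 * K)%:E * davg w a (r k))%E.
  have k1 : (1 : R) <= k.+1%:R by rewrite ler1n.
  have h1 := w_moll_L1 a k1; have h2 := L1Z (w a) (moll_L1 a k1).
  rewrite -(int_moll a k1) -IntZ; last exact: moll_L1.
  rewrite -IntB//.
  apply: (@le_trans _ _ (nrm (fun x => w x * moll k.+1%:R a x - w a * moll k.+1%:R a x))%:E).
    by rewrite lee_fin Int_norm//; exact: L1B.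
  rewrite -Int_fin; last by apply: L1_abs; exact: L1B.
  have mwa : measurable_fun setT (fun x => (K * k.+1%:R * `|w x - w a|)%:E).
    apply/measurable_EFinP; apply: measurable_funM => //.
    by apply: measurableT_comp => //; exact: measurable_funB.
  have mb : measurable (ball a (r k)) by exact: measurable_ball.
  rewrite /davg /iavg lebesgue_measure_ball ?(ltW (r0 _))//.
  apply: (@le_trans _ _ (\int[mu]_(x in ball a (r k)) ((K * k.+1%:R)%:E * `|(w x - w a)%:E|))%E).
    rewrite [leRHS]integral_mkcond; apply: ge0_le_integral => //.
    - by apply/measurable_EFinP; apply: L1_meas; apply: L1_abs; exact: L1B.
    - by apply/(measurable_restrictT _ _).1 => //; apply: measurable_funTS; exact: mwa.
    - move=> x _; rewrite /patch; case: ifPn => [|].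
        rewrite inE => _; rewrite lee_fin -mulrBl normrM mulrC ler_wpM2r//.
        rewrite mollE normrM mulrC ler_pM//; first by rewrite normr_nat.
      rewrite notin_setE /ball/= => /negP; rewrite -leNgt => h.
      have -> : moll k.+1%:R a x = 0.
        rewrite mollE bump_out ?mulr0//.
        have kp : (0 : R) < k.+1%:R by rewrite ltr0n.
        move: h; rewrite /r ler_pdivrMr// => h; have [ax|xa] := lerP a x.
          apply/orP; right; move: h; rewrite distrC ger0_norm ?subr_ge0//; lra.
        by apply/orP; left; rewrite pmulr_rle0// subr_le0 ltW.
      by rewrite !mulr0 subrr normr0.
  rewrite ge0_integralZl//; last 2 first.
  - apply: measurable_funTS; apply: measurableT_comp => //.
    by apply/measurable_EFinP; exact: measurable_funB.
  - by rewrite lee_fin mulr_ge0.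
  rewrite inver mulrn_eq0/= gt_eqF//= muleA -EFinM; apply: lee_wpmul2r.
    exact: integral_ge0.
  rewrite lee_fin /r.
  have kp : (0 : R) < k.+1%:R by rewrite ltr0n.
  rewrite (_ : 4 * K * _ = K * k.+1%:R)//.
  by rewrite mulr2n; field; rewrite gt_eqF.
have sq : (`|\int[mu]_x (w x * moll k.+1%:R a x) - w a * mass|%:E @[k --> \oo] --> 0%:E)%E.
  apply: (@squeeze_cvge _ _ _ _ (cst 0%E) _ (fun k => (4 * K)%:E * davg w a (r k))%E).
  - by apply: nearW => k; rewrite bound andbT lee_fin.
  - exact: cvg_cst.
  - rewrite [X in _ --> X](_ : _ = ((4 * K)%:E * 0)%E); last by rewrite mule0.
    by apply: cvgeM => //; exact: cvg_cst.
apply/subr_cvg0; apply: norm_cvg0.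
exact: (fine_cvg sq).
Qed.

(** The lemma of du Bois-Reymond.  By the two lemmas above [w] takes the same
    value at all its Lebesgue points, that is almost everywhere; this value is 0
    because [f] is integrable. *)
Lemma weak_derivative_ac : {ae mu, forall x, f x = prim g x} /\ L1 (prim g).
Proof.
have lf : locally_integrable setT f by apply: open_integrable_locally f1; exact: openT.
have lp : locally_integrable setT (prim g).
  split; [by case: (bmf_prim g1)|exact: openT|move=> K _ cK].
  have /integrableP[] := @continuous_compact_integrable R (prim g) K cK
    (continuous_subspaceT (prim_cont g1)).
  by [].
have aeL := lebesgue_differentiation (locally_integrableB lf lp).
have [b Lb] := aeE aeL.
have wb : {ae mu, forall x, f x = w b + prim g x}.
  apply: aeS aeL => x Lx.
  suff : w x * mass = w b * mass by move/(mulIf mass_neq0) => <-; rewrite /w subrK.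
  have cx := moll_lebesgue_pt Lx; have cb := moll_lebesgue_pt Lb.
  apply: (cvg_unique _ cx); first exact: Rhausdorff.
  apply: cvg_trans cb; apply: near_eq_cvg; apply: nearW => n.
  by apply: moll_indep; rewrite ler1n.
have ac : ac_deriv (fun x => w b + prim g x) g.
  apply: ac_eq (ac_derivD (ac_cst (w b)) (ac_prim g1)) _ _ => x //=.
  by rewrite add0r.
have l : L1 (fun x => w b + prim g x) by apply: (L1_ae f1) => //; case: (ac_bmf ac).
have e := ac_L1_prim ac l.
split; last by move: l; congr (L1 _); apply/funext => x; rewrite e.
by apply: aeS wb => x ->; rewrite e.
Qed.

End dbr.
End bump.

(** * Entropy dissipation at a fixed time *)

Section calculus.
Context {R : realType}.
Local Notation mu := (@lebesgue_measure R).
Implicit Types (f g h : R -> R).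

Lemma is_deriveI f (t l : R) (m : R -> R) :
  (\forall h \near 0^', `|(f (t + h) - f t) / h - l| <= m h) ->
  m h @[h --> 0^'] --> 0 -> is_derive t 1 f l.
Proof.
move=> fm m0.
have cv : h^-1 *: (f (h%:A + t) - f t) @[h --> 0^'] --> l.
  apply/subr_cvg0; apply: norm_cvg0.
  apply: (@squeeze_cvgr _ _ _ _ (fun=> 0) m) => //; last exact: cvg_cst.
  near=> h; rewrite normr_ge0/= [h%:A]mulr1 [h + t]addrC /GRing.scale/= mulrC.
  by near: h.
by apply: DeriveDef; [apply/cvg_ex; exists l|apply: cvg_lim].
Unshelve. all: by end_near. Qed.

Lemma near0_addr_gt0 (t : R) : 0 < t -> \forall h \near 0^', 0 < t + h.
Proof.
move=> t0; near=> h.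
have : `|h| < t by near: h; exact: dnbhs0_lt.
by rewrite ltr_norml => /andP[]; lra.
Unshelve. all: by end_near. Qed.

Lemma derive_le0_nincr f (f' : R -> R) (a b : R) : a <= b ->
  (forall t, a <= t -> t <= b -> is_derive t 1 f (f' t)) ->
  (forall t, a <= t -> t <= b -> f' t <= 0) -> f b <= f a.
Proof.
move=> ab df f'0.
have cf : {within `[a, b], continuous f}.
  apply: derivable_within_continuous => t; rewrite in_itv/= => /andP[h1 h2].
  by have [] := df t h1 h2.
apply: (@ler0_derive1_le_cc _ f a b) => //.
- by move=> t; rewrite in_itv/= => /andP[h1 h2]; have [] := df t (ltW h1) (ltW h2).
- move=> t; rewrite in_itv/= => /andP[h1 h2]; rewrite derive1E.
  by have h := df t (ltW h1) (ltW h2); rewrite derive_val f'0// ltW.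
- by rewrite in_itv/= lexx ab.
- by rewrite in_itv/= ab lexx.
Qed.

End calculus.

Section space.
Context {R : realType}.
Local Notation mu := (@lebesgue_measure R).
Variables (A eps : R) (V Vx : R -> R).
Hypotheses (hA : 0 < A) (heps : 0 <= eps) (hV : W11 V Vx) (hVx : nrm Vx < A).

Lemma W11_prim : {ae mu, forall x, V x = prim Vx x} /\ L1 (prim Vx).
Proof. by have [V1 Vx1 VVx] := hV; exact: weak_derivative_ac. Qed.

(** The velocity [conv K' w] in the form given by [conv_kernel], and its space
    derivative; the Burgers term [- A * w] of the latter controls the
    perturbation by [V]. *)
Definition vel (w : R -> R) (x : R) : R :=
  - A * (prim w x - 2^-1 * \int[mu]_y w y) + conv V w x.

Definition velx (w : R -> R) (x : R) : R := - A * w x + conv Vx w x.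

Lemma conv_V (w : R -> R) : L1 w -> bmf w -> conv V w =1 prim (conv Vx w).
Proof.
move=> w1 bw x; have [e p1] := W11_prim; have [V1 Vx1 _] := hV.
by rewrite (conv_ae_l V1 p1 bw e) conv_prim.
Qed.

Lemma L1_velx w : L1 w -> bmf w -> L1 (velx w).
Proof.
by move=> w1 bw; have [_ Vx1 _] := hV; have [? _] := conv_L1 Vx1 w1 bw; rewrite /velx; l1.
Qed.

Lemma nrm_velx w : L1 w -> bmf w -> nrm (velx w) <= 2 * A * nrm w.
Proof.
move=> w1 bw; have [_ Vx1 _] := hV; have [c1 c2] := conv_L1 Vx1 w1 bw.
have w1' : L1 (fun x => - A * w x) by l1.
apply: le_trans (nrmD w1' c1) _.
have -> : nrm (fun x => - A * w x) = A * nrm w.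
  rewrite /nrm -IntZ; last exact: L1_abs.
  by apply: eq_Rintegral => x _; rewrite normrM normrN (gtr0_norm hA).
have : nrm Vx * nrm w <= A * nrm w by rewrite ler_wpM2r ?nrm_ge0// ltW.
lra.
Qed.

Lemma ac_vel w : L1 w -> bmf w -> ac_deriv (vel w) (velx w).
Proof.
move=> w1 bw; have [_ Vx1 _] := hV; have [c1 _] := conv_L1 Vx1 w1 bw.
have h := ac_derivD (ac_derivZ (- A) (ac_derivD (ac_prim w1) (ac_cst (- (2^-1 * \int[mu]_y w y)))))
  (ac_prim c1).
apply: ac_eq h _ _ => x; rewrite /vel ?conv_V// /velx.
by rewrite addr0.
Qed.

Variables (w wx wt h0 h1 h2 : R -> R) (L : R).
Hypotheses (aw : ac_deriv w wx) (w1 : L1 w) (wt1 : L1 wt) (pwt1 : L1 (prim wt))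
  (eqn : {ae mu, forall x, prim wt x = eps * wx x + w x * vel w x}).
Hypotheses (d0 : forall s : R, is_derive s 1 h0 (h1 s))
  (d1 : forall s : R, is_derive s 1 h1 (h2 s))
  (c2 : continuous h2) (h2pos : forall s, 0 <= h2 s)
  (h1L : forall s, `|h1 s| <= L * `|s|) (h0L : forall s, `|h0 s| <= L * s ^+ 2).

Lemma entropy_L1 : [/\ L1 (fun x => h0 (w x)), L1 (fun x => h1 (w x)) &
  L1 (fun x => w x * h1 (w x) - h0 (w x))].
Proof.
have bw := ac_bmf aw.
have c0 := is_derive_cont d0; have c1 := is_derive_cont d1.
have b0 := bmf_comp c0 bw; have b1 := bmf_comp c1 bw.
have w2 : L1 (fun x => w x ^+ 2) by l1.
have e0 : L1 (fun x => h0 (w x)).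
  by apply: (L1_dom b0.1 _ (L1Z L w2)) => x; exact: h0L.
have e1 : L1 (fun x => h1 (w x)).
  by apply: (L1_dom b1.1 _ (L1Z L (L1_abs w1))) => x; exact: h1L.
by split => //; l1.
Qed.

(** For the convex function [h0] with [h1 = h0'] and [h2 = h0''], two integrations
    by parts, both against the flux [prim wt = eps * wx + w * vel w]:
    the viscous part contributes [- eps * h2 w * wx ^+ 2 <= 0], and the transport
    part is the integral of [(w * h1 w - h0 w) * velx w], because
    [s * h1 s - h0 s] has derivative [s * h2 s]. *)
Lemma entropy_dissipation : \int[mu]_x (h1 (w x) * wt x) <=
  \int[mu]_x ((w x * h1 (w x) - h0 (w x)) * velx w x).
Proof.
have bw := ac_bmf aw; have [wx1 _] := aw.
have [e0 e1 eG] := entropy_L1.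
have c0 := is_derive_cont d0; have c1 := is_derive_cont d1.
have b0 := bmf_comp c0 bw; have b1 := bmf_comp c1 bw; have b2 := bmf_comp c2 bw.
have av := ac_vel w1 bw; have bv := ac_bmf av; have vx1 := L1_velx w1 bw.
have bp := bmf_prim wt1.
have a1 := ac_chain d1 c2 aw.
have a2 := ac_mul a1 (ac_prim wt1).
have p1 : L1 (fun x => h1 (w x) * prim wt x) by l1.
have i1 : L1 (fun x => h2 (w x) * wx x * prim wt x) by l1.
have i2 : L1 (fun x => h1 (w x) * wt x) by l1.
have := ac_int0 a2 p1; rewrite IntD// => E1.
have aG : ac_deriv (fun x => w x * h1 (w x) - h0 (w x)) (fun x => w x * h2 (w x) * wx x).
  have a0 := ac_chain d0 c1 aw.
  apply: ac_eq (ac_derivD (ac_mul aw a1) (ac_derivZ (-1) a0)) _ _ => x /=; ring.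
have a3 := ac_mul aG av.
have p3 : L1 (fun x => (w x * h1 (w x) - h0 (w x)) * vel w x) by l1.
have i3 : L1 (fun x => w x * h2 (w x) * wx x * vel w x) by l1.
have i4 : L1 (fun x => (w x * h1 (w x) - h0 (w x)) * velx w x).
  have bG := ac_bmf aG; by apply: bL1M.
have := ac_int0 a3 p3; rewrite IntD// => E2.
have : \int[mu]_x (w x * h2 (w x) * wx x * vel w x) <= \int[mu]_x (h2 (w x) * wx x * prim wt x).
  apply: Int_ae_le => //; apply: aeS eqn => x ->.
  rewrite -subr_ge0 (_ : _ - _ = eps * h2 (w x) * wx x ^+ 2); last by ring.
  by rewrite mulr_ge0// ?sqr_ge0// mulr_ge0.
move: E1 => /eqP; rewrite addrC addr_eq0 => /eqP ->.
by move: E2 => /eqP; rewrite addrC addr_eq0 => /eqP ->; rewrite lerN2.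
Qed.

End space.

(** * Time derivatives along a viscous flow *)

(** What is used of a viscous solution, for the representative [v t] of the
    density that is absolutely continuous in space: [vt] is its time derivative in
    L^1, the flux is the primitive of [vt], and [v] is continuous in time with
    values in W^{1,1}. *)
Record viscous_flow {R : realType} (A eps : R) (V : R -> R) (v vx vt : R -> R -> R) : Prop := {
  flow_ac : forall t : R, 0 < t -> ac_deriv (v t) (vx t);
  flow_L1 : forall t : R, 0 < t -> L1 (v t);
  flow_vt : forall t : R, 0 < t -> L1 (vt t);
  flow_flux : forall t : R, 0 < t -> L1 (prim (vt t));
  flow_eqn : forall t : R, 0 < t -> {ae @lebesgue_measure R,
    forall x, prim (vt t) x = eps * vx t x + v t x * vel A V (v t) x};
  flow_dt : forall t : R, 0 < t ->
    nrm (fun x => (v (t + h) x - v t x) / h - vt t x) @[h --> 0^'] --> (0 : R);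
  flow_cv : forall t : R, 0 < t ->
    nrm (fun x => v s x - v t x) @[s --> t] --> (0 : R);
  flow_dx : forall t : R, 0 < t ->
    nrm (fun x => vx (t + h) x - vx t x) @[h --> 0^'] --> (0 : R) }.

Section flow.
Context {R : realType}.
Local Notation mu := (@lebesgue_measure R).
Variables (A eps : R) (V : R -> R) (v vx vt : R -> R -> R).
Hypothesis fl : viscous_flow A eps V v vx vt.

Let av := flow_ac fl.
Let v1 := flow_L1 fl.
Let vt1 := flow_vt fl.
Let pvt1 := flow_flux fl.
Let dt := flow_dt fl.
Let dx := flow_dx fl.

Let vb (t : R) : 0 < t -> bmf (v t).
Proof. by move=> t0; exact: ac_bmf (av t0). Qed.

Let vprim (t : R) : 0 < t -> v t =1 prim (vx t).
Proof. by move=> t0; exact: ac_L1_prim (av t0) (v1 t0). Qed.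

Let vx1 (t : R) : 0 < t -> L1 (vx t). Proof. by move=> t0; case: (av t0). Qed.

Let quot t h x := (v (t + h) x - v t x) / h - vt t x.

Let quot1 t h : 0 < t -> 0 < t + h -> L1 (quot t h).
Proof.
move=> t0 th; apply: L1B; last exact: vt1.
by under eq_fun do rewrite mulrC; apply: L1Z; apply: L1B; exact: v1.
Qed.

Lemma v_diff_sup t s x : 0 < t -> 0 < s -> `|v s x - v t x| <= nrm (fun y => vx s y - vx t y).
Proof.
move=> t0 s0; rewrite (vprim s0) (vprim t0).
have -> : prim (vx s) x - prim (vx t) x = prim (fun y => vx s y - vx t y) x.
  have -> : (fun y => vx s y - vx t y) = (fun y => vx s y + (-1) * vx t y).
    by apply/funext => y; rewrite mulN1r.
  rewrite primD ?primZ ?mulN1r//; first exact: vx1.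
    exact: vx1.
  by apply: L1Z; exact: vx1.
by apply: prim_norm; apply: L1B; exact: vx1.
Qed.

(** In one dimension the sup norm of [v (t + h) - v t] is at most the L^1 norm of
    [vx (t + h) - vx t], which tends to zero, while the L^1 norm of the increment
    is of order [h]; so the quadratic remainder of [h0] is negligible. *)
Lemma entropy_derive (h0 h1 : R -> R) (L : R) (t : R) : 0 < t ->
  (forall s : R, 0 < s -> L1 (fun x => h0 (v s x))) -> bmf (fun x => h1 (v t x)) -> 0 <= L ->
  (forall a b, `|h0 b - h0 a - h1 a * (b - a)| <= L * (b - a) ^+ 2) ->
  is_derive t 1 (fun s => \int[mu]_x h0 (v s x)) (\int[mu]_x (h1 (v t x) * vt t x)).
Proof.
move=> t0 H1 b1 L0 hq.
have [K hK] : exists K : R, forall x, `|h1 (v t x)| <= K by case: b1.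
have K0 : 0 <= K by apply: le_trans (hK 0).
pose e h := nrm (quot t h); pose d h := nrm (fun x => vx (t + h) x - vx t x).
apply: (@is_deriveI _ _ _ _ (fun h => L * (d h * (nrm (vt t) + e h)) + K * e h)); last first.
  rewrite [X in _ --> X](_ : 0 = L * (0 * (nrm (vt t) + 0)) + K * 0); last by rewrite mul0r !mulr0 addr0.
  apply: cvgD; apply: cvgMl_tmp; last exact: dt.
  by apply: cvgM; [exact: dx|apply: cvgD; [exact: cvg_cst|exact: dt]].
near=> h.
have h_neq0 : h != 0 by near: h; exact: nbhs_dnbhs_neq.
have th : 0 < t + h by near: h; exact: near0_addr_gt0.
have q1 := quot1 t0 th; have vtt := vt1 t0.
have w1 := v1 th; have u1 := v1 t0; have bw := vb th; have bu := vb t0.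
have D1 : L1 (fun x => v (t + h) x - v t x) by l1.
have bD : bmf (fun x => v (t + h) x - v t x) by bm.
have r1 : L1 (fun x => h^-1 * (h0 (v (t + h) x) - h0 (v t x) - h1 (v t x) * (v (t + h) x - v t x))).
  have := H1 _ th; have := H1 _ t0 => ? ?.
  by apply: L1Z; l1.
have r2 : L1 (fun x => h1 (v t x) * quot t h x) by l1.
have -> : (\int[mu]_x h0 (v (t + h) x) - \int[mu]_x h0 (v t x)) / h
    - \int[mu]_x (h1 (v t x) * vt t x)
  = \int[mu]_x (h^-1 * (h0 (v (t + h) x) - h0 (v t x) - h1 (v t x) * (v (t + h) x - v t x)))
    + \int[mu]_x (h1 (v t x) * quot t h x).
  have a1 := H1 _ th; have a0 := H1 _ t0.
  rewrite -IntB// mulrC -IntZ; last by l1.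
  rewrite -IntB; [|by apply: L1Z; l1|by l1].
  rewrite -IntD//; apply: eq_Rintegral => x _; rewrite /quot; ring.
apply: le_trans (ler_normD _ _) _; apply: lerD.
  apply: le_trans (Int_norm r1) _.
  have s1 : L1 (fun x => L * (d h * `|quot t h x + vt t x|)).
    by apply: L1Z; apply: L1Z; apply: L1_abs; l1.
  apply: (@le_trans _ _ (\int[mu]_x (L * (d h * `|quot t h x + vt t x|)))).
    apply: Int_le => [||x]; [exact: L1_abs|exact: s1|].
    rewrite normrM; apply: (@le_trans _ _ (`|h^-1| * (L * (v (t + h) x - v t x) ^+ 2))).
      by rewrite ler_wpM2l.
    rewrite mulrCA ler_wpM2l// -(real_normK (num_real (v (t + h) x - v t x))) expr2 mulrCA.
    rewrite ler_pM//.
      exact: v_diff_sup.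
    by rewrite /quot subrK normrM mulrC.
  rewrite !IntZ//; [|by apply: L1_abs; l1|by apply: L1Z; apply: L1_abs; l1].
  rewrite ler_wpM2l// ler_wpM2l ?nrm_ge0// addrC; exact: nrmD.
apply: le_trans (Int_norm r2) _; rewrite /e /nrm -IntZ; last exact: L1_abs.
apply: Int_le => [||x]; [exact: L1_abs|by apply: L1Z; exact: L1_abs|].
by rewrite normrM ler_wpM2r.
Unshelve. all: by end_near. Qed.

(** The integral of [vt t] is zero because its primitive, the flux, is
    integrable. *)
Lemma mass_cst (s t : R) : 0 < s -> s <= t -> \int[mu]_x v t x = \int[mu]_x v s x.
Proof.
move=> s0 st.
have D (r : R) : 0 < r -> is_derive r 1 (fun s => \int[mu]_x v s x) 0.
  move=> r0.
  have b1 := @bmf_cst R 1.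
  have := @entropy_derive id (fun=> 1) 0 r r0 v1 b1 (lexx 0).
  under eq_Rintegral do rewrite mul1r.
  rewrite (ac_int0 (ac_prim (vt1 r0)) (pvt1 r0)); apply => a b.
  by rewrite mul0r mul1r subrr normr0.
apply/eqP; rewrite eq_le; apply/andP; split.
  apply: (@derive_le0_nincr _ (fun s => \int[mu]_x v s x) (fun=> 0) s t st) => // r sr _; apply: D; exact: lt_le_trans sr.
rewrite -lerN2.
apply: (@derive_le0_nincr _ (fun s => - \int[mu]_x v s x) (fun=> 0) s t st) => // r sr _.
rewrite -[X in is_derive _ _ _ X]oppr0; apply: is_deriveN; apply: D; exact: lt_le_trans sr.
Qed.

End flow.

(** * Contraction in L^1, positivity, and decay in L^2 *)

Section sqrt_entropy.
Context {R : realType}.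
Variable d : R.
Hypothesis d0 : 0 < d.

(** A smooth approximation of the absolute value; its convexity defect
    [s * h' s - h s], with [h s = sqrt_reg s - d], lies between 0 and [d]. *)
Definition sqrt_reg (s : R) : R := Num.sqrt (s ^+ 2 + d ^+ 2).

Lemma sqrt_reg_sqr s : sqrt_reg s ^+ 2 = s ^+ 2 + d ^+ 2.
Proof. by rewrite sqr_sqrtr// addr_ge0 ?sqr_ge0. Qed.

Lemma sqrt_reg_ged s : d <= sqrt_reg s.
Proof.
have e : Num.sqrt (d ^+ 2) = d by rewrite sqrtr_sqr gtr0_norm.
rewrite -[leLHS]e.
by rewrite ler_sqrt ?addr_ge0 ?sqr_ge0// lerDr sqr_ge0.
Qed.

Lemma sqrt_reg_gt0 s : 0 < sqrt_reg s. Proof. exact: lt_le_trans (sqrt_reg_ged s). Qed.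

Lemma sqrt_reg_geabs s : `|s| <= sqrt_reg s.
Proof.
by rewrite -sqrtr_sqr ler_sqrt ?addr_ge0 ?sqr_ge0// lerDl sqr_ge0.
Qed.

Lemma sqrt_reg_leabs s : sqrt_reg s <= `|s| + d.
Proof.
have p := sqrt_reg_gt0 s; have n := normr_ge0 s.
rewrite -ler_sqr ?nnegrE ?addr_ge0 ?(ltW p) ?(ltW d0)// sqrt_reg_sqr.
rewrite sqrrD real_normK ?num_real// lerD2r lerDl mulrn_wge0// mulr_ge0// ltW//.
Qed.

Lemma sqrt_reg_der (s : R) : is_derive s 1 sqrt_reg (s / sqrt_reg s).
Proof.
have p : 0 < s ^+ 2 + d ^+ 2 by rewrite ltr_wpDl ?sqr_ge0// exprn_gt0.
have di : is_derive s 1 (fun s : R => s ^+ 2 + d ^+ 2) (2 * s).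
  by apply: is_derive_eq; rewrite /GRing.scale/=; ring.
have h : is_derive s 1 sqrt_reg _ := @is_derive1_comp R (@Num.sqrt R) (fun s : R => s ^+ 2 + d ^+ 2) s _ _ (is_derive1_sqrt p) di.
apply: is_derive_eq h _.
have := sqrt_reg_gt0 s; rewrite /sqrt_reg => q0; field.
by rewrite gt_eqF.
Qed.

Lemma sqrt_reg_der2 (s : R) : is_derive s 1 (fun s => s / sqrt_reg s) (d ^+ 2 / sqrt_reg s ^+ 3).
Proof.
have q0 := sqrt_reg_gt0 s; have qn : sqrt_reg s != 0 by rewrite gt_eqF.
have di := is_deriveM (is_derive_id s 1) (is_deriveV qn (sqrt_reg_der s)).
apply: is_derive_eq di _; rewrite /GRing.scale/= -[d ^+ 2](addKr (s ^+ 2)) -sqrt_reg_sqr.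
field.
by rewrite qn.
Qed.

Lemma sqrt_reg_cont : continuous sqrt_reg.
Proof. exact: is_derive_cont sqrt_reg_der. Qed.

Lemma sqrt_reg_der2_cont : continuous (fun s => d ^+ 2 / sqrt_reg s ^+ 3).
Proof.
move=> x; apply: cvgMl_tmp; apply: cvgV; first by rewrite expf_neq0// gt_eqF// sqrt_reg_gt0.
have c := @exprn_continuous R 3.
by apply: (@cvg_comp _ _ _ sqrt_reg (fun y => y ^+ 3) _ (nbhs (sqrt_reg x))); [exact: sqrt_reg_cont|exact: c].
Qed.

Lemma sqrt_reg_quad a b :
  `|(sqrt_reg b - d) - (sqrt_reg a - d) - a / sqrt_reg a * (b - a)| <= d^-1 * (b - a) ^+ 2.
Proof.
have qa := sqrt_reg_gt0 a; have qb := sqrt_reg_gt0 b; have qan : sqrt_reg a != 0 by rewrite gt_eqF.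
have ea := sqrt_reg_sqr a; have eb := sqrt_reg_sqr b.
have -> : (sqrt_reg b - d) - (sqrt_reg a - d) - a / sqrt_reg a * (b - a) =
    (sqrt_reg a)^-1 * (sqrt_reg a * sqrt_reg b - d ^+ 2 - a * b).
  rewrite -[d ^+ 2](addKr (a ^+ 2)) -ea; field.
  by rewrite qan.
have cs : a * b + d ^+ 2 <= sqrt_reg a * sqrt_reg b.
  apply: le_trans (ler_norm _) _.
  rewrite -ler_sqr ?nnegrE ?normr_ge0 ?mulr_ge0 ?(ltW qa) ?(ltW qb)// exprMn ea eb real_normK ?num_real//.
  have := sqr_ge0 (d * (a - b)); nra.
have am : sqrt_reg a * sqrt_reg b <= a * b + d ^+ 2 + 2^-1 * (b - a) ^+ 2.
  have := sqr_ge0 (sqrt_reg a - sqrt_reg b); nra.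
rewrite ger0_norm; last by rewrite mulr_ge0 ?invr_ge0 ?(ltW qa)//; lra.
rewrite ler_pM ?invr_ge0 ?(ltW qa)//; first lra.
  by rewrite lef_pV2 ?posrE// sqrt_reg_ged.
have := sqr_ge0 (b - a); lra.
Qed.

Lemma sqrt_reg_h1L s : `|s / sqrt_reg s| <= d^-1 * `|s|.
Proof.
rewrite normrM mulrC ler_wpM2r// normfV (gtr0_norm (sqrt_reg_gt0 s)).
by rewrite lef_pV2 ?posrE ?sqrt_reg_gt0// sqrt_reg_ged.
Qed.

Lemma sqrt_reg_h0_ge0 s : 0 <= sqrt_reg s - d. Proof. by rewrite subr_ge0 sqrt_reg_ged. Qed.

Lemma sqrt_reg_h0L s : `|sqrt_reg s - d| <= d^-1 * s ^+ 2.
Proof.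
have := sqrt_reg_quad 0 s.
have -> : sqrt_reg 0 = d by rewrite /sqrt_reg expr0n add0r sqrtr_sqr gtr0_norm.
by rewrite subrr !mul0r !subr0.
Qed.

Lemma sqrt_reg_G s : 0 <= s * (s / sqrt_reg s) - (sqrt_reg s - d) <= d.
Proof.
have q := sqrt_reg_gt0 s; have qn : sqrt_reg s != 0 by rewrite gt_eqF.
have -> : s * (s / sqrt_reg s) - (sqrt_reg s - d) = d - d ^+ 2 / sqrt_reg s.
  rewrite -[d ^+ 2](addKr (s ^+ 2)) -sqrt_reg_sqr; field.
  by rewrite qn.
have h : d ^+ 2 / sqrt_reg s <= d.
  by rewrite ler_pdivrMr// expr2 ler_pM2l// sqrt_reg_ged.
have h' : 0 <= d ^+ 2 / sqrt_reg s by rewrite divr_ge0 ?sqr_ge0 ?(ltW q).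
by apply/andP; split; lra.
Qed.

End sqrt_entropy.

Section contraction.
Context {R : realType}.
Local Notation mu := (@lebesgue_measure R).
Variables (A eps : R) (V Vx : R -> R).
Hypotheses (hA : 0 < A) (heps : 0 <= eps) (hV : W11 V Vx) (hVx : nrm Vx < A).
Variables (v vx vt : R -> R -> R).
Hypothesis fl : viscous_flow A eps V v vx vt.

Let vb (t : R) : 0 < t -> bmf (v t).
Proof. by move=> t0; exact: ac_bmf (flow_ac fl t0). Qed.

Lemma entropy_ineq (h0 h1 h2 : R -> R) (L : R) :
  (forall s : R, is_derive s 1 h0 (h1 s)) -> (forall s : R, is_derive s 1 h1 (h2 s)) ->
  continuous h2 -> (forall s, 0 <= h2 s) -> 0 <= L ->
  (forall s, `|h1 s| <= L * `|s|) -> (forall s, `|h0 s| <= L * s ^+ 2) ->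
  (forall a b, `|h0 b - h0 a - h1 a * (b - a)| <= L * (b - a) ^+ 2) ->
  exists2 l : R -> R,
    forall t : R, 0 < t -> is_derive t 1 (fun s => \int[mu]_x h0 (v s x)) (l t) &
    forall t, 0 < t -> l t <=
      \int[mu]_x ((v t x * h1 (v t x) - h0 (v t x)) * velx A Vx (v t) x).
Proof.
move=> d0 d1 c2 h2p L0 h1L h0L hq.
exists (fun t => \int[mu]_x (h1 (v t x) * vt t x)) => t t0; last first.
  exact: (entropy_dissipation heps hV (flow_ac fl t0) (flow_L1 fl t0) (flow_vt fl t0)
    (flow_eqn fl t0) d0 d1 c2 h2p h1L h0L).
apply: (entropy_derive fl t0 _ _ L0 hq).
  by move=> s s0; have [] := entropy_L1 (flow_ac fl s0) (flow_L1 fl s0) d0 d1 h1L h0L.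
by apply: bmf_comp; [exact: is_derive_cont d1|exact: vb].
Qed.

(** Any bound will do; it is improved to the initial norm by [L1_contraction]. *)
Lemma nrm_bounded (s t : R) : 0 < s -> s <= t ->
  exists2 M, 0 <= M & forall r, s <= r -> r <= t -> nrm (v r) <= M.
Proof.
move=> s0 st.
have cn (r : R) : 0 < r -> {for r, continuous (fun r => nrm (v r))}.
  move=> r0; apply/subr_cvg0; apply: norm_cvg0.
  apply: (@squeeze_cvgr _ _ _ _ (fun=> 0) (fun h => nrm (fun x => v h x - v r x))).
  - near=> h; rewrite normr_ge0/=.
    have h0 : 0 < h by near: h; exact: lt_nbhsr.
    have v1 := flow_L1 fl.
    have a1 := v1 _ h0; have a2 := v1 _ r0.
    rewrite /nrm -IntB; [|exact: L1_abs..].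
    apply: le_trans (Int_norm _) _; first by l1.
    apply: Int_le => [||x]; [by l1|by l1|exact: ler_dist_dist].
  - exact: cvg_cst.
  - exact: (flow_cv fl r0).
have cw : {within `[s, t], continuous (fun r => nrm (v r))}.
  apply: continuous_in_subspaceT => r; rewrite inE/= in_itv/= => /andP[sr _].
  by apply: cn; exact: lt_le_trans sr.
have [c _ hc] := EVT_max st cw.
exists (nrm (v c)); first exact: nrm_ge0.
by move=> r sr rt; apply: hc; rewrite in_itv/= sr.
Unshelve. all: by end_near. Qed.

(** With the entropies [sqrt_reg d s - d] the dissipation estimate gives a growth
    rate of at most [d * 2 A M], where [M] bounds the L^1 norm; let [d] tend
    to zero. *)
Lemma L1_contraction (s t : R) : 0 < s -> s <= t -> nrm (v t) <= nrm (v s).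
Proof.
move=> s0 st; have t0 : 0 < t by exact: lt_le_trans st.
have [M M0 hM] := nrm_bounded s0 st.
have step d : 0 < d -> \int[mu]_x (sqrt_reg d (v t x) - d) <= nrm (v s) + 2 * A * M * (t - s) * d.
  move=> d0.
  pose f r := \int[mu]_x (sqrt_reg d (v r x) - d) + (- (d * (2 * A * M))) * r.
  have dh0 (x : R) : is_derive x 1 (fun x => sqrt_reg d x - d) (x / sqrt_reg d x).
    by rewrite -[X in is_derive _ _ _ X]subr0; apply: is_deriveB; exact: sqrt_reg_der.
  have L0 : 0 <= d^-1 by rewrite invr_ge0 ltW.
  have [l dl hl] := entropy_ineq dh0 (sqrt_reg_der2 d0) (@sqrt_reg_der2_cont _ d d0)
    (fun x => divr_ge0 (sqr_ge0 d) (exprn_ge0 3 (ltW (sqrt_reg_gt0 d0 x))))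
    L0 (sqrt_reg_h1L d0) (sqrt_reg_h0L d0) (sqrt_reg_quad d0).
  have : f t <= f s.
    apply: (@derive_le0_nincr _ f (fun r => l r + (- (d * (2 * A * M)))) s t st) => r sr rt.
      have r0 : 0 < r by exact: lt_le_trans sr.
      apply: is_deriveD; first exact: dl.
      by apply: is_derive_eq; rewrite /GRing.scale/= mulr1.
    have r0 : 0 < r by exact: lt_le_trans sr.
    rewrite subr_le0; apply: le_trans (hl r r0) _.
    have [_ _ g1] := entropy_L1 (flow_ac fl r0) (flow_L1 fl r0) dh0 (sqrt_reg_der2 d0)
      (sqrt_reg_h1L d0) (sqrt_reg_h0L d0).
    have vr1 := flow_L1 fl r0; have vbr := vb r0.
    have x1 := L1_velx A hV vr1 vbr.
    apply: (@le_trans _ _ (d * nrm (velx A Vx (v r)))).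
      rewrite /nrm -IntZ; last exact: L1_abs.
      apply: Int_le => [||x].
      + apply: bL1M => //; have aG := @sqrt_reg_G _ d d0; split; first exact: L1_meas.
        exists d => x; have /andP[p q] := aG (v r x).
        by rewrite ger0_norm.
      + by apply: L1Z; exact: L1_abs.
      + apply: le_trans (ler_norm _) _; rewrite normrM ler_wpM2r//.
        by have /andP[p q] := sqrt_reg_G d0 (v r x); rewrite ger0_norm.
    rewrite ler_wpM2l ?(ltW d0)//; apply: le_trans (nrm_velx hA hV hVx vr1 vbr) _.
    by rewrite ler_wpM2l ?mulr_ge0 ?(ltW hA)// hM.
  rewrite /f => h.
  have : \int[mu]_x (sqrt_reg d (v s x) - d) <= nrm (v s).
    have [e0 _ _] := entropy_L1 (flow_ac fl s0) (flow_L1 fl s0) dh0 (sqrt_reg_der2 d0)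
      (sqrt_reg_h1L d0) (sqrt_reg_h0L d0).
    have vs1 := flow_L1 fl s0.
    apply: Int_le => [||x]; [exact: e0|exact: L1_abs|].
    by rewrite lerBlDr sqrt_reg_leabs.
  lra.
have vt1 := flow_L1 fl t0.
have lim : \int[mu]_x (sqrt_reg n.+1%:R^-1 (v t x) - n.+1%:R^-1) @[n --> \oo] --> nrm (v t).
  have p n : 0 < n.+1%:R^-1 :> R by rewrite invr_gt0.
  apply: (@Int_DCT _ _ _ (fun x => `|v t x|)).
  - move=> n; apply: measurable_funB => //.
    apply: measurableT_comp; last by case: (vb t0).
    by apply: continuous_measurable_fun; exact: sqrt_reg_cont.
  - by apply: L1_meas; exact: L1_abs.
  - apply: aeT => x; apply: (@squeeze_cvgr _ _ _ _ (fun n => `|v t x| - n.+1%:R^-1) (fun=> `|v t x|)).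
    + apply: nearW => n; rewrite lerD2r sqrt_reg_geabs/=.
      by rewrite lerBlDr sqrt_reg_leabs.
    + rewrite -[X in _ --> X]subr0; apply: cvgB; [exact: cvg_cst|exact: cvg_harmonic].
    + exact: cvg_cst.
  - exact: L1_abs.
  - by move=> n x; rewrite ger0_norm ?sqrt_reg_h0_ge0// lerBlDr sqrt_reg_leabs.
have lim2 : nrm (v s) + 2 * A * M * (t - s) * n.+1%:R^-1 @[n --> \oo] --> nrm (v s).
  rewrite -[X in _ --> X]addr0; apply: cvgD; first exact: cvg_cst.
  rewrite -[X in _ --> X](mulr0 (2 * A * M * (t - s))); apply: cvgMl_tmp; exact: cvg_harmonic.
by apply: (ler_cvg_to lim lim2); apply: nearW => n; apply: step; rewrite invr_gt0.
Qed.

Variable u0 : R -> R.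
Hypotheses (u01 : L1 u0) (u0_ge0 : {ae mu, forall x, 0 <= u0 x}) (u0_mass : \int[mu]_x u0 x = 1)
  (u0_cv : nrm (fun x => v s x - u0 x) @[s --> 0^'+] --> (0 : R)).

Lemma flow_mass (t : R) : 0 < t -> \int[mu]_x v t x = 1.
Proof.
move=> t0; apply/eqP; rewrite -subr_eq0 -normr_eq0 eq_le normr_ge0 andbT.
apply: (cvgr_to_ge u0_cv).
near=> s.
have s0 : 0 < s by near: s; exact: nbhs_right_gt.
have st : s <= t by near: s; exact: nbhs_right_le.
have vs1 := flow_L1 fl s0.
rewrite (mass_cst fl s0 st) -u0_mass -IntB//.
by apply: Int_norm; exact: L1B.
Unshelve. all: by end_near. Qed.

Lemma flow_nrm (t : R) : 0 < t -> nrm (v t) <= 1.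
Proof.
move=> t0; rewrite -subr_le0.
apply: (cvgr_to_ge u0_cv).
near=> s.
have s0 : 0 < s by near: s; exact: nbhs_right_gt.
have st : s <= t by near: s; exact: nbhs_right_le.
rewrite lerBlDr; apply: le_trans (L1_contraction s0 st) _.
have vs1 := flow_L1 fl s0.
have e : nrm u0 = 1.
  rewrite -u0_mass; apply: Int_ae_eq; [by apply: L1_meas; exact: L1_abs|exact: L1_meas|].
  by apply: aeS u0_ge0 => x h; rewrite ger0_norm.
rewrite -e /nrm -IntD; [|by l1|by l1].
apply: Int_le => [||x]; [by l1|by l1|].
by rewrite -[leLHS](congr1 _ (subrK (u0 x) (v s x))) ler_normD.
Unshelve. all: by end_near. Qed.

(** The L^1 norm is at most 1, which is the integral of [v t]; so [v t] coincides
    with its absolute value. *)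
Lemma flow_ge0 (t x : R) : 0 < t -> 0 <= v t x.
Proof.
move=> t0; have vt1 := flow_L1 fl t0.
apply: (ae_cont_ge0 (ac_cont (flow_ac fl t0))).
have d1 : L1 (fun x => `|v t x| - v t x) by l1.
have z : nrm (fun x => `|v t x| - v t x) = 0.
  apply/eqP; rewrite eq_le nrm_ge0 andbT.
  have -> : nrm (fun x => `|v t x| - v t x) = nrm (v t) - \int[mu]_x v t x.
    rewrite /nrm -IntB//; last exact: L1_abs.
    by apply: eq_Rintegral => y _; rewrite ger0_norm// subr_ge0 ler_norm.
  by rewrite flow_mass// subr_le0 flow_nrm.
by apply: aeS (nrm0_ae d1 z) => y /eqP; rewrite subr_eq0 => /eqP <-.
Qed.

Definition energy (t : R) : R := \int[mu]_x v t x ^+ 2.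

Let V1 : L1 Vx. Proof. by case: hV. Qed.

(** For [h0 s = s ^+ 2] the dissipation is at most
    [(nrm Vx - A) * \int v ^+ 3], and the square of the integral of [v ^+ 2] is at
    most the integral of [v ^+ 3], since [v] is a probability density. *)
Lemma energy_ineq : exists2 l : R -> R, forall t : R, 0 < t -> is_derive t 1 energy (l t) &
  forall t, 0 < t -> l t <= - (A - nrm Vx) * energy t ^+ 2.
Proof.
have d0 (s : R) : is_derive s 1 (fun s => s ^+ 2) (2 * s).
  by apply: is_derive_eq; rewrite /GRing.scale/=; ring.
have d1 (s : R) : is_derive s 1 (fun s => 2 * s) 2.
  by apply: is_derive_eq; rewrite /GRing.scale/=; ring.
have cc : continuous (fun _ : R => 2 : R) by move=> x; exact: cvg_cst.
have h1L (s : R) : `|2 * s| <= 2 * `|s| by rewrite normrM ger0_norm.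
have h0L (s : R) : `|s ^+ 2| <= 2 * s ^+ 2.
  by rewrite ger0_norm ?sqr_ge0// ler_peMl ?sqr_ge0// ler1n.
have hq (a b : R) : `|b ^+ 2 - a ^+ 2 - 2 * a * (b - a)| <= 2 * (b - a) ^+ 2.
  rewrite (_ : _ - _ = (b - a) ^+ 2); last by ring.
  by rewrite ger0_norm ?sqr_ge0// ler_peMl ?sqr_ge0// ler1n.
have [l dl hl] := @entropy_ineq _ _ (fun=> 2) 2 d0 d1 cc (fun=> ler0n R 2) (ler0n R 2)
  h1L h0L hq.
exists l => // t t0; apply: le_trans (hl t t0) _.
have w1 := flow_L1 fl t0; have bw := vb t0.
have [c1 c2] := nrm_conv_cube V1 w1 bw.
have v3 : L1 (fun x => v t x ^+ 3) by l1.
have v2 : L1 (fun x => v t x ^+ 2) by l1.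
have e3 : \int[mu]_x `|v t x| ^+ 3 = \int[mu]_x (v t x ^+ 3).
  by apply: eq_Rintegral => x _; rewrite ger0_norm ?flow_ge0.
rewrite e3 in c2.
have -> : \int[mu]_x ((v t x * (2 * v t x) - v t x ^+ 2) * velx A Vx (v t) x) =
   - A * \int[mu]_x (v t x ^+ 3) + \int[mu]_x (v t x ^+ 2 * conv Vx (v t) x).
  rewrite -IntZ// -IntD//; last by l1.
  by apply: eq_Rintegral => x _; rewrite /velx; ring.
(* the variance of [v] under the probability density [v] *)
have y2 : energy t ^+ 2 <= \int[mu]_x (v t x ^+ 3).
  rewrite -subr_ge0.
  have -> : \int[mu]_x (v t x ^+ 3) - energy t ^+ 2 =
     \int[mu]_x (v t x * (v t x - energy t) ^+ 2).
    have -> : \int[mu]_x (v t x * (v t x - energy t) ^+ 2) =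
       \int[mu]_x (v t x ^+ 3 + (-2 * energy t) * v t x ^+ 2 + energy t ^+ 2 * v t x).
      by apply: eq_Rintegral => x _; ring.
    rewrite IntD; [|by l1|by l1].
    rewrite IntD; [|by l1|by l1].
    rewrite !IntZ// flow_mass// -/(energy t); ring.
  by apply: Int_ge0 => x; rewrite mulr_ge0 ?sqr_ge0 ?flow_ge0.
have := le_trans (ler_norm _) (le_trans (Int_norm c1) c2).
have : 0 < A - nrm Vx by rewrite subr_gt0.
nra.
Qed.

(** If the energy exceeded [e] at the time [T] it would exceed [e] on all of
    [1, T] and decrease at the rate [c] at least, and so would vanish at [T]. *)
Lemma energy_decay (e : R) : 0 < e -> exists2 T : R, 1 <= T & forall t, T <= t -> energy t <= e.
Proof.
move=> e0; have [l dl hl] := energy_ineq.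
have k0 : 0 < A - nrm Vx by rewrite subr_gt0.
have nincr (s t : R) : 1 <= s -> s <= t -> energy t <= energy s.
  move=> s1 st; apply: (derive_le0_nincr st) => r sr _.
    by apply: dl; apply: lt_le_trans sr; exact: lt_le_trans s1.
  apply: le_trans (hl r _) _; first by apply: lt_le_trans sr; exact: lt_le_trans s1.
  by rewrite mulNr oppr_le0 mulr_ge0 ?sqr_ge0// ltW.
pose c := (A - nrm Vx) * e ^+ 2.
have c0 : 0 < c by rewrite mulr_gt0// exprn_gt0.
pose T := 1 + energy 1 / c.
have E1 : 0 <= energy 1 by apply: Int_ge0 => x; exact: sqr_ge0.
have T1 : 1 <= T by rewrite lerDl divr_ge0// ltW.
exists T => // t Tt; apply: le_trans (nincr _ _ T1 Tt) _.
rewrite leNgt; apply/negP => eT.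
pose f r := energy r + c * r.
have : f T <= f 1.
  apply: (@derive_le0_nincr _ f (fun r => l r + c) 1 T T1) => r r1 rT.
    have r0 : 0 < r by exact: lt_le_trans r1.
    apply: is_deriveD; first exact: dl.
    by apply: is_derive_eq; rewrite /GRing.scale/= mulr1.
  have r0 : 0 < r by exact: lt_le_trans r1.
  have h : e ^+ 2 <= energy r ^+ 2.
    have er : e <= energy r by apply: le_trans (ltW eT) (nincr _ _ r1 rT).
    by rewrite ler_sqr ?nnegrE ?(ltW e0)//; apply: le_trans er; exact: ltW.
  have := hl r r0; rewrite /c; nra.
rewrite /f /T mulrDr mulrCA divff ?gt_eqF//; lra.
Qed.

End contraction.

(** * The weight and the rarefaction wave *)

Section weight.
Context {R : realType}.
Local Notation mu := (@lebesgue_measure R).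

Lemma L1_oneDsqrV : L1 (fun x : R => (oneDsqr x)^-1).
Proof.
have c : continuous (fun x : R => (oneDsqr x)^-1) by exact: continuous_oneDsqrV.
have p (x : R) : 0 <= (oneDsqr x)^-1 by rewrite invr_ge0 (le_trans _ (oneDsqr_ge1 x)).
apply/integrableP; split; first by apply/measurable_EFinP; exact: continuous_measurable_fun.
under eq_integral => x _ do rewrite /= ger0_norm//.
rewrite ge0_symfun_integralT//; last first.
  by move=> x; rewrite /= /oneDsqr sqrrN.
rewrite -set_itvcy integral0y_oneDsqr -EFinM ltry//.
Qed.

Variable lam : R.
Hypothesis lam0 : 0 < lam.

(** The weight [1 / (1 + (x / lam) ^+ 2)], whose logarithmic derivative is at most
    [1 / lam]. *)
Definition wgt (x : R) : R := (oneDsqr (lam^-1 * x + 0))^-1.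

Definition dwgt (x : R) : R := - 2 * lam^-1 * (lam^-1 * x) * wgt x ^+ 2.

Let lamn : lam^-1 != 0. Proof. by rewrite invr_eq0 gt_eqF. Qed.

Lemma wgt_gt0 x : 0 < wgt x.
Proof. by rewrite invr_gt0 (lt_le_trans ltr01)// oneDsqr_ge1. Qed.

Lemma wgt_le1 x : wgt x <= 1. Proof. exact: oneDsqrV_le1. Qed.

Lemma L1_wgt : L1 wgt. Proof. exact: (L1_affine 0 lamn L1_oneDsqrV). Qed.

Lemma Int_wgt : \int[mu]_x wgt x = lam * \int[mu]_x (oneDsqr x)^-1.
Proof.
rewrite (Int_affine 0 lamn L1_oneDsqrV) gtr0_norm ?invr_gt0// mulrA divff ?gt_eqF//.
by rewrite mul1r.
Qed.

Lemma wgt_der (x : R) : is_derive x 1 wgt (dwgt x).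
Proof.
have d : is_derive x 1 (fun x : R => oneDsqr (lam^-1 * x + 0)) (2 * lam^-1 * (lam^-1 * x)).
  rewrite /oneDsqr; apply: is_derive_eq; rewrite /GRing.scale/=; ring.
have n : oneDsqr (lam^-1 * x + 0) != 0 by rewrite gt_eqF// (lt_le_trans ltr01)// oneDsqr_ge1.
have h : is_derive x 1 wgt _ := @is_deriveV _ (fun x : R => oneDsqr (lam^-1 * x + 0)) x _ 1 n d.
apply: is_derive_eq h _.
by rewrite /GRing.scale/= /dwgt /wgt -exprVn; ring.
Qed.

Lemma wgt_cont : continuous wgt.
Proof. exact: is_derive_cont wgt_der. Qed.

Lemma dwgt_cont : continuous dwgt.
Proof.
move=> x; apply: cvgM.
  by apply: cvgMl_tmp; apply: cvgMl_tmp.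
by apply: (@cvg_comp _ _ _ wgt (fun y => y ^+ 2) _ (nbhs (wgt x)));
  [exact: wgt_cont|exact: exprn_continuous].
Qed.

Lemma dwgt_le x : `|dwgt x| <= lam^-1 * wgt x.
Proof.
have w0 := wgt_gt0 x.
rewrite /dwgt; set z := lam^-1 * x.
have -> : - 2 * lam^-1 * z * wgt x ^+ 2 = lam^-1 * (- (2 * z) * wgt x * wgt x) by ring.
rewrite normrM gtr0_norm ?invr_gt0// ler_pM2l ?invr_gt0//.
rewrite normrM (gtr0_norm w0) ler_piMl ?(ltW w0)//.
rewrite normrM (gtr0_norm w0) normrN {1}/wgt addr0 ler_pdivrMr; last first.
  by rewrite (lt_le_trans ltr01)// oneDsqr_ge1.
rewrite mul1r /oneDsqr ler_norml -/z.
by have := sqr_ge0 (z - 1); have := sqr_ge0 (z + 1) => h1 h2; apply/andP; split; nra.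
Qed.

Lemma wgt_ac : ac_deriv wgt dwgt.
Proof.
apply: ac_C1; [exact: wgt_der|exact: dwgt_cont|].
apply: (L1_dom _ dwgt_le (L1Z lam^-1 L1_wgt)).
by apply: continuous_measurable_fun; exact: dwgt_cont.
Qed.

End weight.

Section rarefaction.
Context {R : realType}.
Local Notation mu := (@lebesgue_measure R).
Variable A : R.
Hypothesis hA : 0 < A.

(** [WRx] and [WRt] are the space and time derivatives of the rarefaction wave
    away from its two edges. *)
Definition WRx (t x : R) : R := (A * t)^-1 * ind (- (A * t / 2)) (A * t / 2) x.

Definition WRt (t x : R) : R := - A * (WR A x t * WRx t x).

Lemma WR_bound (x t : R) : 0 < t -> `|WR A x t| <= 2^-1.
Proof.
move=> t0; have At : 0 < A * t by rewrite mulr_gt0.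
rewrite /WR; case: ifPn => [_|]; first by rewrite normrN gtr0_norm.
rewrite -ltNge => h1; case: ifPn => h2; last by rewrite gtr0_norm.
rewrite ler_norml ler_pdivlMr// ler_pdivrMr//; lra.
Qed.

Lemma WR_in (x t : R) : 0 < t -> - (A * t / 2) <= x -> x <= A * t / 2 ->
  WR A x t = x / (A * t).
Proof.
move=> t0; have At : 0 < A * t by rewrite mulr_gt0.
rewrite /WR => h1 h2; case: ifPn => h3.
  have -> : x = - (A * t / 2) by apply/eqP; rewrite eq_le h1 h3.
  by field; rewrite ?gt_eqF.
case: ifPn => // h4.
have -> : x = A * t / 2 by apply/eqP; rewrite eq_le h2 leNgt h4.
by field; rewrite ?gt_eqF.
Qed.

Lemma L1_WRx t : 0 < t -> L1 (WRx t).
Proof.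
move=> t0; have At : 0 < A * t by rewrite mulr_gt0.
apply: L1_ind; first lra.
by apply: (@cont_int _ (fun=> (A * t)^-1)); [lra|move=> x; exact: cvg_cst].
Qed.

Lemma WRx_ge0 (t x : R) : 0 < t -> 0 <= WRx t x.
Proof.
move=> t0; have At : 0 < A * t by rewrite mulr_gt0.
by rewrite /WRx indE; [rewrite mulr_ge0// invr_ge0 ltW|lra].
Qed.

Lemma WRx_le (t x : R) : 0 < t -> WRx t x <= (A * t)^-1.
Proof.
move=> t0; have At : 0 < A * t by rewrite mulr_gt0.
rewrite /WRx indE; last lra.
by rewrite ler_piMr ?invr_ge0 ?(ltW At)// lern1 leq_b1.
Qed.

Lemma int_cst_ind (c a x : R) : a <= x -> \int[mu]_y (c * ind a x y) = c * (x - a).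
Proof.
move=> ax; rewrite (@Int_ind_itv _ (fun=> c))//.
transitivity (c * fine (mu `]a, x]%classic)); first exact: Rintegral_cst.
rewrite lebesgue_measure_itv/= lte_fin; case: ltP => //= xa.
by have -> : x = a by [apply/eqP; rewrite eq_le xa ax]; rewrite subrr mulr0.
Qed.

Lemma prim_WRx (t x : R) : 0 < t -> prim (WRx t) x = WR A x t + 2^-1.
Proof.
move=> t0; have At : 0 < A * t by rewrite mulr_gt0.
have aa : - (A * t / 2) <= A * t / 2 by lra.
rewrite primE /WRx.
have [h1|h1] := leP x (- (A * t / 2)).
  rewrite /WR h1 addNr -[RHS]Int0; apply: eq_Rintegral => y _.
  have [yx|xy] := leP (y : R) x; last by rewrite (below0 xy) mulr0.
  by rewrite indE// ltNge (le_trans yx h1)/= mulr0 mul0r.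
have [h2|h2] := leP x (A * t / 2).
  rewrite WR_in ?(ltW h1)//.
  transitivity (\int[mu]_y ((A * t)^-1 * ind (- (A * t / 2)) x y)).
    apply: eq_Rintegral => y _; rewrite -[LHS]mulrA; congr (_ * _).
    rewrite !indE ?(ltW h1)//; have [yx|xy] := leP (y : R) x.
      by rewrite below1// mulr1 (le_trans yx h2).
    by rewrite below0// mulr0 andbF.
  by rewrite int_cst_ind ?(ltW h1)//; field; rewrite ?gt_eqF.
transitivity (\int[mu]_y ((A * t)^-1 * ind (- (A * t / 2)) (A * t / 2) y)).
  apply: eq_Rintegral => y _; rewrite -[LHS]mulrA; congr (_ * _).
  rewrite !indE//; have [yx|xy] := leP (y : R) x; first by rewrite below1// mulr1.
  by rewrite below0// mulr0 [(y : R) <= _]leNgt (lt_trans h2 xy) andbF.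
rewrite int_cst_ind// /WR leNgt h1/= ltNge (ltW h2)/=.
by field; rewrite ?gt_eqF.
Qed.

Lemma WR_ac t : 0 < t -> ac_deriv (fun x => WR A x t) (WRx t).
Proof.
move=> t0; have h := ac_derivD (ac_prim (L1_WRx t0)) (ac_cst (- 2^-1)).
apply: ac_eq h _ _ => x; last by rewrite addr0.
by rewrite prim_WRx// addrK.
Qed.

Lemma bmf_WRx t : 0 < t -> bmf (WRx t).
Proof.
move=> t0; split; first by apply: L1_meas; exact: L1_WRx.
by exists ((A * t)^-1) => x; rewrite ger0_norm ?WRx_ge0// WRx_le.
Qed.

Lemma bmf_WRt t : 0 < t -> bmf (WRt t).
Proof.
by move=> t0; have b := ac_bmf (WR_ac t0); have b' := bmf_WRx t0; rewrite /WRt; bm.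
Qed.

End rarefaction.

Section rarefaction_time.
Context {R : realType}.
Local Notation mu := (@lebesgue_measure R).
Variable A : R.
Hypothesis hA : 0 < A.

Lemma WR_right (x t : R) : 0 < t -> A * t / 2 <= x -> WR A x t = 2^-1.
Proof.
move=> t0 h; have At : 0 < A * t by rewrite mulr_gt0.
by rewrite /WR leNgt (_ : _ < x)/=; [rewrite ltNge h|lra].
Qed.

Lemma WR_left (x t : R) : x <= - (A * t / 2) -> WR A x t = - 2^-1.
Proof. by move=> h; rewrite /WR h. Qed.

Lemma WR_odd (x t : R) : 0 < t -> WR A (- x) t = - WR A x t.
Proof.
move=> t0; have At : 0 < A * t by rewrite mulr_gt0.
have [h1|h1] := leP x (- (A * t / 2)).
  by rewrite (WR_left h1) opprK WR_right//; lra.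
have [h2|h2] := leP x (A * t / 2).
  by rewrite !(WR_in hA)// ?mulNr//; lra.
by rewrite (WR_right t0 (ltW h2)) WR_left//; lra.
Qed.

(** By symmetry [x >= 0]; then compare the value 1/2 or [x / (A s)] with 1/2 or
    [x / (A t)]. *)
Lemma WR_lip_le (x s t : R) : 0 < s -> s <= t -> `|WR A x s - WR A x t| <= (t - s) / t.
Proof.
move=> s0 st; have t0 : 0 < t by exact: lt_le_trans st.
wlog x0 : x / 0 <= x.
  move=> H; have [x0|x0] := leP 0 x; first exact: H.
  by have := H (- x); rewrite !WR_odd// -opprD normrN; apply; lra.
have As : 0 < A * s by rewrite mulr_gt0.
have At : 0 < A * t by rewrite mulr_gt0.
have Ast : A * s <= A * t by rewrite ler_pM2l.
have k0 : 0 <= (t - s) / t by rewrite divr_ge0 ?subr_ge0// ltW.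
have [h1|h1] := leP (A * t / 2) x.
  by rewrite !WR_right ?subrr ?normr0//; lra.
rewrite (WR_in hA (t := t)) ?(ltW h1)//; last lra.
have [h2|h2] := leP (A * s / 2) x.
  rewrite WR_right//.
  have a1 : x / (A * t) <= 2^-1 by rewrite ler_pdivrMr//; lra.
  have a2 : s / t / 2 <= x / (A * t).
    rewrite ler_pdivlMr// [leLHS](_ : _ = A * s / 2)//; field; rewrite gt_eqF//.
  rewrite ger0_norm ?subr_ge0// mulrBl divff ?gt_eqF//.
  have : 0 <= s / t by rewrite divr_ge0// ltW.
  have : s / t <= 1 by rewrite ler_pdivrMr// mul1r.
  lra.
rewrite (WR_in hA) ?(ltW h2)//; last lra.
have -> : x / (A * s) - x / (A * t) = x / (A * s) * ((t - s) / t).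
  by field; rewrite !gt_eqF.
rewrite ger0_norm; last by rewrite mulr_ge0// divr_ge0// ltW.
rewrite ler_piMl// ler_pdivrMr//; lra.
Qed.

Lemma WR_lip (x s t : R) : 0 < s -> 0 < t -> `|WR A x s - WR A x t| <= `|s - t| / t.
Proof.
move=> s0 t0; have [st|ts] := leP s t.
  have -> : `|s - t| = t - s by rewrite distrC ger0_norm ?subr_ge0.
  exact: WR_lip_le.
rewrite distrC; apply: le_trans (WR_lip_le x t0 (ltW ts)) _.
by rewrite gtr0_norm ?subr_gt0// ler_pM2l ?subr_gt0// lef_pV2// ltW.
Qed.

(** This is the Burgers equation satisfied by the wave away from its edges. *)
Lemma WR_der (t x : R) : 0 < t -> x != A * t / 2 -> x != - (A * t / 2) ->
  is_derive t 1 (fun s => WR A x s) (WRt A t x).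
Proof.
move=> t0 n1 n2; have At : 0 < A * t by rewrite mulr_gt0.
have aa : - (A * t / 2) <= A * t / 2 by lra.
have cA (c : R) : (fun s : R => c * s) s @[s --> t] --> c * t by apply: cvgMl_tmp.
have near_gt (y : R) : A * t / 2 < y -> \forall s \near t, A * s / 2 < y.
  move=> h; near=> s; rewrite mulrAC; near: s.
  by apply: (cvgr_lt _ (cA (A / 2))); rewrite mulrAC.
have near_lt (y : R) : y < A * t / 2 -> \forall s \near t, y < A * s / 2.
  move=> h; near=> s; rewrite mulrAC; near: s.
  by apply: (cvgr_gt _ (cA (A / 2))); rewrite mulrAC.
rewrite /WRt /WRx indE//.
have [h1|h1] := leP x (- (A * t / 2)).
  have h1' : A * t / 2 < - x by rewrite ltrNr lt_neqAle n2.
  rewrite /= !mulr0.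
  apply: (near_eq_is_derive _ (is_derive_cst (- 2^-1 : R) t 1)).
  near=> s; rewrite WR_left//.
  have : A * s / 2 < - x by near: s; exact: near_gt.
  lra.
have [h2|h2] := leP x (A * t / 2); last first.
  rewrite /= !mulr0.
  apply: (near_eq_is_derive _ (is_derive_cst (2^-1 : R) t 1)).
  near=> s; rewrite WR_right//; first by near: s; exact: lt_nbhsr.
  by apply: ltW; near: s; exact: near_gt.
have h2' : x < A * t / 2 by rewrite lt_neqAle n1.
have h1' : - x < A * t / 2 by lra.
rewrite /= mulr1 WR_in ?(ltW h1)//.
have tn : t != 0 by rewrite gt_eqF.
have d : is_derive t 1 (fun s => x / A * s^-1) (- A * (x / (A * t) / (A * t))).
  have dv := @is_deriveV _ id t _ 1 tn (is_derive_id t 1).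
  apply: is_derive_eq; rewrite /GRing.scale/=; field.
  by rewrite tn gt_eqF.
apply: (near_eq_is_derive _ d).
near=> s.
have s0 : 0 < s by near: s; exact: lt_nbhsr.
have a1 : x < A * s / 2 by near: s; exact: near_lt.
have a2 : - x < A * s / 2 by near: s; exact: near_lt.
rewrite WR_in//; [by rewrite invfM mulrA|lra|exact: ltW].
Unshelve. all: by end_near. Qed.

(** Dominated convergence: the quotients are bounded by [WR_lip] and converge
    except on the two edges of the wave. *)
Lemma WR_quot (t : R) (p : R -> R) : 0 < t -> L1 p -> (forall x, 0 <= p x) ->
  \int[mu]_x (`|(WR A x (t + h) - WR A x t) / h - WRt A t x| * p x) @[h --> 0^'] --> (0 : R).
Proof.
move=> t0 p1 p0; apply/cvgr_dnbhsP => u [un u0].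
have At : 0 < A * t by rewrite mulr_gt0.
have [N _ HN] : \forall n \near \oo, `|u n| < t.
  by have /cvgr0Pnorm_lt/(_ _ t0) := u0.
have tun n : (N <= n)%N -> 0 < t + u n.
  by move=> /HN; rewrite /= ltr_norml => /andP[]; lra.
have mW s : 0 < s -> measurable_fun setT (fun x => WR A x s).
  by move=> s0; have [] := ac_bmf (WR_ac hA s0).
have bt := bmf_WRt hA t0.
have [K hK] : exists K : R, forall x, `|WRt A t x| <= K by case: bt.
suff H : (fun n => \int[mu]_x (`|(WR A x (t + u (n + N)%N) - WR A x t) / u (n + N)%N - WRt A t x|
    * p x)) @ \oo --> \int[mu]_(x in setT) (0 : R).
  by rewrite -(cvg_shiftn N); move: H; rewrite Int0.
apply: (@Int_DCT _ _ _ (fun x => (t^-1 + K) * p x)).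
- move=> n; apply: measurable_funM; last exact: L1_meas.
  apply: measurableT_comp => //; apply: measurable_funB; last by case: bt.
  apply: measurable_funM => //; apply: measurable_funB; apply: mW => //.
  by apply: tun; exact: leq_addl.
- exact: measurable_cst.
- apply: aeS (aeI (ae_neq (A * t / 2)) (ae_neq (- (A * t / 2)))) => x [n1 n2].
  rewrite -[X in _ --> X](mul0r (p x)); apply: cvgMr_tmp.
  rewrite -[X in _ --> X](@normr0 _ R); apply: cvg_norm; apply/subr_cvg0.
  have d := WR_der t0 n1 n2.
  have dq : (WR A x (t + h) - WR A x t) / h @[h --> 0^'] --> WRt A t x.
    have [+ <-] := d; rewrite /derivable /derive => cv.
    apply: cvg_trans cv; apply: near_eq_cvg; near=> h.
    by rewrite /GRing.scale/= mulr1 [h + t]addrC mulrC.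
  apply: (@cvg_comp _ _ _ (fun n => (n + N)%N)
    (fun n => (WR A x (t + u n) - WR A x t) / u n) _ \oo); first exact: cvg_addnr.
  by move/cvgr_dnbhsP : dq; apply.
- exact: L1Z.
- move=> n x; set k := u _.
  have tk : 0 < t + k by apply: tun; exact: leq_addl.
  have k0 : k != 0 by exact: un.
  rewrite normrM normr_id (ger0_norm (p0 x)) ler_wpM2r//.
  apply: le_trans (ler_normB _ _) _; apply: lerD => //.
  rewrite normrM normfV ler_pdivrMr ?normr_gt0//.
  by apply: le_trans (WR_lip x tk t0) _; rewrite addrAC subrr add0r mulrC.
Unshelve. all: by end_near. Qed.

End rarefaction_time.

(** * The weighted distance to the rarefaction wave *)

Section modulated.
Context {R : realType}.
Local Notation mu := (@lebesgue_measure R).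
Variables (A eps : R) (V Vx : R -> R).
Hypotheses (hA : 0 < A) (heps : 0 <= eps) (hV : W11 V Vx) (hVx : nrm Vx < A).
Variables (v vx vt : R -> R -> R).
Hypothesis fl : viscous_flow A eps V v vx vt.
Variable u0 : R -> R.
Hypotheses (u01 : L1 u0) (u0_ge0 : {ae mu, forall x, 0 <= u0 x}) (u0_mass : \int[mu]_x u0 x = 1)
  (u0_cv : nrm (fun x => v s x - u0 x) @[s --> 0^'+] --> (0 : R)).

Let v_ge0 (t x : R) : 0 < t -> 0 <= v t x := flow_ge0 hA heps hV hVx fl u01 u0_ge0 u0_mass u0_cv (t := t) x.
Let v_mass (t : R) : 0 < t -> \int[mu]_x v t x = 1 := flow_mass fl u01 u0_mass u0_cv (t := t).

Definition potential (t x : R) : R := prim (v t) x - 2^-1.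
Definition deviation (t x : R) : R := potential t x - WR A x t.

Lemma potential_bound (t x : R) : 0 < t -> `|potential t x| <= 2^-1.
Proof.
move=> t0; have v1 := flow_L1 fl t0.
have p0 : 0 <= prim (v t) x.
  rewrite primE; apply: Int_ge0 => y; rewrite mulr_ge0 ?v_ge0//.
have p1 : prim (v t) x <= 1.
  rewrite -(v_mass t0) primE; apply: Int_le => // [|y].
    by apply: L1Mb => //; exact: bmf_below.
  by rewrite ler_piMr ?v_ge0// lern1 leq_b1.
by rewrite /potential ler_norml; apply/andP; split; lra.
Qed.

Lemma deviation_bound (t x : R) : 0 < t -> `|deviation t x| <= 1.
Proof.
move=> t0; apply: le_trans (ler_normB _ _) _.
by have := potential_bound x t0; have := WR_bound hA x t0; lra.
Qed.

Lemma potential_ac (t : R) : 0 < t -> ac_deriv (potential t) (v t).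
Proof.
move=> t0; apply: ac_eq (ac_derivD (ac_prim (flow_L1 fl t0)) (ac_cst (- 2^-1))) _ _ => x //.
by rewrite addr0.
Qed.

Lemma deviation_ac (t : R) : 0 < t -> ac_deriv (deviation t) (fun x => v t x - WRx A t x).
Proof.
move=> t0; apply: ac_eq (ac_derivD (potential_ac t0) (ac_derivZ (-1) (WR_ac hA t0))) _ _ => x;
by rewrite mulN1r.
Qed.

Section weighted.
Variable lam : R.
Hypothesis lam0 : 0 < lam.
Local Notation rho := (wgt lam).

(** The squared distance between the potential and the rarefaction wave on the
    scale [lam]. *)
Definition mod_energy (t : R) : R := \int[mu]_x (deviation t x ^+ 2 * rho x).

Let rho1 : L1 rho := L1_wgt lam0.
Let brho : bmf rho := ac_bmf (wgt_ac lam0).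
Let rho_ge0 x : 0 <= rho x := ltW (wgt_gt0 lam x).

(** The potential and the wave have the time derivatives [prim (vt t)], uniformly
    in [x], and [WRt], in the weighted L^1 norm; the quadratic remainder is of
    order [h]. *)
Lemma mod_energy_derive (t : R) : 0 < t ->
  is_derive t 1 mod_energy (\int[mu]_x (2 * deviation t x * (prim (vt t) x - WRt A t x) * rho x)).
Proof.
move=> t0.
pose e h := nrm (fun x => (v (t + h) x - v t x) / h - vt t x).
pose C h := nrm (vt t) + e h + t^-1.
pose P := \int[mu]_x rho x.
pose q h := \int[mu]_x (`|(WR A x (t + h) - WR A x t) / h - WRt A t x| * rho x).
have bD s : 0 < s -> bmf (deviation s) by move=> s0; exact: ac_bmf (deviation_ac s0).
have bW s : 0 < s -> bmf (fun x => WR A x s) by move=> s0; exact: ac_bmf (WR_ac hA s0).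
have bU s : 0 < s -> bmf (potential s) by move=> s0; exact: ac_bmf (potential_ac s0).
have bWt := bmf_WRt hA t0.
have bF := bmf_prim (flow_vt fl t0).
(* the three terms of the bound come from the remainder and from the two
   difference quotients *)
apply: (@is_deriveI _ _ _ _ (fun h => `|h| * (C h * C h) * P + 2 * P * e h + 2 * q h)); last first.
  have ce := flow_dt fl t0.
  have cC : C h @[h --> 0^'] --> nrm (vt t) + 0 + t^-1.
    by apply: cvgD; [apply: cvgD; [exact: cvg_cst|exact: ce]|exact: cvg_cst].
  have c0 : `|h| @[h --> (0 : R)^'] --> (0 : R).
    by rewrite -[X in _ --> X](@normr0 _ R); apply: cvg_norm; apply: nbhs_dnbhs.
  rewrite [X in _ --> X](_ : 0 = 0 * ((nrm (vt t) + 0 + t^-1) * (nrm (vt t) + 0 + t^-1)) * P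
     + 2 * P * 0 + 2 * 0); last by rewrite !mul0r !mulr0 !addr0.
  apply: cvgD; first (apply: cvgD).
  - by apply: cvgMr_tmp; apply: cvgM => //; exact: cvgM.
  - exact: cvgMl_tmp.
  - by apply: cvgMl_tmp; exact: WR_quot.
near=> h.
have hn : h != 0 by near: h; exact: nbhs_dnbhs_neq.
have th : 0 < t + h by near: h; exact: near0_addr_gt0.
pose dU x := (potential (t + h) x - potential t x) / h.
pose dW x := (WR A x (t + h) - WR A x t) / h.
have vs1 := flow_L1 fl th; have vt1 := flow_L1 fl t0; have vtt := flow_vt fl t0.
have q1 : L1 (fun x => (v (t + h) x - v t x) / h - vt t x).
  by apply: L1B => //; under eq_fun do rewrite mulrC; apply: L1Z; l1.
have dUF x : `|dU x - prim (vt t) x| <= e h.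
  have -> : dU x - prim (vt t) x = prim (fun x => (v (t + h) x - v t x) / h - vt t x) x.
    have -> : (fun x => (v (t + h) x - v t x) / h - vt t x) =
       (fun x => (h^-1 * v (t + h) x + (- h^-1) * v t x) + (-1) * vt t x).
      by apply/funext => y; field.
    rewrite !primD ?primZ//; [|exact: L1Z..|by apply: L1D; exact: L1Z|exact: L1Z].
    rewrite /dU /potential; field.
    by [].
  exact: prim_norm.
have dUC x : `|dU x| <= nrm (vt t) + e h.
  rewrite -[dU x](subrK (prim (vt t) x)) addrC; apply: le_trans (ler_normD _ _) _.
  by apply: lerD => //; exact: prim_norm.
have dWC x : `|dW x| <= t^-1.
  rewrite normrM normfV ler_pdivrMr ?normr_gt0//.
  by apply: le_trans (WR_lip hA x th t0) _; rewrite addrAC subrr add0r mulrC.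
have dD x : deviation (t + h) x - deviation t x = h * (dU x - dW x).
  by rewrite /deviation /dU /dW; field.
have dUWC x : `|dU x - dW x| <= C h.
  by apply: le_trans (ler_normB _ _) _; apply: lerD.
have bdU : bmf dU.
  have b1 := bU _ th; have b2 := bU _ t0.
  by rewrite /dU; bm.
have bdW : bmf dW.
  have b1 := bW _ th; have b2 := bW _ t0.
  by rewrite /dW; bm.
have b1 := bD _ th; have b2 := bD _ t0.
pose X1 x := h * (dU x - dW x) * (dU x - dW x) * rho x.
pose X2 x := 2 * deviation t x * (dU x - prim (vt t) x) * rho x.
pose X3 x := 2 * deviation t x * (dW x - WRt A t x) * rho x.
have X11 : L1 X1 by rewrite /X1; apply: bL1M => //; bm.
have X21 : L1 X2 by rewrite /X2; apply: bL1M => //; bm.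
have X31 : L1 X3 by rewrite /X3; apply: bL1M => //; bm.
have -> : (mod_energy (t + h) - mod_energy t) / h -
    \int[mu]_x (2 * deviation t x * (prim (vt t) x - WRt A t x) * rho x)
   = \int[mu]_x X1 x + \int[mu]_x X2 x - \int[mu]_x X3 x.
  rewrite /mod_energy -IntB; [|by apply: bL1M => //; bm..].
  rewrite mulrC -IntZ; last by apply: L1B; apply: bL1M => //; bm.
  rewrite -IntB; [|by apply: L1Z; apply: L1B; apply: bL1M => //; bm|by apply: bL1M => //; bm].
  rewrite -IntD// -IntB//; last by l1.
  apply: eq_Rintegral => x _; rewrite /X1 /X2 /X3.
  have -> : deviation (t + h) x = deviation t x + h * (dU x - dW x) by rewrite -dD [RHS]addrC subrK.
  field.
  by [].
have C0 : 0 <= C h by apply: le_trans (dUWC 0).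
apply: le_trans (ler_normB _ _) _; apply: lerD; first (apply: le_trans (ler_normD _ _) _; apply: lerD).
- apply: le_trans (Int_norm X11) _; rewrite /P -IntZ//.
  apply: Int_le => [||x]; [exact: L1_abs|exact: L1Z|].
  rewrite !normrM (ger0_norm (rho_ge0 x)) ler_wpM2r// -mulrA ler_wpM2l//.
  by apply: ler_pM.
- apply: le_trans (Int_norm X21) _; rewrite /P mulrAC -IntZ//.
  apply: Int_le => [||x]; [exact: L1_abs|exact: L1Z|].
  rewrite !normrM (ger0_norm (rho_ge0 x)) ler_wpM2r// ger0_norm// -mulrA ler_wpM2l//.
  by rewrite -[leRHS]mul1r ler_pM// deviation_bound.
- apply: le_trans (Int_norm X31) _; rewrite /q -IntZ; last first.
    by apply: bL1M => //; bm.
  apply: Int_le => [||x]; [exact: L1_abs|by apply: L1Z; apply: bL1M => //; bm|].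
  rewrite !normrM (ger0_norm (rho_ge0 x)) ger0_norm// -!mulrA ler_wpM2l//.
  by rewrite ler_piMl ?deviation_bound// mulr_ge0.
Unshelve. all: by end_near. Qed.

(** With [D = U - W] and [S = U + W] for the potential [U] and the wave [W], the
    integrals of [(rho * D * v)'] and of [(rho * S * D ^+ 2)'] vanish.  Adding
    them with the factors [- 2 eps] and [A / 2] to the time derivative removes the
    second-order term and turns the difference of the two Burgers fluxes into
    [- A / 2 * rho * (v + W') * D ^+ 2 <= 0]: this sign is the compressivity of
    the nonnegative densities [v] and [W'].  What remains is an error from the
    derivative of the weight, the viscous term, and the interaction with [V],
    bounded by the L^2 norm of [v] squared. *)
Lemma mod_energy_ineq (t : R) : 0 < t ->
  \int[mu]_x (2 * deviation t x * (prim (vt t) x - WRt A t x) * rho x) <=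
  A / (2 * lam) * mod_energy t + (2 * eps * ((A * t)^-1 + lam^-1) + 2 * nrm V * energy v t).
Proof.
move=> t0.
have [V1 _ _] := hV.
have v1 := flow_L1 fl t0; have vac := flow_ac fl t0; have bv := ac_bmf vac.
have [vx1 _] := vac.
have bD := ac_bmf (deviation_ac t0); have bW := ac_bmf (WR_ac hA t0); have bU := ac_bmf (potential_ac t0).
have Wx1 := L1_WRx hA t0.
have bWx := bmf_WRx hA t0; have bWt := bmf_WRt hA t0.
have bF := bmf_prim (flow_vt fl t0).
have dr1 : L1 (dwgt lam) by case: (wgt_ac lam0).
pose S x := potential t x + WR A x t.
have Sac : ac_deriv S (fun x => v t x + WRx A t x) := ac_derivD (potential_ac t0) (WR_ac hA t0).
have bS := ac_bmf Sac.
have [Q1 Qb] := nrm_conv_sqr V1 v1 bv.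
(* [rho * D * v] and [rho * S * D ^+ 2] *)
have ac1 := ac_mul (ac_mul (wgt_ac lam0) (deviation_ac t0)) vac.
have l1' : L1 (fun x => rho x * deviation t x * v t x) by apply: bL1M => //; bm.
have z1 := ac_int0 ac1 l1'.
have ac2 := ac_mul (ac_mul (wgt_ac lam0) Sac) (ac_sqr (deviation_ac t0)).
have l2' : L1 (fun x => rho x * S x * deviation t x ^+ 2).
  by apply: L1Mb; [exact: L1Mb|exact: bmfX].
have z2 := ac_int0 ac2 l2'.
have [m1 _] := ac1; have [m2 _] := ac2.
set g1 := (fun x => _) in m1 z1; set g2 := (fun x => _) in m2 z2.
pose T x := 2 * deviation t x * (prim (vt t) x - WRt A t x) * rho x.
have T1 : L1 T by rewrite /T; apply: bL1M => //; bm.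
pose Z x := A / (2 * lam) * (deviation t x ^+ 2 * rho x) + (2 * eps * ((A * t)^-1 + lam^-1) * v t x
   + 2 * `|v t x * conv V (v t) x|).
have E1 : L1 (fun x => deviation t x ^+ 2 * rho x) by apply: bL1M => //; bm.
have Q1' := L1_abs Q1.
have Z1 : L1 Z by rewrite /Z; apply: L1D; [exact: L1Z|apply: L1D; exact: L1Z].
have key : \int[mu]_x (T x + (- (2 * eps) * g1 x + A / 2 * g2 x)) <= \int[mu]_x Z x.
  apply: Int_ae_le => //.
    by apply: L1D => //; apply: L1D; exact: L1Z.
  apply: aeS (flow_eqn fl t0) => x Fx.
  rewrite /T Fx /g1 /g2 /vel (v_mass t0) mulr1 -/(potential t x).
  have W0 := WRx_ge0 hA x t0; have W1 := WRx_le hA x t0.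
  have v0 := v_ge0 x t0; have D1 := deviation_bound x t0; have r0 := rho_ge0 x; have r1 := wgt_le1 lam x.
  have dr := dwgt_le lam0 x.
  have S1 : `|S x| <= 1.
    apply: le_trans (ler_normD _ _) _.
    by have := potential_bound x t0; have := WR_bound hA x t0; lra.
  have -> : potential t x = 2^-1 * (S x + deviation t x) by rewrite /S /deviation; field.
  rewrite /WRt.
  have -> : WR A x t = 2^-1 * (S x - deviation t x) by rewrite /S /deviation; field.
  rewrite /Z normrM (ger0_norm v0).
  move: (S x) (deviation t x) (conv V (v t) x) (rho x) (dwgt lam x) (v t x) (vx t x) (WRx A t x)
    S1 D1 r0 r1 dr v0 W0 W1 => s d Q r r' w wx W S1 D1 r0 r1 dr v0 W0 W1.
  (* the second-order term [2 eps r d wx] cancels here *)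
  have -> : 2 * d * (eps * wx + w * (- A * (2^-1 * (s + d)) + Q) -
      - A * (2^-1 * (s - d) * W)) * r +
    (- (2 * eps) * ((r' * d + r * (w - W)) * w + r * d * wx) +
     A / 2 * ((r' * s + r * (w + W)) * d ^+ 2 + r * s * (2 * d * (w - W)))) =
    2 * (w * (r * d * Q)) + 2 * eps * (w * (- (r' * d)) + w * (r * W) - r * w ^+ 2)
    + A / 2 * (d ^+ 2 * (r' * s)) - A / 2 * (r * (w + W) * d ^+ 2) by field.
  have e1 : r * d * Q <= `|Q|.
    apply: le_trans (ler_norm _) _; rewrite normrM ler_piMl// normrM (ger0_norm r0).
    by rewrite mulr_ile1.
  have e2 : - (r' * d) <= lam^-1.
    apply: le_trans (ler_norm _) _; rewrite normrN normrM.
    rewrite -[leRHS]mulr1; apply: ler_pM => //; apply: le_trans dr _.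
    by rewrite ler_piMr// invr_ge0 ltW.
  have e3 : r * W <= (A * t)^-1.
    by apply: le_trans W1; rewrite ler_piMl.
  have e4 : r' * s <= lam^-1 * r.
    apply: le_trans (ler_norm _) _; rewrite normrM; apply: le_trans dr.
    by rewrite ler_piMr.
  have f1 : w * (r * d * Q) <= w * `|Q| by rewrite ler_wpM2l.
  have f2 : 2 * eps * (w * (- (r' * d)) + w * (r * W) - r * w ^+ 2) <=
     2 * eps * ((A * t)^-1 + lam^-1) * w.
    rewrite -[leRHS]mulrA ler_wpM2l ?mulr_ge0//.
    have k1 : w * (- (r' * d)) <= w * lam^-1 by rewrite ler_wpM2l.
    have k2 : w * (r * W) <= w * (A * t)^-1 by rewrite ler_wpM2l.
    have k3 : 0 <= r * w ^+ 2 by rewrite mulr_ge0 ?sqr_ge0.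
    lra.
  have f3 : A / 2 * (d ^+ 2 * (r' * s)) <= A / (2 * lam) * (d ^+ 2 * r).
    rewrite (_ : A / (2 * lam) * _ = A / 2 * (d ^+ 2 * (lam^-1 * r))); last first.
      by field; rewrite gt_eqF.
    by rewrite ler_wpM2l ?divr_ge0 ?(ltW hA)// ler_wpM2l ?sqr_ge0.
  have f4 : 0 <= A / 2 * (r * (w + W) * d ^+ 2).
    by rewrite mulr_ge0 ?divr_ge0 ?(ltW hA)// mulr_ge0 ?sqr_ge0// mulr_ge0// addr_ge0.
  lra.
have -> : \int[mu]_x (2 * deviation t x * (prim (vt t) x - WRt A t x) * rho x) =
    \int[mu]_x (T x + (- (2 * eps) * g1 x + A / 2 * g2 x)).
  rewrite IntD//; last by apply: L1D; exact: L1Z.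
  by rewrite IntD ?IntZ; [rewrite z1 z2 !mulr0 !addr0|..] => //; exact: L1Z.
apply: le_trans key _.
rewrite /Z IntD; [|exact: L1Z|by apply: L1D; exact: L1Z].
rewrite IntD; [|exact: L1Z..].
rewrite !IntZ// (v_mass t0) mulr1 lerD2l lerD2l -mulrA ler_wpM2l//.
Qed.

(** The function [(mod_energy t + b / c) * exp (- c t)] with [c = A / (2 lam)] is
    nonincreasing. *)
Lemma mod_energy_gronwall (T0 T b : R) : 0 < T0 -> T0 <= T ->
  (forall t, T0 <= t -> 2 * eps * ((A * t)^-1 + lam^-1) + 2 * nrm V * energy v t <= b) ->
  0 <= b ->
  mod_energy T <= (mod_energy T0 + b * (2 * lam / A)) * expR (A / (2 * lam) * T).
Proof.
move=> T00 TT hb b0.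
pose c := A / (2 * lam).
have c0 : 0 < c by rewrite divr_gt0// mulr_gt0.
have -> : b * (2 * lam / A) = b / c.
  by rewrite /c; field; rewrite !gt_eqF.
pose f t := (mod_energy t + b / c) * expR (- c * t).
pose l t := \int[mu]_x (2 * deviation t x * (prim (vt t) x - WRt A t x) * rho x).
have fT : f T <= f T0.
  apply: (@derive_le0_nincr _ f
    (fun t => (l t - c * (mod_energy t + b / c)) * expR (- c * t)) T0 T TT) => t tT _.
    have t0 : 0 < t by exact: lt_le_trans tT.
    have d1 : is_derive t 1 (fun t => mod_energy t + b / c) (l t).
      have d := is_deriveD (mod_energy_derive t0) (is_derive_cst (b / c) t 1).
      by apply: is_derive_eq d _; rewrite addr0.
    have dl : is_derive t 1 (fun t : R => - c * t) (- c).
      by apply: is_derive_eq; rewrite /GRing.scale/= mulr1.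
    have d2 := @is_derive1_comp _ expR (fun t : R => - c * t) t _ _ (is_derive_expR _) dl.
    apply: is_derive_eq (is_deriveM d1 d2) _.
    by rewrite /GRing.scale/=; ring.
  have t0 : 0 < t by exact: lt_le_trans tT.
  rewrite pmulr_lle0 ?expR_gt0// subr_le0 mulrDr mulrCA divff ?gt_eqF// mulr1.
  by apply: le_trans (mod_energy_ineq t0) _; rewrite lerD2l hb.
have E0 t : 0 <= mod_energy t.
  by apply: Int_ge0 => x; rewrite mulr_ge0 ?sqr_ge0.
have bc : 0 <= b / c by rewrite divr_ge0// ltW.
apply: (@le_trans _ _ (mod_energy T + b / c)); first by rewrite lerDl.
have -> : mod_energy T + b / c = f T * expR (c * T).
  by rewrite /f -mulrA -expRD mulNr addNr expR0 mulr1.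
rewrite ler_wpM2r ?expR_ge0//; apply: le_trans fT _.
rewrite /f ler_piMr ?addr_ge0// -expR0 ler_expR mulNr oppr_le0.
by rewrite mulr_ge0 ?(ltW c0) ?(ltW T00).
Qed.

(** The deviation is at most [e] outside of [-N, N] and at most 1 inside. *)
Lemma mod_energy_start (T0 e N : R) : 0 < T0 -> 0 <= N ->
  (forall x, (x <= - N) || (N < x) -> `|deviation T0 x| <= e) ->
  mod_energy T0 <= e ^+ 2 * (lam * \int[mu]_x (oneDsqr x)^-1) + 2 * N.
Proof.
move=> T00 N0 hN; have NN : - N <= N by lra.
have i1 : L1 (fun x => 1 * ind (- N) N x).
  by apply: L1_ind => //; apply: (@cont_int _ (fun=> 1)) => // x; exact: cvg_cst.
have bD := ac_bmf (deviation_ac T00).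
rewrite -Int_wgt// -IntZ//.
have -> : 2 * N = \int[mu]_x (1 * ind (- N) N x) by rewrite int_cst_ind//; ring.
rewrite -IntD//; last exact: L1Z.
apply: Int_le => [||x]; [by apply: bL1M => //; bm|by apply: L1D => //; exact: L1Z|].
rewrite indE// mul1r; have [/andP[h1 h2]|] := boolP ((- N < x) && (x <= N)).
  have : deviation T0 x ^+ 2 <= 1.
    by rewrite -[leLHS]real_normK ?num_real// expr_le1// deviation_bound.
  move=> D1; apply: (@le_trans _ _ 1).
    by rewrite mulr_ile1 ?sqr_ge0 ?wgt_le1.
  by rewrite lerDr mulr_ge0 ?sqr_ge0.
rewrite negb_and -leNgt -ltNge addr0 => h; rewrite ler_wpM2r//.
have e0 : 0 <= e by apply: le_trans (hN x h).
by rewrite -[leLHS]real_normK ?num_real// ler_sqr ?nnegrE// hN.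
Qed.

End weighted.
End modulated.

Section convergence.
Context {R : realType}.
Local Notation mu := (@lebesgue_measure R).
Variables (A eps : R) (V Vx : R -> R).
Hypotheses (hA : 0 < A) (heps : 0 <= eps) (hV : W11 V Vx) (hVx : nrm Vx < A).
Variables (v vx vt : R -> R -> R).
Hypothesis fl : viscous_flow A eps V v vx vt.
Variable u0 : R -> R.
Hypotheses (u01 : L1 u0) (u0_ge0 : {ae mu, forall x, 0 <= u0 x}) (u0_mass : \int[mu]_x u0 x = 1)
  (u0_cv : nrm (fun x => v s x - u0 x) @[s --> 0^'+] --> (0 : R)).

(** The potential tends to the same constants as the wave at both infinities. *)
Lemma deviation_vanish (t e : R) : 0 < t -> 0 < e ->
  exists2 N, 0 <= N & forall x, (x <= - N) || (N < x) -> `|deviation A v t x| <= e.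
Proof.
move=> t0 e0; have v1 := flow_L1 fl t0.
have At : 0 < A * t by rewrite mulr_gt0.
have vm := flow_mass fl u01 u0_mass u0_cv t0.
have [M1 [_ h1]] : \forall x \near +oo, `|1 - prim (v t) x| < e.
  by have /cvgrPdist_lt/(_ _ e0) := prim_pinfty v1; rewrite vm.
have [M2 [_ h2]] : \forall x \near -oo, `|0 - prim (v t) x| < e.
  by have /cvgrPdist_lt/(_ _ e0) := prim_ninfty v1.
exists (`|M1| + `|M2| + A * t + 1); first by rewrite !addr_ge0// ltW.
move=> x hx.
have n1 := ler_norm M1; have n2 := ler_norm (- M2); rewrite normrN in n2.
have p1 := normr_ge0 M1; have p2 := normr_ge0 M2.
rewrite /deviation /potential; case/orP: hx => hx.
  rewrite WR_left; last lra.
  rewrite opprK subrK -normrN -sub0r ltW// h2//; lra.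
rewrite WR_right//; last lra.
rewrite -addrA -opprD (_ : 2^-1 + 2^-1 = 1); last lra.
rewrite distrC ltW// h1//; lra.
Qed.

(** Start at a time [T0] after which the energy of [v] is small, and which does
    not depend on [lam].  By [mod_energy_start] the initial distance is
    [o(lam)]; up to the time [lam * t0] the error terms accumulate to a small
    multiple of [lam], and the Gronwall factor is [exp (A * t0 / 2)] whatever
    [lam]: the width of the weight is chosen for this. *)
Lemma mod_energy_small (t0 d : R) : 0 < t0 -> 0 < d ->
  \forall lam \near +oo, mod_energy A v lam (lam * t0) <= d * lam.
Proof.
move=> t00 d0.
pose G := expR (A * t0 / 2); pose P1 := \int[mu]_x (oneDsqr x : R)^-1.
have G0 : 0 < G by exact: expR_gt0.
have P10 : 0 <= P1.
  by apply: Int_ge0 => x; rewrite invr_ge0 (le_trans _ (oneDsqr_ge1 x)).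
(* a forcing [b] contributes [b * (2 lam / A) * G = d * lam / 2] *)
have [b bE] : exists b, b = A * d / (4 * G) by exists (A * d / (4 * G)).
have b0 : 0 < b by rewrite bE divr_gt0 ?mulr_gt0.
have nV := nrm_ge0 V.
have eV : 0 < b / (4 * (nrm V + 1)) by apply: divr_gt0 => //; lra.
have [T1 T11 hT1] := energy_decay hA heps hV hVx fl u01 u0_ge0 u0_mass u0_cv eV.
pose T0 := T1 + 8 * eps / (A * b).
have T0T1 : T1 <= T0.
  rewrite lerDl; apply: divr_ge0; [exact: mulr_ge0|apply: ltW; exact: mulr_gt0].
have T00 : 0 < T0 by lra.
pose e := Num.min 1 (d / (4 * G * (P1 + 1))).
have e0 : 0 < e by rewrite lt_min ltr01/= divr_gt0// !mulr_gt0//; lra.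
have [N N0 hN] := deviation_vanish T00 e0.
near=> lam.
have lam0 : 0 < lam by near: lam; exact: nbhs_pinfty_gt.
have lamT : T0 <= lam * t0.
  by rewrite -ler_pdivrMr//; near: lam; apply: nbhs_pinfty_ge; exact: num_real.
have lame : 8 * eps / b <= lam by near: lam; apply: nbhs_pinfty_ge; exact: num_real.
have lamN : 8 * N * G / d <= lam by near: lam; apply: nbhs_pinfty_ge; exact: num_real.
have hb t : T0 <= t -> 2 * eps * ((A * t)^-1 + lam^-1) + 2 * nrm V * energy v t <= b.
  move=> tT; have t1 : 0 < t by exact: lt_le_trans tT.
  have h1 : 2 * eps * lam^-1 <= b / 4.
    rewrite ler_pdivrMr// mulrAC ler_pdivlMr//.
    by move: lame; rewrite ler_pdivrMr//; lra.
  have h2 : 2 * eps * (A * t)^-1 <= b / 4.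
    rewrite ler_pdivrMr ?mulr_gt0//.
    have : 8 * eps / (A * b) <= t by apply: le_trans tT; rewrite /T0; lra.
    by rewrite ler_pdivrMr ?mulr_gt0//; lra.
  have h3 : 2 * nrm V * energy v t <= b / 2.
    have := hT1 _ (le_trans T0T1 tT).
    rewrite ler_pdivlMr ?mulr_gt0//; last lra.
    have : 0 <= energy v t by apply: Int_ge0 => x; exact: sqr_ge0.
    lra.
  lra.
apply: le_trans (mod_energy_gronwall hA heps hV hVx fl u01 u0_ge0 u0_mass u0_cv lam0 T00 lamT hb (ltW b0)) _.
have -> : A / (2 * lam) * (lam * t0) = A * t0 / 2 by field; rewrite gt_eqF.
rewrite -/G.
have := mod_energy_start hA heps hV hVx fl u01 u0_ge0 u0_mass u0_cv lam0 T00 N0 hN.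
rewrite -/P1; set E0 := mod_energy _ _ _ _ => hE.
have -> : b * (2 * lam / A) = d * lam / (2 * G).
  by rewrite bE; field; rewrite !gt_eqF.
rewrite mulrDl (_ : d * lam / (2 * G) * G = d * lam / 2); last by field; rewrite gt_eqF.
suff : E0 * G <= d * lam / 2 by lra.
apply: (@le_trans _ _ ((e ^+ 2 * (lam * P1) + 2 * N) * G)); first by rewrite ler_pM2r.
have a1 : 2 * N * G <= d * lam / 4.
  by move: lamN; rewrite ler_pdivrMr//; lra.
have a2 : e ^+ 2 * (lam * P1) * G <= d * lam / 4.
  have e1 : e <= 1 by rewrite ge_min lexx.
  have e2 : e <= d / (4 * G * (P1 + 1)) by rewrite ge_min lexx orbT.
  have e3 : e ^+ 2 <= e by rewrite expr2 ler_piMr// ltW.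
  have e4 : e * (4 * G * (P1 + 1)) <= d by rewrite -ler_pdivlMr// !mulr_gt0//; lra.
  apply: (@le_trans _ _ (e * (lam * P1) * G)).
    by rewrite ler_pM2r// ler_wpM2r// mulr_ge0// ltW.
  have : e * (4 * G * (P1 + 1)) * lam <= d * lam by rewrite ler_pM2r.
  have : 0 <= e * G * lam by rewrite !mulr_ge0// ltW.
  lra.
lra.
Unshelve. all: by end_near. Qed.

End convergence.

(** * The rescaled pairing as a distance between potentials *)

Section rescaled_error.
Context {R : realType}.
Local Notation mu := (@lebesgue_measure R).

Lemma test_supp (phi : R -> R) : test_function phi ->
  exists2 m : R, 0 <= m & forall x, (x < - m) || (m < x) -> phi x = 0.
Proof.
move=> [_ cphi].
have := compact_bounded cphi.
rewrite /bounded_set => -[M [Mr hM]].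
exists (`|M| + 1) => [|x hx]; first by rewrite addr_ge0.
apply/eqP; apply: contraT => fx.
have := hM (`|M| + 1).
have -> : M < `|M| + 1 by rewrite (le_lt_trans (ler_norm _))// ltrDl.
move=> /(_ isT x) h; have := h (@subset_closure _ _ x fx).
rewrite /= ler_norml; case/orP: hx => hx; lra.
Qed.

Lemma test_der (phi : R -> R) : test_function phi ->
  [/\ forall x : R, is_derive x 1 phi (derive1 phi x),
      continuous phi & continuous (derive1 phi)].
Proof.
move=> [d _].
have c f : (forall x : R, derivable f x 1) -> continuous f.
  by move=> df x; apply: differentiable_continuous; apply/derivable1_diffP.
split.
- by move=> x; apply: DeriveDef; [exact: (d 0%N)|rewrite derive1E].
- by apply: c => x; exact: (d 0%N).
- by apply: c => x; exact: (d 1%N).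
Qed.

Lemma derive1_supp (phi : R -> R) (m : R) : (forall x, (x < - m) || (m < x) -> phi x = 0) ->
  forall x, (x < - m) || (m < x) -> derive1 phi x = 0.
Proof.
move=> h x hx; rewrite derive1E.
rewrite (@near_eq_derive _ _ _ phi (fun=> 0)); first exact: derive_cst.
case/orP: hx => hx; near=> y; apply: h.
  by apply/orP; left; near: y; exact: lt_nbhsl.
by apply/orP; right; near: y; exact: lt_nbhsr.
Unshelve. all: by end_near. Qed.

Lemma test_function_L1 (phi : R -> R) : test_function phi ->
  [/\ bmf phi, L1 phi, bmf (derive1 phi) & L1 (derive1 phi)].
Proof.
move=> tphi; have [m _ hm] := test_supp tphi; have hm' := derive1_supp hm.
have [_ cphi cdphi] := test_der tphi.
have b := bounded_supp cphi hm; have b' := bounded_supp cdphi hm'.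
by split => //; [exact: L1_supp b hm|exact: L1_supp b' hm'].
Qed.

Lemma test_scale (phi : R -> R) (a : R) : 0 < a -> test_function phi ->
  test_function (fun x => phi (a * x)) /\
  derive1 (fun x => phi (a * x)) = (fun x => a * derive1 phi (a * x)).
Proof.
move=> a0 tphi; have [d _] := tphi.
have da (x : R) : is_derive x 1 (fun x : R => a * x) a.
  by apply: is_derive_eq; rewrite /GRing.scale/= mulr1.
have step (f : R -> R) : (forall x : R, derivable f x 1) -> forall x : R,
   is_derive x 1 (fun x => f (a * x)) (a * derive1 f (a * x)).
  move=> df x; rewrite mulrC; apply: (@is_derive1_comp _ f (fun x : R => a * x) x) => //.
  by apply: DeriveDef; [exact: df|rewrite derive1E].
have step1 (c : R) (f : R -> R) : (forall x : R, derivable f x 1) ->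
   forall x : R, is_derive x 1 (fun x => c * f (a * x)) (c * (a * derive1 f (a * x))).
  move=> df x; have h := is_deriveM (is_derive_cst c x 1) (step f df x).
  by apply: is_derive_eq h _; rewrite /GRing.scale/= mulr0 addr0.
have E n : derive1n n (fun x => phi (a * x)) = (fun x => a ^+ n * derive1n n phi (a * x)).
  elim: n => [|n ih]; first by apply/funext => x; rewrite expr0 mul1r.
  rewrite derive1nS ih; apply/funext => x; rewrite derive1E.
  have h := step1 (a ^+ n) _ (d n) x; rewrite derive_val derive1nS exprS.
  by rewrite mulrCA mulrA.
have E1 := E 1%N; rewrite expr1 in E1.
split; last exact: E1.
split.
  by move=> n x; rewrite E; have [] := step1 (a ^+ n) _ (d n) x.
have [m m0 hm] := test_supp tphi.
apply: (@subclosed_compact _ _ `[- m / a, m / a]%classic); first exact: closed_closure.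
  exact: segment_compact.
rewrite (closure_id `[- m / a, m / a]%classic).1; last exact: interval_closed.
apply: closure_subset => x /= fx; rewrite in_itv/= ler_pdivrMr// ler_pdivlMr// [x * a]mulrC.
apply: contraT; rewrite negb_and -!ltNge => /hm e; by rewrite e eqxx in fx.
Qed.

Lemma L1_loc (f g : R -> R) (m : R) : locally_integrable setT f -> bmf g ->
  (forall x, (x < - m) || (m < x) -> g x = 0) -> L1 (fun x => f x * g x).
Proof.
move=> [mf _ fK] bg g0.
have mi : measurable (`[- m, m]%classic : set R) by exact: measurable_itv.
have fi : mu.-integrable `[- m, m] (EFin \o f).
  apply/integrableP; split.
    by apply/measurable_EFinP; exact: measurable_funTS.
  exact: (fK _ _ (@segment_compact _ (- m) m)).
have f1 : L1 (f \_ `[- m, m]).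
  by move/integrable_mkcond : fi; rewrite restrict_EFin; apply.
have := L1Mb f1 bg; congr (L1 _); apply/funext => x.
rewrite /patch; case: ifPn => //.
rewrite mem_setE in_itv/= negb_and -!ltNge => /g0 ->.
by rewrite !mulr0.
Qed.

Lemma WR_scale (A lam x t : R) : 0 < lam -> WR A (lam * x) (lam * t) = WR A x t.
Proof.
move=> lam0; rewrite /WR mulrCA -!mulrA -mulrN ler_pM2l// ltr_pM2l//.
case: ifP => // _; case: ifP => // _.
rewrite [LHS]mulrCA; congr (x * _).
by rewrite invfM mulrA mulfV ?gt_eqF// mul1r.
Qed.

(** Substitute [lam * x], integrate by parts against the dilated test function and
    use that the wave is invariant under the scaling of space and time. *)
Lemma rescaled_error (A : R) (F : R -> R) (u : R -> R -> R) (phi : R -> R) (lam t0 : R) :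
  0 < A -> 0 < t0 -> 0 < lam -> test_function phi ->
  weak_derivative F (u^~ (lam * t0)) ->
  `|(- (\int[mu]_x (WR A x t0 * derive1 phi x))) - \int[mu]_x (rescale lam u x t0 * phi x)|
  <= lam^-1 * \int[mu]_x (`|F x - WR A x (lam * t0)| * `|derive1 phi (lam^-1 * x + 0)|).
Proof.
move=> hA t00 lam0 tphi; move fE : (u^~ (lam * t0)) => f wFf.
have li : 0 < lam^-1 by rewrite invr_gt0.
have lin : lam^-1 != 0 by rewrite gt_eqF.
have lamn : lam != 0 by rewrite gt_eqF.
have Tp : 0 < lam * t0 by rewrite mulr_gt0.
have [tphil dphil] := test_scale li tphi.
have [m m0 hm] := test_supp tphi.
have hm' := derive1_supp hm.
have [bphi _ bdphi dphi1] := test_function_L1 tphi.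
have [lF lf wd] := wFf.
have baff g : bmf g -> bmf (fun x => g (lam^-1 * x + 0)).
  move=> [mg [M hM]]; split; last by exists M => x; exact: hM.
  exact: meas_affine.
have supp (g : R -> R) : (forall x, (x < - m) || (m < x) -> g x = 0) ->
   forall x, (x < - (lam * m)) || (lam * m < x) -> g (lam^-1 * x + 0) = 0.
  move=> hg x hx; apply: hg; rewrite addr0 mulrC ltr_pdivrMr// ltr_pdivlMr//.
  by rewrite mulNr [m * lam]mulrC.
have b1 := baff _ bphi; have b2 := baff _ bdphi.
have i1 := L1_loc lf b1 (supp _ hm).
have i2 := L1_loc lF b2 (supp _ hm').
have bW := ac_bmf (WR_ac hA Tp).
have i3 : L1 (fun x => WR A x (lam * t0) * derive1 phi (lam^-1 * x + 0)).
  by apply: bL1M => //; exact: L1_affine.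
have e1 : \int[mu]_x (rescale lam u x t0 * phi x) =
    \int[mu]_x (f x * phi (lam^-1 * x + 0)).
  rewrite (Int_affine 0 lamn i1) (gtr0_norm lam0) -IntZ; last exact: (L1_affine 0 lamn i1).
  apply: eq_Rintegral => x _; rewrite /rescale -fE !addr0 mulrA.
  by rewrite mulrA mulVf// mul1r.
have e2 : \int[mu]_x (WR A x t0 * derive1 phi x) =
    lam^-1 * \int[mu]_x (WR A x (lam * t0) * derive1 phi (lam^-1 * x + 0)).
  rewrite (Int_affine 0 lamn i3) (gtr0_norm lam0) mulrA mulVf// mul1r.
  apply: eq_Rintegral => x _; rewrite !addr0 mulrA mulVf// mul1r; congr (_ * _).
  by rewrite WR_scale.
have e3 : \int[mu]_x (f x * phi (lam^-1 * x + 0)) =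
    - (lam^-1 * \int[mu]_x (F x * derive1 phi (lam^-1 * x + 0))).
  transitivity (\int[mu]_x (f x * phi (lam^-1 * x))).
    by apply: eq_Rintegral => x _; rewrite addr0.
  have e4 : \int[mu]_x (F x * (lam^-1 * derive1 phi (lam^-1 * x))) =
      \int[mu]_x (lam^-1 * (F x * derive1 phi (lam^-1 * x + 0))).
    by apply: eq_Rintegral => x _; rewrite addr0 mulrCA.
  by rewrite (wd _ tphil) dphil e4 IntZ.
rewrite e1 e2 e3 opprK [X in `|X|]addrC -mulrBr -IntB// normrM (gtr0_norm li) ler_pM2l//.
apply: le_trans (Int_norm _) _; first exact: L1B.
rewrite le_eqVlt; apply/orP; left; apply/eqP; apply: eq_Rintegral => x _.
by rewrite -mulrBl normrM.
Qed.

End rescaled_error.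

(** * The continuous representative of a viscous solution *)

Section from_solution.
Context {R : realType}.
Local Notation mu := (@lebesgue_measure R).

Lemma cvg_Lp1 (F : set_system R) (FF : Filter F) (f : R -> R -> R) (g : R -> R) :
  (\forall h \near F, L1 (f h)) -> (\forall h \near F, nrm (f h) = g h) ->
  Lpnorm 1%E (f h) @[h --> F] --> 0%E -> g h @[h --> F] --> 0.
Proof.
move=> f1 fg fc.
have fc' : fine (Lpnorm 1%E (f h)) @[h --> F] --> (0 : R) by exact: fine_cvg fc.
apply: cvg_trans fc'; apply: near_eq_cvg; apply: filterS2 f1 fg => h a b.
by rewrite Lp1//= b.
Qed.

Lemma nrm_ae (f g : R -> R) : measurable_fun setT f -> measurable_fun setT g ->
  {ae mu, forall x, f x = g x} -> nrm f = nrm g.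
Proof.
move=> mf mg fg; apply: Int_ae_eq.
- exact: measurableT_comp.
- exact: measurableT_comp.
- by apply: aeS fg => x ->.
Qed.

Variables (A eps : R) (V Vx : R -> R).
Hypotheses (hV : W11 V Vx).
Variables (u0 : R -> R) (u ux ut : R -> R -> R).
Hypotheses (c0 : C_L1 `[0, +oo[ u) (cux : C_W11 `]0, +oo[ u ux) (cut : C1_L1 `]0, +oo[ u ut)
  (ueq : forall t : R, 0 < t -> weak_derivative
            (fun x => eps * ux x t + u x t * conv (kernel' A V) (u^~ t) x) (ut^~ t))
  (ui : {ae @lebesgue_measure R, forall x, u x 0 = u0 x}) (u01 : L1 u0).

Let vx t x := ux x t.
Let vt t x := ut x t.
Let v t := prim (vx t).

Let pos (t : R) : 0 < t -> (`]0, +oo[%classic : set R) t.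
Proof. by rewrite /= in_itv/= andbT. Qed.

Let u1 (t : R) : 0 < t -> L1 (u^~ t).
Proof. by move=> /pos t0; have [c _ _] := cux; have [] := c t t0. Qed.

Let vx1 (t : R) : 0 < t -> L1 (vx t).
Proof. by move=> /pos t0; have [_ c _] := cux; have [] := c t t0. Qed.

Let vt1 (t : R) : 0 < t -> L1 (vt t).
Proof. by move=> /pos t0; have [_ c _] := cut; have [] := c t t0. Qed.

Let uv (t : R) : 0 < t -> {ae mu, forall x, u x t = v t x} /\ L1 (v t).
Proof.
move=> t0; have [_ _ w] := cux.
exact: (weak_derivative_ac (u1 t0) (vx1 t0) (w t (pos t0))).
Qed.

Let vb (t : R) : 0 < t -> bmf (v t).
Proof. by move=> t0; exact: bmf_prim (vx1 t0). Qed.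

Let flux (t : R) : 0 < t ->
  {ae mu, forall x, prim (vt t) x = eps * vx t x + v t x * vel A V (v t) x} /\ L1 (prim (vt t)).
Proof.
move=> t0; have [V1 _ _] := hV; have [uvt v1] := uv t0; have bv := vb t0.
have bs : measurable_fun setT (kernel' A V).
  apply: measurable_funD; last exact: L1_meas.
  apply: measurable_funM => //.
  have [m _] := @bmf_sg R 0; have n1 : (-1 : R) != 0 by rewrite oppr_eq0 oner_eq0.
  have := meas_affine 0 n1 m; congr (measurable_fun _ _); apply/funext => y.
  by rewrite mulN1r addr0 sub0r opprK.
have mu_ := L1_meas (u1 t0); have mv := L1_meas v1.
have e x : conv (kernel' A V) (u^~ t) x = vel A V (v t) x.
  by rewrite (conv_ae_r bs mu_ mv uvt) conv_kernel.
have bvel := ac_bmf (ac_vel A hV v1 bv).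
have raw1 : L1 (fun x => eps * ux x t + u x t * conv (kernel' A V) (u^~ t) x).
  under eq_fun do rewrite e.
  by apply: L1D; [apply: L1Z; exact: vx1|apply: L1Mb => //; exact: u1].
have [h1 h2] := weak_derivative_ac raw1 (vt1 t0) (ueq t0).
split=> //; apply: aeS (aeI uvt h1) => x [<- <-].
by rewrite e.
Qed.

(** The weak derivatives in the definition of a solution become absolutely
    continuous primitives by [weak_derivative_ac], once for [u] and once for the
    flux; the equation is then an identity between functions, and the convergences
    in L^1 do not see the change of representative. *)
Lemma flow_of_solution : viscous_flow A eps V v vx vt.
Proof.
split.
- by move=> t t0; exact: ac_prim (vx1 t0).
- by move=> t t0; have [] := uv t0.
- exact: vt1.
- by move=> t t0; have [] := flux t0.
- by move=> t t0; have [] := flux t0.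
- move=> t t0; have [_ _ c] := cut.
  apply: (@cvg_Lp1 _ _ (fun h x => (u x (t + h) - u x t) / h - ut x t)); last exact: c (pos t0).
    near=> h; have th : 0 < t + h by near: h; exact: near0_addr_gt0.
    apply: L1B; last exact: vt1.
    by under eq_fun do rewrite mulrC; apply: L1Z; apply: L1B; exact: u1.
  near=> h; have th : 0 < t + h by near: h; exact: near0_addr_gt0.
  have [a1 b1] := uv th; have [a2 b2] := uv t0.
  have q f g : L1 f -> L1 g -> measurable_fun setT (fun x => (f x - g x) / h - ut x t).
    move=> f1 g1; apply: L1_meas; apply: L1B; last exact: vt1.
    by under eq_fun do rewrite mulrC; apply: L1Z; exact: L1B.
  apply: nrm_ae; [exact: q (u1 th) (u1 t0)|exact: q b1 b2|].
  by apply: aeS (aeI a1 a2) => x [-> ->].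
- move=> t t0; have [c _ _] := cux; have [_ ct] := c t (pos t0).
  have gt0 : \forall s \near t, 0 < s by exact: lt_nbhsr.
  have ct' : Lpnorm 1%E (fun x => u x s - u x t) @[s --> t] --> 0%E.
    apply: cvg_trans ct; apply: cvg_app => P /= wP.
    near=> s; have : `]0, +oo[%classic s by apply: pos; near: s.
    by near: s.
  apply: (@cvg_Lp1 _ _ (fun s x => u x s - u x t)) ct'.
    by near=> s; apply: L1B; apply: u1 => //; near: s.
  near=> s; have s0 : 0 < s by near: s.
  have [a1 b1] := uv s0; have [a2 b2] := uv t0.
  apply: nrm_ae; [by apply: L1_meas; apply: L1B; exact: u1|by apply: L1_meas; exact: L1B|].
  by apply: aeS (aeI a1 a2) => x [-> ->].
- move=> t t0; have [_ c _] := cux; have [_ ct] := c t (pos t0).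
  have ct' : Lpnorm 1%E (fun x => ux x (t + h) - ux x t) @[h --> 0^'] --> 0%E.
    apply: (@cvg_comp _ _ _ (fun h => t + h) (fun s => Lpnorm 1%E (fun x => ux x s - ux x t)) _
      (within `]0, +oo[%classic (nbhs t))) ct.
    move=> P /= wP.
    have tc : t + h @[h --> 0^'] --> t.
      rewrite -[X in _ --> X]addr0; apply: cvgD; [exact: cvg_cst|exact: nbhs_dnbhs].
    have := tc _ wP; move=> /= wP'.
    near=> h; have : `]0, +oo[%classic (t + h) by apply: pos; near: h; exact: near0_addr_gt0.
    by near: h.
  apply: (@cvg_Lp1 _ _ (fun h x => ux x (t + h) - ux x t)) ct'.
    near=> h; have th : 0 < t + h by near: h; exact: near0_addr_gt0.
    by apply: L1B; exact: vx1.
  by near=> h.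
Unshelve. all: by end_near. Qed.

Lemma flow_initial : nrm (fun x => v s x - u0 x) @[s --> 0^'+] --> (0 : R).
Proof.
have z0 : (`[0, +oo[%classic : set R) 0 by rewrite /= in_itv/= lexx.
have [u00 ct] := c0 z0.
have ct' : Lpnorm 1%E (fun x => u x s - u x 0) @[s --> 0^'+] --> 0%E.
  apply: cvg_trans ct; apply: cvg_app => P /= wP.
  apply: (@filterS _ (nbhs (0 : R)) _ [set s | `[0, +oo[%classic s -> P s] [set s | 0 < s -> P s])
    wP => s /= h s0.
  by apply: h; rewrite in_itv/= andbT ltW.
apply: (@cvg_Lp1 _ _ (fun s x => u x s - u x 0)) ct'.
  near=> s; have s0 : 0 < s by near: s; exact: nbhs_right_gt.
  by apply: L1B => //; exact: u1.
near=> s; have s0 : 0 < s by near: s; exact: nbhs_right_gt.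
have [a1 b1] := uv s0.
apply: nrm_ae; [by apply: L1_meas; apply: L1B => //; exact: u1|by apply: L1_meas; exact: L1B|].
by apply: aeS (aeI a1 ui) => x [-> ->].
Unshelve. all: by end_near. Qed.

Lemma potential_weak (t : R) : 0 < t -> weak_derivative (potential v t) (u^~ t).
Proof.
move=> t0; have [a1 v1] := uv t0.
have acU := potential_ac flow_of_solution t0.
have bU := ac_bmf acU.
split.
- split; [by case: bU|exact: openT|move=> K _ cK].
  have /integrableP[] := @continuous_compact_integrable R (potential v t) K cK
    (continuous_subspaceT (ac_cont acU)).
  by [].
- by apply: open_integrable_locally (u1 t0); exact: openT.
- move=> phi tphi.
  have [dphi _ cdphi] := test_der tphi.
  have [bphi phi1 bdphi dphi1] := test_function_L1 tphi.
  have h := ac_int0 (ac_mul acU (ac_C1 dphi cdphi dphi1)) (bL1M bU phi1).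
  rewrite IntD in h; [|exact: L1Mb|exact: bL1M].
  have -> : \int[mu]_x (u x t * phi x) = \int[mu]_x (v t x * phi x).
    apply: Int_ae_eq; [by apply: L1_meas; apply: L1Mb => //; exact: u1|by apply: L1_meas; exact: L1Mb|].
    by apply: aeS a1 => x ->.
  lra.
Qed.

End from_solution.

(** * The two limits *)

Section conclusion.
Context {R : realType}.
Local Notation mu := (@lebesgue_measure R).

(** By [rescaled_error] the error is at most [1 / lam] times the integral of the
    deviation at the time [lam * t0] against the dilated test function, which is
    at most a multiple of the weight.  Young's inequality bounds it by
    [mod_energy / lam], which tends to zero, plus an arbitrarily small
    constant. *)
Lemma viscous_limit (A eps : R) (V Vx u0 : R -> R) (u : R -> R -> R) (phi : R -> R) (t0 : R) :
  0 < A -> 0 <= eps -> W11 V Vx -> nrm Vx < A ->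
  L1 u0 -> {ae mu, forall x, 0 <= u0 x} -> \int[mu]_x u0 x = 1 ->
  viscous_solution A V eps u0 u -> test_function phi -> 0 < t0 ->
  \int[mu]_x (rescale lam u x t0 * phi x) @[lam --> +oo] -->
    - \int[mu]_x (WR A x t0 * derive1 phi x).
Proof.
move=> hA heps hV hVx u01 u0p u0m [ux [ut [c0 cux cut ueq ui]]] tphi t00.
pose vx t x := ux x t; pose vt t x := ut x t; pose v t := prim (vx t).
have fl := flow_of_solution hV cux cut ueq.
have ui' := flow_initial c0 cux ui u01.
have [m m0 hm] := test_supp tphi.
have [_ _ cdphi] := test_der tphi.
have hm' := derive1_supp hm.
have [K hK] := bounded_cont m cdphi.
have K0 : 0 <= K by apply: le_trans (hK 0 _); rewrite ?normr0.
pose P1 := \int[mu]_x (oneDsqr x : R)^-1.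
have P10 : 0 <= P1.
  by apply: Int_ge0 => x; rewrite invr_ge0 (le_trans _ (oneDsqr_ge1 x)).
pose C := K * oneDsqr m + 1.
have om : 1 <= oneDsqr m by exact: oneDsqr_ge1.
have C0 : 0 < C by rewrite /C ltr_pwDr// mulr_ge0// (le_trans _ om).
have phiC z : `|derive1 phi z| <= C * (oneDsqr z)^-1.
  have oz : 0 < oneDsqr z by rewrite (lt_le_trans ltr01)// oneDsqr_ge1.
  have [/hm' ->|] := boolP ((z < - m) || (m < z)).
    by rewrite normr0 mulr_ge0 ?invr_ge0 ?(ltW C0) ?(ltW oz).
  rewrite negb_or -!leNgt => /andP[z1 z2].
  have zm : `|z| <= m by rewrite ler_norml z1.
  rewrite ler_pdivlMr//; apply: (@le_trans _ _ (K * oneDsqr m)); last by rewrite lerDl.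
  apply: ler_pM; [exact: normr_ge0|exact: ltW|exact: (hK z zm)|].
  by rewrite lerD2l -[leLHS]real_normK ?num_real// ler_sqr ?nnegrE.
apply/cvgrPdist_le => e e0.
(* in [d <= k d ^+ 2 + 1 / (4 k)] this [k] makes the last term contribute less
   than [e / 2] *)
have [k kE] : exists k, k = C * (P1 + 1) / (2 * e) by exists (C * (P1 + 1) / (2 * e)).
have k0 : 0 < k by rewrite kE divr_gt0 ?mulr_gt0//; lra.
have d0 : 0 < e / (2 * C * k) by rewrite divr_gt0 ?mulr_gt0.
have hE := mod_energy_small hA heps hV hVx fl u01 u0p u0m ui' t00 d0.
near=> lam.
have lam0 : 0 < lam by near: lam; exact: nbhs_pinfty_gt.
have li : 0 < lam^-1 by rewrite invr_gt0.
have T0 : 0 < lam * t0 by rewrite mulr_gt0.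
have E1 : mod_energy A v lam (lam * t0) <= e / (2 * C * k) * lam by near: lam; exact: hE.
have wd := potential_weak hV cux cut ueq T0.
apply: le_trans (rescaled_error hA t00 lam0 tphi wd) _.
have bD := ac_bmf (deviation_ac hA fl T0).
have rho1 := L1_wgt lam0.
have rho0 x : 0 <= wgt lam x by exact: ltW (wgt_gt0 lam x).
have lin : lam^-1 != 0 by rewrite gt_eqF.
have [_ _ bdphi dphi1] := test_function_L1 tphi.
have dl1 := L1_abs (L1_affine 0 lin dphi1).
pose G x := C * (k * (deviation A v (lam * t0) x ^+ 2 * wgt lam x) + (4 * k)^-1 * wgt lam x).
have i1 : L1 (fun x => deviation A v (lam * t0) x ^+ 2 * wgt lam x) by apply: bL1M => //; bm.
have G1 : L1 G by apply: L1Z; apply: L1D; exact: L1Z.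
have IG : \int[mu]_x (`|deviation A v (lam * t0) x| * `|derive1 phi (lam^-1 * x + 0)|) <= \int[mu]_x G x.
  apply: Int_le => [||x]; [by apply: bL1M => //; bm|exact: G1|].
  apply: (@le_trans _ _ (`|deviation A v (lam * t0) x| * (C * wgt lam x))).
    by rewrite ler_wpM2l//; exact: phiC.
  rewrite /G mulrCA ler_wpM2l ?(ltW C0)// mulrA -mulrDl ler_wpM2r//.
  rewrite -[X in _ <= k * X + _]real_normK ?num_real//.
  set d := `|_|; rewrite -subr_ge0.
  rewrite (_ : _ - _ = k * (d - (2 * k)^-1) ^+ 2); last by field; rewrite gt_eqF.
  by rewrite mulr_ge0 ?sqr_ge0 ?(ltW k0).
apply: (@le_trans _ _ (lam^-1 * \int[mu]_x G x)); first by rewrite ler_pM2l//.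
have -> : \int[mu]_x G x = C * (k * mod_energy A v lam (lam * t0) + (4 * k)^-1 * (lam * P1)).
  rewrite IntZ; last by apply: L1D; exact: L1Z.
  by rewrite IntD; [rewrite !IntZ// Int_wgt|exact: L1Z..].
have a1 : lam^-1 * (C * (k * mod_energy A v lam (lam * t0))) <= e / 2.
  rewrite mulrC ler_pdivrMr//.
  apply: (@le_trans _ _ (C * (k * (e / (2 * C * k) * lam)))).
    by rewrite ler_pM2l// ler_pM2l.
  rewrite le_eqVlt; apply/orP; left; apply/eqP; field.
  by rewrite !gt_eqF.
have a2 : lam^-1 * (C * ((4 * k)^-1 * (lam * P1))) <= e / 2.
  have -> : lam^-1 * (C * ((4 * k)^-1 * (lam * P1))) = C * P1 / (4 * k).
    by field; rewrite !gt_eqF.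
  rewrite ler_pdivrMr ?mulr_gt0// kE.
  have -> : e / 2 * (4 * (C * (P1 + 1) / (2 * e))) = C * (P1 + 1).
    by field; rewrite gt_eqF.
  by rewrite ler_pM2l// lerDl.
rewrite mulrDr mulrDr; lra.
Unshelve. all: by end_near. Qed.

Lemma sup_norm_bound (f : R -> R) (M : R) : (Lpnorm +oo f <= M%:E)%E ->
  {ae mu, forall x, `|f x| <= M}.
Proof.
have muT : (0 < mu setT)%E by rewrite -set_itvNyy lebesgue_measure_itv/= ltry.
rewrite /Lpnorm unlock muT => /ess_supP h.
by move: h; apply: aeS => x /=; rewrite lee_fin.
Qed.

(** The case [p = +oo] of the decay rate; the logarithm is eventually below [k t]
    for every [k > 0], by [exp s >= 1 + s ^+ 2 / 2]. *)
Lemma decay_vanish (C e : R) : 0 < C -> 0 < e ->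
  \forall t \near +oo, C * t `^ (- (2^-1 * (1 - 0))) * ln (2 + t) `^ (2^-1 * (1 + 0)) <= e.
Proof.
move=> C0 e0; rewrite subr0 addr0 mulr1.
pose k := (e / C) ^+ 2.
have k0 : 0 < k by rewrite exprn_gt0// divr_gt0.
near=> t.
have t1 : 1 <= t by near: t; apply: nbhs_pinfty_ge; exact: num_real.
have tk : 4 / k ^+ 2 <= t by near: t; apply: nbhs_pinfty_ge; exact: num_real.
have t0 : 0 < t by lra.
have t2 : 1 < 2 + t by lra.
have l0 : 0 <= ln (2 + t) by rewrite ln_ge0// ltW.
have lnk : ln (2 + t) <= k * t.
  rewrite -ler_expR lnK ?posrE; last lra.
  have kt : 0 <= k * t by rewrite mulr_ge0 ?ltW.
  apply: le_trans (expR_ge1Dxn 1 kt).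
  have : 4 <= k ^+ 2 * t by rewrite mulrC -ler_pdivrMr// exprn_gt0.
  move=> h; have : 4 * t <= k ^+ 2 * t * t by rewrite ler_wpM2r// ltW.
  by rewrite (_ : (2`!)%:R = 2 :> R)// (_ : (k * t) ^+ 2 = k ^+ 2 * t * t); [lra|ring].
rewrite powRN !powR12_sqrt ?(ltW t0)//.
rewrite -mulrA -ler_pdivlMl// mulrC ler_pdivrMr ?sqrtr_gt0//.
have -> : C^-1 * e = Num.sqrt k by rewrite /k sqrtr_sqr ger0_norm ?divr_ge0 ?ltW// mulrC.
by rewrite -sqrtrM ?(ltW k0)// ler_sqrt// mulr_ge0 ?ltW.
Unshelve. all: by end_near. Qed.

(** The decay estimate in the sup norm at the time [lam * t0], integrated against
    the dilated derivative of the test function, whose L^1 norm is [lam] times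
    that of the original one. *)
Lemma inviscid_limit (A : R) (Vx u0 : R -> R) (u : R -> R -> R) (phi : R -> R) (t0 : R) :
  0 < A -> inviscid_solution A Vx u0 u -> test_function phi -> 0 < t0 ->
  \int[mu]_x (rescale lam u x t0 * phi x) @[lam --> +oo] -->
    - \int[mu]_x (WR A x t0 * derive1 phi x).
Proof.
move=> hA [U [_ wd _ _ [C C0 est]]] tphi t00.
have [m m0 hm] := test_supp tphi.
have hm' := derive1_supp hm.
have [_ _ bdphi dphi1] := test_function_L1 tphi.
have n0 := nrm_ge0 (derive1 phi).
apply/cvgrPdist_le => e e0.
have n1 : 0 < nrm (derive1 phi) + 1 by rewrite ltr_wpDl.
have e1 : 0 < e / (nrm (derive1 phi) + 1) by rewrite divr_gt0.
have ratio : e / (nrm (derive1 phi) + 1) * nrm (derive1 phi) <= e.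
  by rewrite mulrAC ler_pdivrMr// ler_pM2l// lerDl.
have [M [Mr hM]] := decay_vanish C0 e1.
near=> lam.
have lam0 : 0 < lam by near: lam; exact: nbhs_pinfty_gt.
have lamM : M < lam * t0.
  by rewrite -ltr_pdivrMr//; near: lam; apply: nbhs_pinfty_gt; exact: num_real.
have T0 : 0 < lam * t0 by rewrite mulr_gt0.
have lin : lam^-1 != 0 by rewrite gt_eqF// invr_gt0.
have li : 0 < lam^-1 by rewrite invr_gt0.
have wdT := wd _ T0.
apply: le_trans (rescaled_error hA t00 lam0 tphi wdT) _.
have := est (lam * t0) +oo%E T0 (ltry 1); rewrite invey/= => /sup_norm_bound hs.
have hMT := hM _ lamM.
have dl1 := L1_affine 0 lin dphi1.
have dla := L1_abs dl1.
have supp x : (x < - (lam * m)) || (lam * m < x) -> `|derive1 phi (lam^-1 * x + 0)| = 0.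
  move=> hx; apply/normr0P/eqP; apply: hm'.
  by rewrite addr0 mulrC ltr_pdivrMr// ltr_pdivlMr// mulNr [m * lam]mulrC.
have bdl : bmf (fun x => `|derive1 phi (lam^-1 * x + 0)|).
  apply: bmf_abs; have [mm [K hK]] := bdphi; split; last by exists K => x; exact: hK.
  exact: meas_affine.
have [lF _ _] := wdT; have mF : measurable_fun setT (U^~ (lam * t0)) by case: lF.
have bW := ac_bmf (WR_ac hA T0).
have i1 : L1 (fun x => `|U x (lam * t0) - WR A x (lam * t0)| * `|derive1 phi (lam^-1 * x + 0)|).
  have a1 := L1_loc lF bdl supp.
  have a2 : L1 (fun x => WR A x (lam * t0) * `|derive1 phi (lam^-1 * x + 0)|) by l1.
  have := L1_abs (L1B a1 a2); congr (L1 _); apply/funext => x.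
  by rewrite -mulrBl normrM normr_id.
pose b := e / (nrm (derive1 phi) + 1).
apply: (@le_trans _ _ (lam^-1 * \int[mu]_x (b * `|derive1 phi (lam^-1 * x + 0)|))).
  rewrite ler_pM2l//; apply: Int_ae_le => //; first exact: L1Z.
  apply: aeS hs => x hx; rewrite ler_wpM2r//; exact: le_trans hx hMT.
have -> : lam^-1 * \int[mu]_x (b * `|derive1 phi (lam^-1 * x + 0)|) = b * nrm (derive1 phi).
  rewrite (IntZ b dla).
  rewrite mulrCA.
  congr (_ * _).
  rewrite -{1}(gtr0_norm li).
  by apply/esym; exact: (Int_affine 0 lin (L1_abs dphi1)).
exact: ratio.
Unshelve. all: by end_near. Qed.

End conclusion.

Theorem mainTheorem4 (R : realType) (A : R) (V Vx : R -> R) (u0 : R -> R)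
    (eps : R) (u : R -> R -> R)
    (hA : 0 < A)
    (hV : W11 V Vx)
    (hVx : (Lpnorm 1 Vx < A%:E)%E)
    (hu0 : L1 u0)
    (hu0_ge0 : {ae @lebesgue_measure R, forall x, 0 <= u0 x})
    (hu0_mass : \int[@lebesgue_measure R]_x u0 x = 1)
    (heps : 0 <= eps)
    (hmoment : eps = 0 -> L1 (fun x => u0 x * `|x|))
    (hu : is_solution A V Vx eps u0 u) :
  forall phi : R -> R, test_function phi ->
  forall t0 : R, 0 < t0 ->
    \int[@lebesgue_measure R]_x (rescale lambda u x t0 * phi x)
      @[lambda --> +oo]
    --> - \int[@lebesgue_measure R]_x (WR A x t0 * derive1 phi x).
Proof.
move=> phi tphi t0 t00; have [hvis hinv] := hu.
have [eps0|eps0] := eqVneq eps 0; first exact: inviscid_limit hA (hinv eps0) tphi t00.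
have [_ Vx1 _] := hV.
have hVx' : nrm Vx < A by rewrite -lte_fin -Lp1.
apply: (viscous_limit hA heps hV hVx' hu0 hu0_ge0 hu0_mass) => //.
by apply: hvis; rewrite lt_neqAle eq_sym eps0.
Qed.
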